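(* Let $G_1$ and $G_2$ be countable groups and $\Gamma=G_1\times G_2$. The following are equivalent: (1) there is a non-degenerate probability measure $\nu$ on $\Gamma$ such that the Poisson–Furstenberg boundary $\partial(\Gamma,\nu)$ is non-trivial while the boundaries $\partial(G_1,\mathrm{pr}_1(\nu))$ and $\partial(G_2,\mathrm{pr}_2(\nu))$ are both trivial; (2) $G_1$ and $G_2$ are both amenable and each of them has a non-trivial ICC factor group.
   Context: A probability measure $\nu$ on a countable group $G$ is non-degenerate if its support generates $G$ as a semigroup. A group is ICC if every non-identity element has an infinite conjugacy class; an ICC factor group of $G$ is a quotient $G/N$ which is ICC. The Poisson–Furstenberg boundary $\partial(G,\nu)$ is the space of ergodic components of the time shift on the trajectory space of the $\nu$-random walk $Z_n=X_1\cdots X_n$ ($X_i$ i.i.d. with law $\nu$); it is trivial if the corresponding $\sigma$-algebra is trivial mod 0. $\mathrm{pr}_j$ is the coordinate projection $G_1\times G_2\to G_j$. *)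

(* Defs.v *)
From HB Require Import structures.
From mathcomp Require Import all_boot all_order all_algebra.
From mathcomp Require Import all_classical all_reals all_analysis.
From mathcomp Require Import Rstruct.
From Stdlib Require Rdefinitions.
Notation R := Rdefinitions.R.

Set Implicit Arguments.
Unset Strict Implicit.
Unset Printing Implicit Defensive.

Import Order.TTheory GRing.Theory Num.Theory.
Local Open Scope classical_set_scope.
Local Open Scope ring_scope.

Notation gmul := (@monoid.mul _).
Notation gone := (@monoid.one _).
Notation ginv := (@monoid.inv _).

Definition countable_group (G : groupType) : Prop :=
  exists f : G -> nat, injective f.

Definition prodG (G1 G2 : groupType) : Type := (G1 * G2)%type.
HB.instance Definition _ (G1 G2 : groupType) :=
  Choice.on (prodG G1 G2).

Section Prod.
Variables G1 G2 : groupType.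
Let T := prodG G1 G2.
Definition prodG_one : T := (gone, gone).
Definition prodG_inv (x : T) : T := (ginv x.1, ginv x.2).
Definition prodG_mul (x y : T) : T := (gmul x.1 y.1, gmul x.2 y.2).
Fact prodG_mulA : associative prodG_mul.
Proof. by move=> [? ?] [? ?] [? ?]; rewrite /prodG_mul /= !monoid.mulgA. Qed.
Fact prodG_mul1 : left_id prodG_one prodG_mul.
Proof. by move=> [? ?]; rewrite /prodG_mul /= !monoid.mul1g. Qed.
Fact prodG_mulg1 : right_id prodG_one prodG_mul.
Proof. by move=> [? ?]; rewrite /prodG_mul /= !monoid.mulg1. Qed.
Fact prodG_mulV : left_inverse prodG_one prodG_inv prodG_mul.
Proof. by move=> [? ?]; rewrite /prodG_mul /= !monoid.mulVg. Qed.
Fact prodG_mulgV : right_inverse prodG_one prodG_inv prodG_mul.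
Proof. by move=> [? ?]; rewrite /prodG_mul /= !monoid.mulgV. Qed.
End Prod.

HB.instance Definition _ (G1 G2 : groupType) :=
  monoid.isGroup.Build (prodG G1 G2) (@prodG_mulA G1 G2) (@prodG_mul1 G1 G2)
    (@prodG_mulg1 G1 G2) (@prodG_mulV G1 G2) (@prodG_mulgV G1 G2).



Section Walks.
Variable G : groupType.

Definition prob_mass (nu : G -> R) : Prop :=
  (forall g, 0 <= nu g) /\ (\esum_(g in [set: G]) (nu g)%:E = 1%E).

Definition non_degenerate (nu : G -> R) : Prop :=
  forall g : G, exists s : seq G,
    s <> [::] /\ (forall x, x \in s -> 0 < nu x) /\ foldr gmul gone s = g.

Definition cylinders : set (set (nat -> G)) :=
  [set A | exists n g, A = [set z | z n = g]].
Definition path_measurable (A : set (nat -> G)) : Prop := <<s cylinders >> A.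

Definition shift (z : nat -> G) : nat -> G := fun n => z n.+1.
Definition shift_invariant (A : set (nat -> G)) : Prop := shift @^-1` A = A.

Definition iid_law (nu : G -> R) d (T : measurableType d)
    (P : probability T R) (X : nat -> T -> G) : Prop :=
  [/\ forall i g, measurable (X i @^-1` [set g]),
      forall i g, P (X i @^-1` [set g]) = (nu g)%:E &
      forall (n : nat) (B : nat -> set G),
        P (\bigcap_(i in `I_n) X i @^-1` B i)
        = \big[*%E/1%E]_(i < n) P (X i @^-1` B i)].

Definition walk (T : Type) (X : nat -> T -> G) (w : T) : nat -> G :=
  fun n => foldr gmul gone [seq X i w | i <- iota 0 n].

(* triviality of the Poisson boundary: the shift-invariant sigma-algebra of
   the trajectory space of the nu-random walk is trivial mod 0 *)
Definition boundary_trivial (nu : G -> R) : Prop :=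
  forall d (T : measurableType d) (P : probability T R) (X : nat -> T -> G),
    iid_law nu P X ->
    forall A : set (nat -> G), path_measurable A -> shift_invariant A ->
      P [set w | A (walk X w)] = 0%E \/ P [set w | A (walk X w)] = 1%E.

Definition amenable : Prop :=
  exists m : set G -> R,
    [/\ m [set: G] = 1,
        forall A, 0 <= m A,
        forall A B, A `&` B = set0 -> m (A `|` B) = m A + m B &
        forall g A, m [set gmul g x | x in A] = m A].

Definition normal_subgroup (N : set G) : Prop :=
  [/\ N gone,
      forall x y, N x -> N y -> N (gmul x y),
      forall x, N x -> N (ginv x) &
      forall g x, N x -> N (gmul (gmul g x) (ginv g))].

Definition coset (N : set G) (x : G) : set G := [set y | N (gmul (ginv x) y)].

Definition quotient_ICC (N : set G) : Prop :=
  forall g : G, ~ N g ->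
    ~ finite_set [set coset N (gmul (gmul h g) (ginv h)) | h in [set: G]].

Definition has_nontrivial_ICC_factor : Prop :=
  exists N : set G, [/\ normal_subgroup N, N <> [set: G] & quotient_ICC N].

End Walks.

Definition pr1_mass (G1 G2 : groupType) (nu : prodG G1 G2 -> R) : G1 -> R :=
  fun a => fine (\esum_(b in [set: G2]) (nu (a, b))%:E).
Definition pr2_mass (G1 G2 : groupType) (nu : prodG G1 G2 -> R) : G2 -> R :=
  fun b => fine (\esum_(a in [set: G1]) (nu (a, b))%:E).

(* Main.v *)
(* For a non-degenerate measure the boundary is trivial iff the measure is Liouville: bounded
   harmonic functions are constant. One direction follows from Ville's maximal inequality, the other
   from the fact that an invariant event has a constant conditional probability given any finite
   piece of the walk, hence is independent of itself.

   (1) => (2). On a Liouville group, Banach limits of Cesaro means of the laws of the walk give an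
   invariant mean. If [h] is bounded harmonic on the product, [h (Z_n g) - h (Z_n)] tends to 0 in L^2
   for every [g]; hence [h] is invariant under every element whose conjugacy class is finite modulo
   elements already known to preserve [h]. The elements of [G2] that preserve [h] thus form a normal
   subgroup with ICC quotient. If [G2] has no non-trivial ICC factor, [h] descends to [G1], where
   it is constant.

   (2) => (1). Take [nu = sum_m p_m theta_m] with heavy tails. Half of [theta_m] charges pairs
   [(a, psi a)] where [a] follows a measure on [G1] almost invariant under everything the walk did
   at lower levels, and the [psi a] are chosen one after another, each generic in [G2 / N2]; the
   other half is the same with the factors exchanged. At the first step of level at least [m] each
   marginal walk forgets its past with probability about 1/2, so the oscillation [D] of a harmonic
   function satisfies [D <= D / 2]. In the product, genericity (here the ICC property is used: an
   invariant mean does not charge [{a | a^-1 k a in r N}]) makes [k] readable modulo [N1 x N2] from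
   [k a r]; since record levels are attained only once with high probability, the walk remembers
   its starting point modulo [N1 x N2]. *)
Require Import Defs.
From HB Require Import structures.
From mathcomp Require Import all_boot all_order all_algebra.
From mathcomp Require Import all_classical all_reals all_analysis.
From mathcomp Require Import Rstruct Rstruct_topology.
From mathcomp Require Import ring lra.

Set Implicit Arguments.
Unset Strict Implicit.
Unset Printing Implicit Defensive.

Import Order.TTheory GRing.Theory Num.Theory.
Import numFieldNormedType.Exports.
Local Open Scope classical_set_scope.
Local Open Scope ring_scope.

(** * Expectation for a mass function *)

(** [boundary_trivial] quantifies over all realisations of the increments, so one has to exist
    before it can be exploited; the digits of a uniform number provide it. In (2) => (1) two demands
    conflict: each marginal must forget, which calls for almost invariant steps, and the product
    must remember, so no step may hide the position it is applied to. Graphs reconcile them: the law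
    of [(a, psi a)] is almost invariant on one factor, while the label [psi a] tells which [a] was
    used. On the labelled factor nothing is averaged, so each marginal forgets only half of the
    time; this suffices because a factor 1/2 on the oscillation can be iterated. The conditional
    probabilities [rlev m] obey opposite constraints: their sum diverges, since [qlev m], the
    product of the [1 - rlev j] for [j < m], must tend to 0, but the sum of their squares is small,
    since a repeated record spoils the decoding. The order [1/m] does both. Means and hitting laws
    are functionals on bounded functions, obtained from one fixed limit [LIM]; path measures occur
    only in the two passages between boundary and Liouville property. *)

Definition bnd (T : Type) (f : T -> R) : Prop := exists M, forall x, `|f x| <= M.

Lemma bnd_ge0 (T : Type) (f : T -> R) :
  bnd f -> exists2 M, 0 <= M & forall x, `|f x| <= M.
Proof.
move=> [M hM]; exists `|M| => [|x]; first exact: normr_ge0.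
exact: le_trans (hM x) (ler_norm _).
Qed.

Lemma bnd_cst (T : Type) (c : R) : bnd (fun _ : T => c).
Proof. by exists `|c|. Qed.

Lemma bnd_comp (S T : Type) (f : T -> R) (g : S -> T) :
  bnd f -> bnd (fun x => f (g x)).
Proof. by move=> [M hM]; exists M. Qed.

Lemma bndD (T : Type) (f g : T -> R) : bnd f -> bnd g -> bnd (fun x => f x + g x).
Proof.
move=> [M hM] [N hN]; exists (M + N) => x.
by apply: le_trans (ler_normD _ _) _; apply: lerD.
Qed.

Lemma bndM (T : Type) (f g : T -> R) : bnd f -> bnd g -> bnd (fun x => f x * g x).
Proof.
move=> [M hM] [N hN]; exists (M * N) => x.
by rewrite normrM; apply: ler_pM.
Qed.

Lemma bndN (T : Type) (f : T -> R) : bnd f -> bnd (fun x => - f x).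
Proof. by move=> [M hM]; exists M => x; rewrite normrN. Qed.

Lemma bndB (T : Type) (f g : T -> R) : bnd f -> bnd g -> bnd (fun x => f x - g x).
Proof. by move=> hf hg; apply: bndD => //; apply: bndN. Qed.

Lemma bndX2 (T : Type) (f : T -> R) : bnd f -> bnd (fun x => f x ^+ 2).
Proof. by move=> hf; under [X in bnd X]eq_fun do rewrite expr2; exact: bndM. Qed.

Lemma bnd_unit (T : Type) (f : T -> R) : (forall x, 0 <= f x <= 1) -> bnd f.
Proof. by move=> h; exists 1 => x; have /andP[h0 h1] := h x; rewrite ger0_norm. Qed.

Lemma bnd_ind (T : Type) (A : set T) : bnd (\1_A : T -> R).
Proof.
by apply: bnd_unit => x; rewrite indicE ler0n lern1 leq_b1.
Qed.

Lemma esumZ (T : choiceType) (D : set T) (c : R) (a : T -> R) :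
  0 <= c -> (forall x, 0 <= a x) ->
  (\esum_(x in D) (c * a x)%:E = c%:E * \esum_(x in D) (a x)%:E)%E.
Proof.
have half (d : R) (b : T -> R) : 0 <= d -> (forall x, 0 <= b x) ->
  (\esum_(x in D) (d * b x)%:E <= d%:E * \esum_(x in D) (b x)%:E)%E.
  move=> d0 b0; apply: ge_ereal_sup => _ [A hA <-].
  under eq_fsbigr do rewrite EFinM.
  rewrite -ge0_mule_fsumr; last by move=> x; rewrite lee_fin.
  by apply: lee_wpmul2l; [rewrite lee_fin|apply: ereal_sup_ubound; exists A].
move=> c0 a0; apply/eqP; rewrite eq_le half//=.
have [->|cn0] := eqVneq c 0.
  by rewrite mul0e; apply: esum_ge0 => x _; rewrite mul0r.
have {cn0}c0 : 0 < c by rewrite lt_neqAle eq_sym cn0.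
(* The reverse inequality is the one just proved, for [c^-1] and [c * a]. *)
have := half c^-1 (fun x => c * a x); rewrite invr_ge0 ltW// => /(_ isT).
move=> /(_ (fun x => mulr_ge0 (ltW c0) (a0 x))).
under eq_esum do rewrite mulKf ?gt_eqF//.
move=> /(lee_wpmul2l (x := c%:E)); rewrite lee_fin ltW// => /(_ isT).
by rewrite muleA -EFinM mulfV ?gt_eqF// mul1e.
Qed.

(** Positive and negative parts are summed separately, to stay within nonnegative sums. Since [fine]
    sends an infinite sum to 0, the value is a true expectation only when both sums are finite;
    [bnd] ensures this for a probability. *)
Definition Ex (T : choiceType) (nu f : T -> R) : R :=
  fine (\esum_(x in [set: T]) (nu x * Num.max (f x) 0)%:E) -
  fine (\esum_(x in [set: T]) (nu x * Num.max (- f x) 0)%:E).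

Section Expectation.
Variables (T : choiceType) (nu : T -> R).
Hypothesis nu0 : forall x, 0 <= nu x.
Hypothesis nu1 : (\esum_(x in [set: T]) (nu x)%:E = 1)%E.

Let S (f : T -> R) := (\esum_(x in [set: T]) (nu x * f x)%:E)%E.

Let S_fin (f : T -> R) : (forall x, 0 <= f x) -> bnd f -> S f \is a fin_num.
Proof.
move=> f0 /bnd_ge0[M M0 hM].
have S0 : (0 <= S f)%E by apply: esum_ge0 => x _; rewrite lee_fin mulr_ge0.
rewrite ge0_fin_numE//; apply: (@le_lt_trans _ _ M%:E); last exact: ltry.
rewrite -[leRHS]mule1 -nu1 -esumZ//; apply: le_esum => x _.
rewrite lee_fin mulrC; apply: ler_wpM2r => //.
exact: le_trans (ler_norm _) (hM x).
Qed.

Let SD (f g : T -> R) : (forall x, 0 <= f x) -> (forall x, 0 <= g x) ->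
  (S (fun x => (f x + g x)%R) = S f + S g)%E.
Proof.
move=> f0 g0; rewrite /S -esumD; last first.
- by move=> x _; rewrite lee_fin mulr_ge0.
- by move=> x _; rewrite lee_fin mulr_ge0.
by apply: eq_esum => x _; rewrite -EFinD mulrDr.
Qed.

Let bnd_max (f : T -> R) : bnd f -> bnd (fun x => Num.max (f x) 0).
Proof.
move=> [M hM]; exists M => x; apply: le_trans (hM x).
by case: (leP (f x) 0) => h; rewrite ?normr0.
Qed.

Let max_ge0 (r : R) : 0 <= Num.max r 0. Proof. by rewrite le_max lexx orbT. Qed.

Lemma Ex_ge0E (f : T -> R) : (forall x, 0 <= f x) -> bnd f -> (Ex nu f)%:E = S f.
Proof.
move=> f0 bf; rewrite /Ex.
have -> : (\esum_(x in [set: T]) (nu x * Num.max (- f x) 0)%:E = 0)%E.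
  by apply: esum1 => x _; rewrite max_r ?mulr0// oppr_le0.
rewrite subr0; under eq_esum do rewrite max_l//.
by rewrite fineK// S_fin.
Qed.

(** Any splitting into bounded nonnegative parts computes the expectation, because
    [f^+ + b = a + f^-]. Additivity needs this freedom: the positive part of a sum is not the sum of
    the positive parts. *)
Let Ex_decomp (a b : T -> R) : (forall x, 0 <= a x) -> (forall x, 0 <= b x) ->
  bnd a -> bnd b -> Ex nu (fun x => a x - b x) = fine (S a) - fine (S b).
Proof.
move=> a0 b0 ba bb; pose f x := a x - b x.
have bf : bnd f by exact: bndB.
have bf' : bnd (fun x => - f x) by exact: bndN.
have e : (S (fun x => Num.max (f x) 0%R) + S b = S a + S (fun x => Num.max (- f x)%R 0%R))%E.
  rewrite -!SD//; apply: eq_esum => x _; congr (nu x * _)%:E.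
  by rewrite /f; case: (leP (a x - b x) 0) => h1;
    case: (leP (- (a x - b x)) 0) => h2; lra.
have := congr1 fine e; rewrite !fineD ?S_fin//; [|exact: bnd_max..].
by rewrite /Ex -/f /S => h; lra.
Qed.

Let posneg (f : T -> R) x : f x = Num.max (f x) 0 - Num.max (- f x) 0.
Proof. by case: (leP (f x) 0) => h1; case: (leP (- f x) 0) => h2; lra. Qed.

Lemma ExD (f g : T -> R) : bnd f -> bnd g ->
  Ex nu (fun x => f x + g x) = Ex nu f + Ex nu g.
Proof.
move=> bf bg; have bf' := bndN bf; have bg' := bndN bg.
rewrite (_ : (fun x => f x + g x) = fun x =>
  (Num.max (f x) 0 + Num.max (g x) 0) - (Num.max (- f x) 0 + Num.max (- g x) 0)).
  rewrite Ex_decomp; last first.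
  - by apply: bndD; exact: bnd_max.
  - by apply: bndD; exact: bnd_max.
  - by move=> x; rewrite addr_ge0.
  - by move=> x; rewrite addr_ge0.
  rewrite !SD// !fineD ?S_fin//; [|exact: bnd_max..].
  by rewrite /Ex /S; lra.
by apply/funext => x; rewrite {1}(posneg f x) {1}(posneg g x); lra.
Qed.

Lemma ExN (f : T -> R) : bnd f -> Ex nu (fun x => - f x) = - Ex nu f.
Proof.
move=> bf; rewrite /Ex opprB.
by under [in X in _ - X]eq_esum do rewrite opprK.
Qed.

Lemma ExB (f g : T -> R) : bnd f -> bnd g ->
  Ex nu (fun x => f x - g x) = Ex nu f - Ex nu g.
Proof. by move=> bf bg; rewrite ExD ?ExN//; exact: bndN. Qed.

Lemma Ex_ge0 (f : T -> R) : (forall x, 0 <= f x) -> bnd f -> 0 <= Ex nu f.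
Proof.
move=> f0 bf; rewrite -lee_fin Ex_ge0E//.
by apply: esum_ge0 => x _; rewrite lee_fin mulr_ge0.
Qed.

Lemma Ex_le (f g : T -> R) : bnd f -> bnd g -> (forall x, f x <= g x) ->
  Ex nu f <= Ex nu g.
Proof.
move=> bf bg h; rewrite -subr_ge0 -ExB//; apply: Ex_ge0; last exact: bndB.
by move=> x; rewrite subr_ge0.
Qed.

Let ExZ_ge0 (c : R) (f : T -> R) : 0 <= c -> (forall x, 0 <= f x) -> bnd f ->
  Ex nu (fun x => c * f x) = c * Ex nu f.
Proof.
move=> c0 f0 bf; have bc : bnd (fun x => c * f x) by apply: bndM => //; exact: bnd_cst.
apply/EFin_inj; rewrite EFinM !Ex_ge0E//; last by move=> x; rewrite mulr_ge0.
rewrite /S -esumZ//; last by move=> x; rewrite mulr_ge0.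
by apply: eq_esum => x _; rewrite mulrCA.
Qed.

Let ExZ_pos (c : R) (f : T -> R) : 0 <= c -> bnd f ->
  Ex nu (fun x => c * f x) = c * Ex nu f.
Proof.
move=> c0 bf; have bf' := bndN bf.
rewrite [in RHS](_ : f = fun x => Num.max (f x) 0 - Num.max (- f x) 0);
  last exact/funext/posneg.
rewrite (_ : (fun x => c * f x) = fun x =>
  c * Num.max (f x) 0 - c * Num.max (- f x) 0); last first.
  by apply/funext => x; rewrite {1}(posneg f x) mulrBr.
have b1 := bnd_max bf; have b2 := bnd_max bf'.
have b3 := bndM (bnd_cst T c) b1; have b4 := bndM (bnd_cst T c) b2.
by rewrite (ExB b3 b4) (ExB b1 b2) mulrBr !ExZ_ge0.
Qed.

Lemma ExZ (c : R) (f : T -> R) : bnd f -> Ex nu (fun x => c * f x) = c * Ex nu f.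
Proof.
move=> bf; case: (leP 0 c) => c0; first exact: ExZ_pos.
have := @ExZ_pos (- c) f; rewrite oppr_ge0 ltW// => /(_ isT bf) h.
rewrite -[RHS]opprK -mulNr -h -ExN; last by apply: bndM => //; exact: bnd_cst.
by congr Ex; apply/funext => x; lra.
Qed.

Lemma Ex_cst (c : R) : Ex nu (fun=> c) = c.
Proof.
have E1 : Ex nu (fun=> 1) = 1.
  apply/EFin_inj; rewrite Ex_ge0E ?ler01//; last exact: bnd_cst.
  by rewrite /S; under eq_esum do rewrite mulr1.
rewrite -[in LHS](mulr1 c) (ExZ c (bnd_cst T 1)) E1; lra.
Qed.

Lemma Ex_unit (f : T -> R) : (forall x, 0 <= f x <= 1) -> 0 <= Ex nu f <= 1.
Proof.
move=> h; have bf := bnd_unit h.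
rewrite Ex_ge0 //=; last by move=> x; have /andP[] := h x.
by rewrite -(Ex_cst 1); apply: Ex_le => // [|x]; [exact: bnd_cst|have /andP[] := h x].
Qed.

Lemma Ex_atom (f : T -> R) x : (forall x, 0 <= f x) -> bnd f -> nu x * f x <= Ex nu f.
Proof.
move=> f0 bf; rewrite -lee_fin Ex_ge0E// /S.
rewrite -(esum_set1 (t := x) (a := fun x => (nu x * f x)%:E)); last first.
  by rewrite lee_fin mulr_ge0.
rewrite esum_mkcond; apply: le_esum => y _.
by case: ifP => _ //; rewrite lee_fin mulr_ge0.
Qed.

Lemma Ex_jensen (f : T -> R) : bnd f -> Ex nu f ^+ 2 <= Ex nu (fun x => f x ^+ 2).
Proof.
move=> bf; set m := Ex nu f.
have bf2 := bndX2 bf.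
have b1 : bnd (fun x => 2 * m * f x) by apply: bndM => //; exact: bnd_cst.
have h : 0 <= Ex nu (fun x => (f x ^+ 2 - 2 * m * f x) + m ^+ 2).
  apply: Ex_ge0; last by apply: bndD; [exact: bndB|exact: bnd_cst].
  by move=> x; have := sqr_ge0 (f x - m); lra.
move: h; rewrite (ExD (bndB bf2 b1) (bnd_cst T (m ^+ 2))) (ExB bf2 b1) (ExZ _ bf).
by rewrite Ex_cst -/m; lra.
Qed.

Lemma Ex_tight (e : R) : 0 < e ->
  exists F : seq T, Ex nu (\1_[set x | x \notin F]) <= e.
Proof.
move=> e0; have : (1 - e%:E < \esum_(x in [set: T]) (nu x)%:E)%E.
  by rewrite nu1 -EFinB lte_fin; lra.
move=> /ereal_sup_gt[_ [A [finA _] <-]].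
rewrite fsbig_finite//= sumEFin lte_fin => hA.
exists (finmap.enum_fset (fset_set A)).
set F := finmap.enum_fset _ in hA *.
have uF : uniq F by exact: finmap.fset_uniq.
have b1 := bnd_ind [set x : T | x \notin F].
have b2 := bnd_ind [set x : T | x \in F].
have hs : \sum_(i <- F) nu i <= Ex nu (\1_[set x | x \in F]).
  rewrite -lee_fin Ex_ge0E// -sumEFin.
  rewrite [in leRHS]/S.
  have -> : (\sum_(i <- F) (nu i)%:E)%E = (\esum_(x in [set` F]) (nu x)%:E)%E.
    rewrite esum_fset; [|exact: finite_seq|by move=> x _; rewrite lee_fin].
    by rewrite -fsbig_seq.
  rewrite esum_mkcond; apply: le_esum => x _; rewrite indicE.
  have -> : (x \in [set x0 | x0 \in F]) = (x \in [set` F]) by [].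
  by case: ifP => _; rewrite ?mulr1 ?mulr0.
have : Ex nu (fun x => \1_[set x : T | x \notin F] x + \1_[set x : T | x \in F] x) = 1.
  rewrite -[RHS](Ex_cst 1); congr Ex; apply/funext => x; rewrite !indicE.
  have -> : (x \in [set x0 : T | x0 \notin F]) = (x \notin F) by apply/idP/idP; rewrite inE.
  have -> : (x \in [set x0 : T | x0 \in F]) = (x \in F) by apply/idP/idP; rewrite inE.
  by case: (x \in F) => /=; rewrite ?addr0 ?add0r.
rewrite ExD//; lra.
Qed.

End Expectation.

(** * Banach limits *)

(** These are the properties of a limit along an ultrafilter finer than [\oo]. Shift invariance is
    not among them: below, invariance comes from Cesaro means or from error terms tending to 0, and
    [lim_le] only looks at large indices. *)
Record banach_limit (L : (nat -> R) -> R) : Prop := {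
  limD : forall u v, bnd u -> bnd v -> L (fun n => u n + v n) = L u + L v;
  limZ : forall c u, bnd u -> L (fun n => c * u n) = c * L u;
  lim_le : forall N u v, bnd u -> bnd v ->
    (forall n, (N <= n)%N -> u n <= v n) -> L u <= L v;
  lim_cst : forall c, L (fun=> c) = c }.

Lemma ultrafilter_lim (K : realType) : exists U : set_system nat, exists L : (nat -> K) -> K,
  [/\ ProperFilter U, \oo `<=` U & forall u, (exists M, forall n, `|u n| <= M) -> u @ U --> L u].
Proof.
have [U [UU FU]] := ultraFilterLemma (@eventually_filter).
exists U, (fun u => lim (u @ U)); split => //; first exact: ultra_proper.
move=> u [M hM].
have := @segment_compact K (- M) M; rewrite compact_ultra => /(_ (u @ U)).
have UuU : UltraFilter (u @ U).
  split=> [|G GG sG]; first exact: fmap_proper_filter.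
  rewrite predeqE => A; split; last exact: sG.
  move=> GA; have [//|nA] := in_ultra_setVsetC (u @^-1` A) UU.
  have GnA : G (~` A) by exact: sG.
  by have /filter_ex[? []] : G (A `&` ~` A) by exact: filterI.
move=> /(_ UuU) [|p [_ /= hp]]; last by apply/cvg_ex; exists p.
apply: FU; near=> n; rewrite /= in_itv/=.
by have := hM n; rewrite ler_norml.
Unshelve. all: by end_near. Qed.

Lemma banach_limit_exists : exists L, banach_limit L.
Proof.
have [U [L [PU FU cv]]] := ultrafilter_lim R.
exists L; split.
- move=> u v bu bv; apply: (cvg_unique _ (cv _ (bndD bu bv))) => //.
  by apply: cvgD; exact: cv.
- move=> c u bu; apply: (cvg_unique _ (cv _ (bndM (bnd_cst _ c) bu))) => //.
  by apply: cvgMl_tmp; exact: cv.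
- move=> N u v bu bv uv; apply: (ler_cvg_to (cv _ bu) (cv _ bv)).
  by apply: FU; exists N.
- move=> c; apply: (cvg_unique _ (cv _ (bnd_cst _ c))) => //; exact: cvg_cst.
Qed.

Definition LIM : (nat -> R) -> R := sval (cid banach_limit_exists).

Lemma LIM_spec : banach_limit LIM. Proof. exact: svalP (cid _). Qed.

Lemma LIMD u v : bnd u -> bnd v -> LIM (fun n => u n + v n) = LIM u + LIM v.
Proof. exact: limD LIM_spec u v. Qed.

Lemma LIMZ c u : bnd u -> LIM (fun n => c * u n) = c * LIM u.
Proof. exact: limZ LIM_spec c u. Qed.

Lemma LIM_le N u v : bnd u -> bnd v -> (forall n, (N <= n)%N -> u n <= v n) ->
  LIM u <= LIM v.
Proof. exact: lim_le LIM_spec N u v. Qed.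

Lemma LIM_cst c : LIM (fun=> c) = c.
Proof. exact: lim_cst LIM_spec c. Qed.

Lemma LIMB u v : bnd u -> bnd v -> LIM (fun n => u n - v n) = LIM u - LIM v.
Proof.
move=> bu bv.
rewrite (LIMD bu (bndN bv)) -[X in _ + X = _](_ : LIM (fun n => -1 * v n) = _).
  by rewrite LIMZ// mulN1r.
by congr LIM; apply/funext => n; rewrite mulN1r.
Qed.

Lemma LIM_abs N u e : bnd u -> (forall n, (N <= n)%N -> `|u n| <= e) ->
  `|LIM u| <= e.
Proof.
move=> bu h; rewrite ler_norml -[in X in X && _](LIM_cst (- e)) -[in X in _ && X](LIM_cst e).
apply/andP; split; apply: (@LIM_le N) => //; try exact: bnd_cst.
- by move=> n /h; rewrite ler_norml => /andP[].
- by move=> n /h; rewrite ler_norml => /andP[].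
Qed.

Lemma LIM0 u : bnd u ->
  (forall e, 0 < e -> exists N, forall n, (N <= n)%N -> `|u n| <= e) -> LIM u = 0.
Proof.
move=> bu h; apply/eqP; rewrite -normr_le0; apply/ler_addgt0Pl => e e0.
rewrite addr0; have [N hN] := h _ e0.
exact: LIM_abs hN.
Qed.

Lemma LIM_sum (I : Type) (s : seq I) (u : I -> nat -> R) : (forall i, bnd (u i)) ->
  LIM (fun n => \sum_(i <- s) u i n) = \sum_(i <- s) LIM (u i).
Proof.
move=> bu; elim: s => [|i s IH].
  by rewrite big_nil -[RHS](LIM_cst 0); congr LIM; apply/funext => n; rewrite big_nil.
rewrite big_cons -IH -LIMD//.
  by congr LIM; apply/funext => n; rewrite big_cons.
elim: {IH} s => [|j s [M IH]].
  by exists 0 => n; rewrite big_nil normr0.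
have [N hN] := bu j; exists (N + M) => n; rewrite big_cons.
by apply: le_trans (ler_normD _ _) _; exact: lerD.
Qed.

(** * Independent sequences with a given law *)

(** Countable additivity is indexed by [nat]; the family is transported along the injection [f],
    indices outside its range receiving the empty set. *)
Lemma measure_bigcup_inj (G : choiceType) (f : G -> nat) d (T : measurableType d)
    (P : probability T R) (B : set G) (F : G -> set T) :
  injective f -> (forall y, measurable (F y)) -> trivIset setT F ->
  P (\bigcup_(y in B) F y) = \esum_(y in B) P (F y).
Proof.
move=> finj mF tF.
pose F' n := \bigcup_(y in f @^-1` [set n]) F y.
have F'f y : F' (f y) = F y.
  apply/seteqP; split=> [w [z /finj <-]//|w Fw]; by exists y.
have F'0 n : (forall y, f y <> n) -> F' n = set0.
  by move=> h; rewrite -subset0 => w [y /h].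
have mF' n : measurable (F' n).
  have [[y <-]|/forallNP/F'0 ->] := pselect (exists y, f y = n); last exact: measurable0.
  by rewrite F'f.
have tF' : trivIset (f @` B) F'.
  move=> _ _ [y By <-] [z Bz <-]; rewrite !F'f => h.
  by congr f; exact: tF.
have -> : \bigcup_(y in B) F y = \bigcup_(n in f @` B) F' n.
  rewrite bigcup_image; apply: eq_bigcupr => y _; exact/esym/F'f.
rewrite measure_bigcup// nneseries_esum//.
have -> : [set x | x \in f @` B] = f @` B by apply/seteqP; split=> x /=; rewrite inE.
rewrite (@reindex_esum _ _ _ B _ f); first by apply: eq_esum => y _; rewrite F'f.
split=> [x Bx|x y _ _ /finj//|y [x Bx <-]]; by exists x.
Qed.

Lemma measurable_bigcup_inj (G : Type) (f : G -> nat) d (T : measurableType d)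
    (B : set G) (F : G -> set T) :
  injective f -> (forall y, measurable (F y)) -> measurable (\bigcup_(y in B) F y).
Proof.
move=> finj mF; rewrite bigcup_mkcond; apply: countable_bigcupT_measurable.
  by apply/countable_injP; exists f => x y _ _; exact: finj.
by move=> i; case: ifP.
Qed.

Definition word_event (G T : Type) (X : nat -> T -> G) (s : seq G) : set T :=
  [set w | mkseq (X^~ w) (size s) = s].

Section WordEvents.
Variables (G : eqType) (T : Type) (X : nat -> T -> G).

Lemma word_event_rcons s y :
  word_event X (rcons s y) = word_event X s `&` X (size s) @^-1` [set y].
Proof.
apply/seteqP; split=> w /=; rewrite /word_event/= size_rcons /mkseq -addn1 iotaD map_cat/= cats1.
  by move/rcons_inj => [-> ->].
by move=> [-> ->].
Qed.

Lemma word_event_nil : word_event X [::] = setT.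
Proof. by apply/seteqP. Qed.

End WordEvents.

Lemma word_event_measurable (G : eqType) d (T : measurableType d) (X : nat -> T -> G) :
  (forall i g, measurable (X i @^-1` [set g])) ->
  forall s, measurable (word_event X s).
Proof.
move=> mX; elim/last_ind => [|s y IH]; first by rewrite word_event_nil.
by rewrite word_event_rcons; exact: measurableI.
Qed.

Lemma event_measurable (G : Type) (f : G -> nat) (finj : injective f)
    d (T : measurableType d) (Z : T -> G) (C : set G) :
  (forall g, measurable (Z @^-1` [set g])) -> measurable (Z @^-1` C).
Proof.
move=> mZ; have -> : Z @^-1` C = \bigcup_(y in C) Z @^-1` [set y].
  by apply/seteqP; split=> [w Cw|w [y Cy /= wy]]; [exists (Z w)|rewrite /preimage/= wy].
exact: (measurable_bigcup_inj _ finj mZ).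
Qed.

Lemma event_law (G : choiceType) (f : G -> nat) (finj : injective f) (nu : G -> R)
    d (T : measurableType d) (P : probability T R) (Z : T -> G) (C : set G) :
  (forall g, measurable (Z @^-1` [set g])) ->
  (forall g, P (Z @^-1` [set g]) = (nu g)%:E) ->
  P (Z @^-1` C) = \esum_(y in C) (nu y)%:E.
Proof.
move=> mZ lZ; have -> : Z @^-1` C = \bigcup_(y in C) Z @^-1` [set y].
  by apply/seteqP; split=> [w Cw|w [y Cy /= wy]]; [exists (Z w)|rewrite /preimage/= wy].
rewrite (measure_bigcup_inj _ _ finj)//; first by apply: eq_esum => y _; exact: lZ.
by move=> y z _ _ [w [/= wy wz]]; rewrite -wy -wz.
Qed.

(** The law of finite words determines the joint law of arbitrary events on coordinates. The
    induction is on the number [k] of coordinates still to be read, the word already read being a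
    parameter: one more coordinate is summed over its values. *)
Lemma word_law_indep (G : choiceType) (f : G -> nat) (finj : injective f)
    (nu : G -> R) d (T : measurableType d) (P : probability T R) (X : nat -> T -> G) :
  (forall x, 0 <= nu x) ->
  (forall i g, measurable (X i @^-1` [set g])) ->
  (forall i g, P (X i @^-1` [set g]) = (nu g)%:E) ->
  (forall s, P (word_event X s) = (\prod_(x <- s) nu x)%:E) ->
  forall (n : nat) (B : nat -> set G),
    P (\bigcap_(i in `I_n) X i @^-1` B i)
    = (\big[*%E/1%E]_(i < n) P (X i @^-1` B i))%E.
Proof.
move=> nu0 mX lX lW n B.
have mXB i (C : set G) : measurable (X i @^-1` C)
  by apply: (event_measurable finj); exact: mX.
have PXB i (C : set G) : P (X i @^-1` C) = \esum_(y in C) (nu y)%:E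
  by exact: (event_law finj _ (mX i) (lX i)).
pose b i := fine (P (X i @^-1` B i)).
have bE i : P (X i @^-1` B i) = (b i)%:E by rewrite fineK// fin_num_measure.
suff key k s : P (word_event X s `&` \bigcap_(i in [set i | size s <= i < size s + k]%N) X i @^-1` B i)
    = (\prod_(x <- s) nu x * \prod_(size s <= i < size s + k) b i)%:E.
  have := key n [::]; rewrite word_event_nil setTI big_nil mul1r add0n.
  rewrite (eq_bigr (fun i : 'I_n => (b i)%:E)); last by move=> i _; rewrite bE.
  rewrite prodEFin big_mkord => <-; congr (P _).
elim: k s => [|k IH] s.
  rewrite addn0 big_geq// mulr1 -lW; congr (P _).
  rewrite (_ : \bigcap_(_ in _) _ = setT) ?setIT//.
  by apply/seteqP; split=> // w _ i /= /andP[ha hb]; have := leq_trans hb ha; rewrite ltnn.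
set E := _ `&` _.
have -> : E = \bigcup_(y in B (size s)) (word_event X (rcons s y) `&`
   \bigcap_(i in [set i | size (rcons s y) <= i < size (rcons s y) + k]%N) X i @^-1` B i).
  apply/seteqP; split=> w.
    move=> [ws h]; exists (X (size s) w); first by apply: h; rewrite /= leqnn/= addnS ltnS leq_addr.
    split; first by rewrite word_event_rcons.
    move=> i; rewrite /= size_rcons addSn -addnS => /andP[i1 i2].
    by apply: h; rewrite /= i2 andbT ltnW.
  move=> [y By]; rewrite word_event_rcons size_rcons => -[[ws wy] h]; split => // i /=.
  rewrite leq_eqVlt => /andP[/predU1P[<- _|i1 i2]]; first by rewrite /preimage/= wy.
  by apply: h; rewrite /= i1/= addSn -addnS.
rewrite (measure_bigcup_inj _ _ finj)//; last 2 first.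
- move=> y; apply: measurableI; first exact: word_event_measurable.
  by apply: bigcap_measurableType => // ? _; exact: mXB.
- move=> y z _ _ [w [[]]]; rewrite !word_event_rcons => -[_ <-] _ [[_ <-]] //.
pose c := \prod_(x <- s) nu x * \prod_((size s).+1 <= i < (size s).+1 + k) b i.
rewrite (eq_esum (b := fun y => (c * nu y)%:E)); last first.
  move=> y _; rewrite IH -cats1 big_cat big_seq1/= size_cat/= addn1 /c.
  by congr (_%:E); rewrite -!mulrA; congr (_ * _); rewrite mulrC.
rewrite esumZ//; last first.
  rewrite mulr_ge0 ?prodr_ge0// => i _; exact: fine_ge0.
rewrite -(PXB (size s)) bE -EFinM; congr (_%:E).
rewrite addnS -addSn [in RHS]big_ltn ?addSn ?ltnS ?leq_addr// /c -mulrA.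
by congr (_ * _); exact: mulrC.
Qed.

Lemma mkseq_cst (A : Type) (x : A) n : mkseq (fun=> x) n = nseq n x.
Proof. by rewrite /mkseq; elim: n 0%N => //= n IH k; rewrite IH. Qed.

(** * Random digits with a prescribed law *)

Section IntervalCoding.
Variable a : nat -> R.
Hypothesis a0 : forall n, 0 <= a n.
Hypothesis a1 : (\sum_(n <oo) (a n)%:E = 1)%E.

Let cum (n : nat) : R := \sum_(0 <= i < n) a i.

Let cumS n : cum n.+1 = cum n + a n. Proof. by rewrite /cum big_nat_recr. Qed.

Let cum_mono m n : (m <= n)%N -> cum m <= cum n.
Proof.
move=> /subnK <-; elim: (n - m)%N => [|k IH]; first by rewrite add0n.
by rewrite addSn cumS; have := a0 (k + m); move: IH; lra.
Qed.

Let cum_ge0 n : 0 <= cum n. Proof. by rewrite /cum sumr_ge0. Qed.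

Let cum_le1 n : cum n <= 1.
Proof.
rewrite -lee_fin -a1 /cum -sumEFin; apply: nneseries_lim_ge => i _.
by rewrite lee_fin.
Qed.

Let cum_gt (w : R) : w < 1 -> exists n, w < cum n.
Proof.
move=> w1; apply: contrapT => /forallNP h.
have : (\sum_(n <oo) (a n)%:E <= w%:E)%E.
  apply: lime_le; first by apply: is_cvg_nneseries => n _ _; rewrite lee_fin.
  apply: nearW => n; rewrite sumEFin lee_fin; have := h n => /negP.
  by rewrite -leNgt.
by rewrite a1 lee_fin; move: w1; lra.
Qed.

Let digit (w : R) : nat := xget 0%N [set n | cum n <= w < cum n.+1].

Let digitP (w : R) : 0 <= w < 1 -> cum (digit w) <= w < cum (digit w).+1.
Proof.
move=> /andP[w0 w1]; rewrite /digit; case: xgetP => [n -> //|h].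
have ex : exists n, w < cum n by exact: cum_gt.
case: (ex_minnP ex) => n hn nmin.
case: n hn nmin => [|n] hn nmin; first by exfalso; move: hn; rewrite /cum big_geq//; move: w0; lra.
have := h n; rewrite /= hn andbT => /negP; rewrite -ltNge => /nmin.
by rewrite ltnn.
Qed.

Let digit_uniq (w : R) n : 0 <= w < 1 -> cum n <= w < cum n.+1 -> digit w = n.
Proof.
move=> w01 /andP[h3 h4]; have /andP[h1 h2] := digitP w01.
case: (ltngtP (digit w) n) => // h.
- by exfalso; have := cum_mono h; move: h2 h3; lra.
- by exfalso; have := cum_mono h; move: h1 h4; lra.
Qed.

(** The relative position of [w] in the interval of its first digit, that is, the expanding map of
    this expansion: the later digits of [w] are the digits of [tau w]. *)
Let tau (w : R) : R := (w - cum (digit w)) / a (digit w).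

Let tauP (w : R) : 0 <= w < 1 -> 0 < a (digit w) /\ 0 <= tau w < 1.
Proof.
move=> w01; have := digitP w01; rewrite cumS => /andP[h1 h2].
have h : 0 < a (digit w) by move: h1 h2; lra.
split => //; rewrite /tau divr_ge0 ?subr_ge0 ?(ltW h)//= ltr_pdivrMr//.
by move: h2; lra.
Qed.

Let lo := fix lo (s : seq nat) : R := if s is n :: s' then cum n + a n * lo s' else 0 : R.
Let len (s : seq nat) : R := \prod_(n <- s) a n.

Let lenP s : 0 <= len s. Proof. exact: prodr_ge0. Qed.

Let loP s : 0 <= lo s /\ lo s + len s <= 1.
Proof.
elim: s => [|n s [IH1 IH2]] /=; first by rewrite /len big_nil; split; lra.
rewrite /len big_cons -/(len s); split.
  by rewrite addr_ge0// mulr_ge0.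
rewrite -addrA -mulrDr; apply: (@le_trans _ _ (cum n.+1)); last exact: cum_le1.
by rewrite cumS lerD2l; have := a0 n; move: IH2; nra.
Qed.

Let word_itv s : forall w : R, 0 <= w < 1 ->
  mkseq (fun i => digit (iter i tau w)) (size s) = s <-> lo s <= w < lo s + len s.
Proof.
elim: s => [|n s IH] w w01; first by rewrite /len big_nil /= add0r w01; split.
have [an tw] := tauP w01.
have -> : mkseq (fun i => digit (iter i tau w)) (size (n :: s)) =
   digit w :: mkseq (fun i => digit (iter i tau (tau w))) (size s).
  rewrite /mkseq/=; congr (_ :: _).
  by rewrite -[1%N]addn0 iotaDl -map_comp; apply: eq_map => i /=; rewrite -iterSr.
rewrite /= /len big_cons -/(len s); split.
  move=> [dn /IH-/(_ tw)]; rewrite /tau dn => /andP[h1 h2].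
  rewrite dn in an.
  move: h1 h2; rewrite ler_pdivlMr// ltr_pdivrMr// => h1 h2.
  by apply/andP; split; lra.
move=> /andP[h1 h2]; have [l1 l2] := loP s; have lsP := lenP s.
have dn : digit w = n.
  apply: digit_uniq => //; rewrite cumS; apply/andP; split.
    by have := a0 n; nra.
  by have := a0 n; nra.
rewrite dn in an *; congr (_ :: _); apply/IH => //.
rewrite /tau dn ler_pdivlMr// ltr_pdivrMr//.
by apply/andP; split; lra.
Qed.

(* [Y i w] is the [i]-th digit of [w], in the expansion for which the numbers in [0, 1[ starting
   with [s] form the interval [lo s, lo s + len s[. *)
Let Y i (w : R) : nat := if 0 <= w < 1 then digit (iter i tau w) else 0%N.

Lemma exists_iid_nat : exists (d : measure_display) (T : measurableType d)
  (P : probability T R) (Z : nat -> T -> nat),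
  [/\ forall i g, measurable (Z i @^-1` [set g]),
      forall i g, P (Z i @^-1` [set g]) = (a g)%:E &
      forall s, P (word_event Z s) = (\prod_(x <- s) a x)%:E].
Proof.
have mW s : measurable (word_event Y s : set (measurableTypeR R)).
  (* Outside [[0, 1[] all digits are 0 by default, so a word of zeros also captures the
     complement. *)
  have -> : word_event Y s = `[lo s, lo s + len s[%classic `|`
     (if s == nseq (size s) 0%N then ~` `[0%R, 1%R[%classic else set0).
    have [l1 l2] := loP s; have l3 := lenP s.
    apply/seteqP; split=> w; rewrite /word_event /Y /=; have [w01|w01] := boolP (0 <= w < 1).
    - by move/(word_itv _ w01) => ?; left; rewrite in_itv.
    - move=> h; right; rewrite mkseq_cst in h; rewrite -h size_nseq eqxx /=.
      by rewrite in_itv/=; exact/negP.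
    - move=> [|]; first by rewrite in_itv => /(word_itv _ w01).
      by case: ifP => // _ /=; rewrite in_itv/= w01.
    - move=> [|]; rewrite /= ?in_itv/=.
        move=> /andP[h1 h2]; exfalso; move/negP: w01; apply; apply/andP; split; lra.
      by case: ifP => // /eqP -> _; rewrite size_nseq mkseq_cst.
  apply: measurableU; first exact: measurable_itv.
  by case: ifP => _ //; apply: measurableC; exact: measurable_itv.
have PW s : uniform_prob (@ltr01 R) (word_event Y s) = (len s)%:E.
  have [l1 l2] := loP s; have l3 := lenP s.
  rewrite /uniform_prob integral_uniform_pdf.
  rewrite (eq_integral (fun=> 1%:E)); last first.
    move=> x; rewrite inE/= => -[_]; rewrite in_itv/= /uniform_pdf => ->.
    by rewrite subr0 invr1.
  rewrite integral_cst ?mul1e; last by apply: measurableI => //; exact: mW.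
  have eW : word_event Y s `&` `[0%R, 1%R[%classic = `[lo s, lo s + len s[%classic.
    apply/seteqP; split=> w; rewrite /word_event /Y /= !in_itv/=.
      by move=> [+ w01]; rewrite w01 => /(word_itv _ w01).
    move=> h; have w01 : 0 <= w < 1 by move: h => /andP[h1 h2]; apply/andP; split; lra.
    by rewrite w01; split => //; apply/(word_itv _ w01).
  (* The uniform law lives on the closed interval and the digits on [[0, 1[]; the extra point 1 is
     null. *)
  apply/eqP; rewrite eq_le; apply/andP; split.
    apply: (@le_trans _ _ (lebesgue_measure (`[lo s, lo s + len s[%classic `|` [set 1%R]))).
      apply: le_measure; rewrite ?inE.
      - by apply: measurableI => //; exact: mW.
      - by apply: measurableU => //; exact: measurable_itv.
      move=> w [Ww]; rewrite -eW /= in_itv/= => /andP[w0 w1].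
      have [->|wn1] := eqVneq w 1; first by right.
      by left; split => //; rewrite in_itv/= w0 lt_neqAle wn1.
    have hU := @measureU2 _ _ _ (@lebesgue_measure R) _ _ (measurable_itv `[lo s, lo s + len s[) (measurable_set1 1).
    apply: (le_trans hU).
    have h1 : (lebesgue_measure [set (1%R : R)] = 0)%E by exact: lebesgue_measure_set1.
    have h2 : (lebesgue_measure `[lo s, (lo s + len s)%R[%classic <= (len s)%:E)%E.
      rewrite lebesgue_measure_itv/= lte_fin.
      by case: ifP => _; rewrite -?EFinD ?lee_fin//; lra.
    by rewrite -[leRHS]adde0; apply: leeD h2 _; rewrite [leLHS]h1.
  rewrite (_ : (len s)%:E = lebesgue_measure (`[lo s, lo s + len s[%classic : set R)).
    apply: le_measure; rewrite ?inE; [exact: measurable_itv| |].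
    - by apply: measurableI => //; exact: mW.
    - by rewrite -eW => w [? h]; split => //; move: h; rewrite /= !in_itv/= => /andP[-> /ltW ->].
  rewrite lebesgue_measure_itv/= lte_fin; case: ifPn; first by move=> _; rewrite -EFinD; congr (_%:E); lra.
  by rewrite -leNgt => h; congr (_%:E); lra.
have mY i g : measurable (Y i @^-1` [set g] : set (measurableTypeR R)).
  have -> : Y i @^-1` [set g] =
     \bigcup_(s in [set s : seq nat | size s = i]) word_event Y (rcons s g).
    apply/seteqP; split=> w /=.
      move=> h; exists (mkseq (Y^~ w) i); first by rewrite /= size_mkseq.
      rewrite word_event_rcons /word_event/= size_mkseq; split => //.
    by move=> [s /= <-]; rewrite word_event_rcons => -[].
  by apply: (measurable_bigcup_inj _ (pcan_inj choice.pickleK)) => s; exact: mW.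
exists _, (measurableTypeR R), (uniform_prob (@ltr01 R)), Y; split => //.
move=> i g.
(* The law of a single digit follows from that of words by summing over the [k] letters in
   between. *)
have h k s : uniform_prob (@ltr01 R) (word_event Y s `&` Y (size s + k)%N @^-1` [set g]) = (len s * a g)%:E.
  elim: k s => [|k IH] s.
    by rewrite addn0 -word_event_rcons PW /len -cats1 big_cat big_seq1.
  have -> : word_event Y s `&` Y (size s + k.+1)%N @^-1` [set g] =
     \bigcup_(n in setT) (word_event Y (rcons s n) `&` Y (size (rcons s n) + k)%N @^-1` [set g]).
    apply/seteqP; split=> w.
      move=> [h1 h2]; exists (Y (size s) w) => //; rewrite word_event_rcons size_rcons addSn -addnS.
      by split.
    by move=> [n _]; rewrite word_event_rcons size_rcons addSn -addnS => -[[]].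
  rewrite (measure_bigcup_inj _ _ (@inj_id nat)); last 2 first.
  - move=> n; apply: measurableI; [exact: mW|exact: mY].
  - by move=> m n _ _ [w [[+ _]]] [+ _]; rewrite !word_event_rcons => -[_ <-] [_ <-].
  rewrite (eq_esum (b := fun n => (len s * a g * a n)%:E)); last first.
    by move=> n _; apply: (etrans (IH _)); rewrite /len -cats1 big_cat big_seq1/= -!mulrA; congr (_ * _)%:E; rewrite mulrC.
  rewrite esumZ//; last by rewrite mulr_ge0.
  by rewrite -nneseries_esumT ?a1 ?mule1// => n; rewrite lee_fin.
have := h i [::]; rewrite word_event_nil setTI add0n /len big_nil mul1r; exact.
Qed.

End IntervalCoding.

Lemma exists_iid (G : groupType) (nu : G -> R) : countable_group G -> prob_mass nu ->
  exists (d : measure_display) (T : measurableType d) (P : probability T R)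
    (X : nat -> T -> G), iid_law nu P X.
Proof.
move=> [f finj] [nu0 nu1].
pose g n := xget (gone : G) [set y | f y = n].
have gf y : g (f y) = y by rewrite /g; case: xgetP => [z _ /finj//|/(_ y)/(_ erefl)].
(* Outside the range of [f], [g n] is the default [gone]; the test [f (g n) == n] detects exactly
   the range. *)
pose a n := if f (g n) == n then nu (g n) else 0.
have a0 n : 0 <= a n by rewrite /a; case: ifP.
have a1 : (\sum_(n <oo) (a n)%:E = 1)%E.
  rewrite nneseries_esumT; last by move=> n; rewrite lee_fin.
  rewrite -nu1 [RHS](_ : _ = \esum_(y in [set: G]) (a (f y))%:E)%E; last first.
    by apply: eq_esum => y _; rewrite /a gf eqxx.
  rewrite -(@reindex_esum _ _ _ _ (range f) f (fun n => (a n)%:E)); last first.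
    by split=> [y _|x y _ _ /finj//|_ [y _ <-]]; exists y.
  rewrite [RHS]esum_mkcond; apply: eq_esum => n _; case: ifPn => //.
  rewrite notin_setE /a => h; case: ifP => // /eqP e; exfalso; apply: h.
  by exists (g n).
have [d [T [P [Z [mZ lZ wZ]]]]] := exists_iid_nat a0 a1.
have eC i (C : set G) : (fun w => g (Z i w)) @^-1` C = Z i @^-1` (g @^-1` C) by [].
exists d, T, P, (fun i w => g (Z i w)); split.
- by move=> i y; rewrite eC; have := event_measurable (@inj_id nat) (g @^-1` [set y]) (mZ i).
- move=> i y; rewrite eC (event_law (@inj_id nat) _ (mZ i) (lZ i)).
  rewrite esum_mkcond -[RHS](_ : \esum_(n in [set f y]) (a n)%:E = _); last first.
    by rewrite esum_set1 ?lee_fin// /a gf eqxx.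
  rewrite [RHS]esum_mkcond; apply: eq_esum => n _.
  case: ifPn; rewrite ?inE ?notin_setE /preimage /=.
    move=> gn; case: ifPn => //; rewrite notin_setE /= /a => nf.
    by case: ifP => // /eqP; rewrite gn => h; case: nf.
  by move=> h; case: ifPn => //; rewrite inE/= => e; case: h; rewrite e gf.
- move=> n B; exact: (word_law_indep (@inj_id nat) a0 mZ lZ wZ n (fun i => g @^-1` B i)).
Qed.

(** * From trivial boundary to the Liouville property *)

Definition harmonic (G : groupType) (nu h : G -> R) : Prop :=
  forall x, Ex nu (fun y => h (gmul x y)) = h x.

(** Values in [[0, 1]] lose nothing: an affine map brings any bounded harmonic function there. *)
Definition liouville (G : groupType) (nu : G -> R) : Prop :=
  forall h : G -> R, (forall x, 0 <= h x <= 1) -> harmonic nu h ->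
  forall x y, h x = h y.

Definition gprod (G : groupType) (s : seq G) : G := foldr gmul gone s.

Section GProd.
Variable G : groupType.

Lemma gprod_cat (s t : seq G) : gprod (s ++ t) = gmul (gprod s) (gprod t).
Proof.
elim: s => [|x s IH] /=; first by rewrite /gprod/= monoid.mul1g.
by rewrite /gprod/= -/(gprod _) IH monoid.mulgA.
Qed.

Lemma gprod_rcons (s : seq G) y : gprod (rcons s y) = gmul (gprod s) y.
Proof. by rewrite -cats1 gprod_cat /gprod/= monoid.mulg1. Qed.

Lemma walkE T (X : nat -> T -> G) w n : walk X w n = gprod (mkseq (X^~ w) n).
Proof. by []. Qed.

Lemma walk_word T (X : nat -> T -> G) w s : word_event X s w -> walk X w (size s) = gprod s.
Proof. by rewrite walkE => ->. Qed.

End GProd.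

Lemma countable_seq (G : Type) (f : G -> nat) : injective f ->
  exists f' : seq G -> nat, injective f'.
Proof.
move=> finj; exists (fun s => choice.pickle (map f s)) => s t.
by move=> /(pcan_inj choice.pickleK) /inj_map; exact.
Qed.

Section IidWalk.
Variables (G : groupType) (nu : G -> R) (f : G -> nat).
Hypothesis finj : injective f.
Hypothesis pnu : prob_mass nu.
Variables (d : measure_display) (T : measurableType d) (P : probability T R).
Variable X : nat -> T -> G.
Hypothesis iX : iid_law nu P X.

Let nu0 : forall x, 0 <= nu x. Proof. by have [] := pnu. Qed.
Let nu1 : (\esum_(x in [set: G]) (nu x)%:E = 1)%E. Proof. by have [] := pnu. Qed.

Lemma measurable_word s : measurable (word_event X s).
Proof. by have [mX _ _] := iX; exact: word_event_measurable. Qed.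

Lemma iid_word s : P (word_event X s) = (\prod_(x <- s) nu x)%:E.
Proof.
have [mX lX /(_ (size s) (fun i => [set nth gone s i])) hX] := iX.
rewrite -prodEFin (big_nth gone) big_mkord.
rewrite (eq_bigr (fun i : 'I_(size s) => P (X i @^-1` [set nth gone s i]))); last first.
  by move=> i _; rewrite lX.
rewrite -hX; congr (P _); apply/seteqP; split=> w.
  by move=> /= <- i /= ilt; rewrite size_mkseq in ilt; rewrite /preimage/= nth_mkseq.
move=> h; rewrite /word_event/=; apply: (@eq_from_nth _ gone); rewrite ?size_mkseq// => i ilt.
by rewrite nth_mkseq//; exact: h.
Qed.

Lemma prod_mass_ge0 (s : seq G) : 0 <= \prod_(x <- s) nu x.
Proof. exact: prodr_ge0. Qed.

Lemma measurable_walk n (C : set G) : measurable [set w | C (walk X w n)].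
Proof.
have [f' f'inj] := countable_seq finj.
have -> : [set w | C (walk X w n)] =
    \bigcup_(s in [set s | C (gprod s) /\ size s = n]) word_event X s.
  apply/seteqP; split=> w.
    move=> Cw; exists (mkseq (X^~ w) n); last by rewrite /word_event/= size_mkseq.
    by rewrite /= size_mkseq.
  by move=> [s [Cs <-] ws]; rewrite /= (walk_word ws).
by apply: (measurable_bigcup_inj _ f'inj); exact: measurable_word.
Qed.

Lemma bigcup_word_event s (E : set T) :
  E `&` word_event X s = \bigcup_(y in setT) (E `&` word_event X (rcons s y)).
Proof.
apply/seteqP; split=> w.
  by move=> [Ew sw]; exists (X (size s) w) => //; rewrite word_event_rcons.
by move=> [y _ [Ew]]; rewrite word_event_rcons => -[].
Qed.

Lemma prob_word_split s (E : set T) : measurable E ->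
  P (E `&` word_event X s) = \esum_(y in [set: G]) P (E `&` word_event X (rcons s y)).
Proof.
move=> mE; rewrite bigcup_word_event (measure_bigcup_inj _ _ finj)//.
- by move=> y; apply: measurableI => //; exact: measurable_word.
- by move=> y z _ _ [w [[_ +] [_ +]]]; rewrite !word_event_rcons => -[_ <-] [_ <-].
Qed.

(** * Ville's maximal inequality for nonnegative harmonic functions *)

Section Ville.
Variables (u : G -> R) (t : R).
Hypothesis u0 : forall x, 0 <= u x.
Hypothesis bu : bnd u.
Hypothesis hu : harmonic nu u.
Hypothesis t0 : 0 < t.

Let V N k := [set w | exists2 n, (n <= N)%N & t <= u (walk X w (k + n))].

Let mV N k : measurable (V N k).
Proof.
have -> : V N k = \bigcup_(n in [set n | n <= N]%N) [set w | t <= u (walk X w (k + n))].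
  by apply/seteqP; split=> w [n h1 h2]; exists n.
apply: bigcup_measurable => n _; exact: (measurable_walk _ [set x | t <= u x]).
Qed.

(** First-step analysis. If [u] is already at least [t] at the end of [s], the bound is trivial;
    otherwise the crossing happens after the next letter, and averaging the induction hypothesis
    over that letter gives back [u (gprod s)] by harmonicity. *)
Let ville_fin N s :
  (t%:E * P (V N (size s) `&` word_event X s) <= (\prod_(x <- s) nu x * u (gprod s))%:E)%E.
Proof.
elim: N s => [|N IH] s; have [tu|ut] := leP t (u (gprod s)).
1,3: apply: (@le_trans _ _ (t%:E * P (word_event X s))%E);
  [apply: lee_wpmul2l; [by rewrite lee_fin ltW|apply: le_measure; rewrite ?inE;
    [by apply: measurableI; [exact: mV|exact: measurable_word]|exact: measurable_word|by move=> w []]]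
  |by rewrite iid_word -EFinM lee_fin mulrC; apply: ler_wpM2l => //; exact: prod_mass_ge0].
- rewrite (_ : _ `&` _ = set0) ?measure0 ?mule0 ?lee_fin ?mulr_ge0 ?prod_mass_ge0//.
  rewrite -subset0 => w [[n]]; rewrite leqn0 => /eqP-> + ws.
  by rewrite addn0 (walk_word ws) => h; have := le_lt_trans h ut; rewrite ltxx.
rewrite prob_word_split//.
have -> : \esum_(y in [set: G]) P (V N.+1 (size s) `&` word_event X (rcons s y)) =
    \esum_(y in [set: G]) P (V N (size (rcons s y)) `&` word_event X (rcons s y)).
  apply: eq_esum => y _; congr (P _); apply/seteqP; split=> w [] [n nN h] ws; split => //.
    case: n nN h => [_ h|n nN h]; last by exists n => //; rewrite size_rcons addSn -addnS.
    have ws' : word_event X s w by move: (ws); rewrite word_event_rcons => -[].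
    by move: h; rewrite addn0 (walk_word ws') => h; have := le_lt_trans h ut; rewrite ltxx.
  by exists n.+1 => //; move: h; rewrite size_rcons addSn -addnS.
pose g y := fine (P (V N (size (rcons s y)) `&` word_event X (rcons s y))).
rewrite (eq_esum (b := fun y => (g y)%:E)); last first.
  by move=> y _; rewrite fineK// fin_num_measure//; apply: measurableI; [exact: mV|exact: measurable_word].
rewrite -esumZ; [|exact: ltW|by move=> y; exact: fine_ge0].
rewrite -(hu (gprod s)) EFinM Ex_ge0E//; last exact: bnd_comp.
rewrite -esumZ; [|exact: prod_mass_ge0|by move=> y; rewrite mulr_ge0].
apply: le_esum => y _.
apply: le_trans (_ : (t%:E * P (V N (size (rcons s y)) `&` word_event X (rcons s y)) <= _)%E).
  rewrite EFinM /g fineK// fin_num_measure//.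
  by apply: measurableI; [exact: mV|exact: measurable_word].
apply: le_trans (IH _) _; rewrite gprod_rcons -cats1 big_cat big_seq1 /=.
by rewrite mulrA.
Qed.

(** The walk starts at the identity; restricting to the event that it begins with [s] is the way to
    start it at [gprod s]. Here the horizon of [ville_fin] is sent to infinity. *)
Lemma ville s :
  (t%:E * P ([set w | exists n, (t <= u (walk X w (size s + n)))%R] `&` word_event X s)
    <= (\prod_(x <- s) nu x * u (gprod s))%:E)%E.
Proof.
have -> : [set w | exists n, t <= u (walk X w (size s + n))] `&` word_event X s =
    \bigcup_N (V N (size s) `&` word_event X s).
  apply/seteqP; split=> w.
    by move=> [[n h] ws]; exists n => //; split => //; exists n.
  by move=> [N _ [[n _ h] ws]]; split => //; exists n.
have mVW N : measurable (V N (size s) `&` word_event X s).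
  by apply: measurableI; [exact: mV|exact: measurable_word].
have nd : nondecreasing_seq (fun N => V N (size s) `&` word_event X s).
  move=> m n mn; apply/subsetPset => w [[k km h] ws]; split => //.
  by exists k => //; exact: leq_trans mn.
have cv := @nondecreasing_cvg_mu _ _ _ P _ mVW (bigcup_measurable (fun N _ => mVW N)) nd.
apply: (@le_trans _ _ (t%:E * (t^-1 * (\prod_(x <- s) nu x * u (gprod s)))%:E)%E); last first.
  by rewrite -EFinM mulrA mulfV ?gt_eqF// mul1r.
apply: lee_wpmul2l; first by rewrite lee_fin ltW.
rewrite -(cvg_lim _ cv)//; apply: lime_le; first exact: cvgP cv.
apply: nearW => N /=.
have := lee_wpmul2l (x := t^-1%:E) _ (ville_fin N s).
rewrite lee_fin invr_ge0 ltW// => /(_ isT).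
by rewrite muleA -!EFinM mulVf ?gt_eqF// mul1e.
Qed.

End Ville.
End IidWalk.

(** These copies of the path space carry the sigma-algebra generated by [cylinders] as their
    measurable structure, so that the closure properties of measurable sets apply to
    [path_measurable]. *)
Definition paths (G : groupType) : Type := nat -> G.
HB.instance Definition _ (G : groupType) := Choice.copy (paths G) (nat -> G).
HB.instance Definition _ (G : groupType) := isPointed.Build (paths G) (fun=> gone).
Definition path_sigma (G : groupType) := g_sigma_algebraType (@cylinders G : set (set (paths G))).
HB.instance Definition _ (G : groupType) := Measurable.on (path_sigma G).

Lemma path_preimage_measurable (G : groupType) d (T : measurableType d)
    (phi : T -> nat -> G) (A : set (nat -> G)) :
  (forall n g, measurable [set w | phi w n = g]) -> path_measurable A ->
  measurable [set w | A (phi w)].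
Proof.
move=> mphi mA.
suff : <<s @cylinders G >> `<=` [set A | measurable [set w | A (phi w)]] by move=> /(_ A mA).
apply: smallest_sub => [|_ [n [g ->]]]; last exact: mphi.
split=> /=.
- exact: measurable0.
- move=> B mB; rewrite (_ : [set _ | _] = ~` [set w | B (phi w)]); first exact: measurableC.
  by apply/seteqP; split=> w /= => [[]|].
- by move=> F mF; apply: bigcupT_measurable => i; exact: mF.
Qed.

Lemma path_measurable_coord (G : groupType) (f : G -> nat) (finj : injective f) n (C : set G) :
  path_measurable [set z | C (z n)].
Proof.
have -> : [set z : nat -> G | C (z n)] = \bigcup_(g in C) [set z | z n = g].
  by apply/seteqP; split=> z; [move=> Cz; exists (z n)|move=> [g Cg /= ->]].
apply: (@measurable_bigcup_inj _ f _ (path_sigma G) C _ finj) => g.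
by apply: sub_sigma_algebra; exists n, g.
Qed.

Lemma bnd_itv (T : Type) (f : T -> R) a b : (forall x, a <= f x <= b) -> bnd f.
Proof.
move=> h; exists (`|a| + `|b|) => x; have /andP[ha hb] := h x.
rewrite ler_norml; have := ler_norm a; have := ler_norm (- a); have := ler_norm b.
have := normr_ge0 a; have := normr_ge0 b; rewrite normrN => *.
by apply/andP; split; lra.
Qed.

Lemma harmonic_affine (G : groupType) (nu h : G -> R) c e : prob_mass nu -> bnd h ->
  harmonic nu h -> harmonic nu (fun x => c * h x + e).
Proof.
move=> [nu0 nu1] bh hh x.
have b1 : bnd (fun y => h (gmul x y)) by exact: bnd_comp.
rewrite ExD ?ExZ ?Ex_cst ?hh//; last exact: bnd_cst.
by apply: bndM => //; exact: bnd_cst.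
Qed.

Lemma prod_mass_gt0 (T : eqType) (nu : T -> R) (s : seq T) :
  (forall x, x \in s -> 0 < nu x) -> 0 < \prod_(x <- s) nu x.
Proof.
elim: s => [|x s IH] h; first by rewrite big_nil.
rewrite big_cons mulr_gt0 ?h ?mem_head// IH// => y ys.
by apply: h; rewrite in_cons ys orbT.
Qed.

(** For a non-constant [h], the event that [h (Z_n) >= c] infinitely often has probability neither 0
    nor 1. Non-degeneracy lets the walk visit a point where [h] is close to its supremum [b]; from
    there Ville's inequality for [b - h] gives a positive probability of staying above [c] forever.
    The same with [h - a] near the infimum [a] gives a positive probability of staying below [c]. *)
Lemma boundary_trivial_liouville (G : groupType) (nu : G -> R) :
  countable_group G -> prob_mass nu -> non_degenerate nu -> boundary_trivial nu ->
  liouville nu.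
Proof.
move=> cG pnu nd bt h h01 hh x0 y0; apply: contrapT => hne.
have [nu0 nu1] := pnu.
have bh := bnd_unit h01.
have S0 : range h !=set0 by exists (h x0), x0.
have hi : has_inf (range h).
  by split => //; exists 0 => _ [x _ <-]; have /andP[] := h01 x.
have hs : has_sup (range h).
  by split => //; exists 1 => _ [x _ <-]; have /andP[] := h01 x.
pose a := inf (range h); pose b := sup (range h).
have ha x : a <= h x by apply: ge_inf; [exact: (proj2 hi)|exists x].
have hb x : h x <= b by apply: ub_le_sup; [exact: (proj2 hs)|exists x].
have ab : a < b.
  rewrite lt_neqAle; apply/andP; split; last by have := ha x0; have := hb x0; lra.
  apply/eqP => e; apply: hne; apply/eqP; rewrite eq_le.
  by move: (ha x0) (hb x0) (ha y0) (hb y0); rewrite e => *; apply/andP; split; lra.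
have [_ [x _ <-] hx] : exists2 e, range h e & e < a + (b - a) / 2.
  by apply: inf_adherent => //; rewrite divr_gt0// subr_gt0.
have [_ [y _ <-] hy] : exists2 e, range h e & b - (b - a) / 2 < e.
  by apply: sup_adherent => //; rewrite divr_gt0// subr_gt0.
have [d [T [P [X iX]]]] := exists_iid cG pnu.
have [f finj] := cG.
(* [c] is the middle of the range and [t] half its length: [b - h < t] means [h > c], and
   [h - a < t] means [h < c]. *)
pose c := (a + b) / 2; pose t := (b - a) / 2.
have t0 : 0 < t by rewrite /t; lra.
pose A := [set z : nat -> G | forall N, exists2 n, (N <= n)%N & c <= h (z n)].
have mA : path_measurable A.
  have -> : A = \bigcap_N \bigcup_(n in [set n | N <= n]%N) [set z | c <= h (z n)].
    apply/seteqP; split=> z h1 N.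
      by move=> _; have [n h2 h3] := h1 N; exists n.
    by have [n h2 h3] := h1 N I; exists n.
  apply: (@bigcap_measurableType _ (path_sigma G)) => N _.
  apply: (@bigcup_measurable _ (path_sigma G)) => n _.
  exact: (path_measurable_coord finj n [set x | c <= h x]).
have iA : shift_invariant A.
  apply/seteqP; split=> z h1 N.
    by have [n h2 h3] := h1 N; exists n.+1 => //; exact: leqW.
  have [[|n] h2 h3] := h1 N.+1; first by [].
  by exists n.
pose E := [set w | A (walk X w)].
have mE : measurable E.
  by apply: path_preimage_measurable => // n g; exact: (measurable_walk finj iX n [set x | x = g]).
have key (u : G -> R) z : (forall x, 0 <= u x) -> bnd u -> harmonic nu u -> u z < t ->
    exists k W, [/\ measurable W, (0 < P W)%E &
      (P ([set w | exists n, (t <= u (walk X w (k + n)))%R] `&` W) < P W)%E].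
  move=> u0 bu hu uz.
  have [s [sne [spos sz]]] := nd z.
  have ps := prod_mass_gt0 spos.
  have mW := measurable_word iX s.
  exists (size s), (word_event X s); rewrite (iid_word iX) lte_fin; split => //.
  have := ville finj pnu iX u0 bu hu t0 s.
  set p := P _; have pf : p \is a fin_num.
    rewrite fin_num_measure//; apply: measurableI => //.
    rewrite (_ : [set _ | _] = \bigcup_n [set w | t <= u (walk X w (size s + n))]).
      by apply: bigcup_measurable => n _; exact: (measurable_walk finj iX _ [set x | t <= u x]).
    by apply/seteqP; split=> w; [move=> [n h1]|move=> [n _ h1]]; exists n.
  rewrite -(fineK pf) -EFinM lee_fin lte_fin /gprod sz => hp.
  rewrite -(ltr_pM2l t0); apply: le_lt_trans hp _.
  by rewrite mulrC ltr_pM2r.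
have Ple (W V : set T) k (u : G -> R) : measurable W -> P V = 0%E -> measurable V ->
    W `<=` V `|` [set w | exists n, (t <= u (walk X w (k + n)))%R] ->
    (P W <= P ([set w | exists n, (t <= u (walk X w (k + n)))%R] `&` W))%E.
  move=> mW V0 mV sub; rewrite -[leRHS]add0e -V0.
  have mU : measurable [set w | exists n, (t <= u (walk X w (k + n)))%R].
    rewrite (_ : [set _ | _] = \bigcup_n [set w | t <= u (walk X w (k + n))]).
      by apply: bigcup_measurable => n _; exact: (measurable_walk finj iX _ [set x | t <= u x]).
    by apply/seteqP; split=> w; [move=> [n h1]|move=> [n _ h1]]; exists n.
  apply: le_trans (_ : P (V `|` ([set w | exists n, (t <= u (walk X w (k + n)))%R] `&` W)) <= _)%E.
    apply: le_measure; rewrite ?inE//.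
      by apply: measurableU => //; exact: measurableI.
    by move=> w Ww; case: (sub _ Ww) => ?; [left|right].
  by apply: measureU2 => //; exact: measurableI.
have [PE|PE] := bt _ _ _ _ iX A mA iA.
- have hu : harmonic nu (fun x => -1 * h x + b) by exact: harmonic_affine.
  have [||||k [W [mW W0]]] := key (fun x => -1 * h x + b) y.
  + by move=> z; have := hb z; lra.
  + by apply: (@bnd_itv _ _ 0 b) => z; have := hb z; have /andP[] := h01 z; move=> *; apply/andP; split; lra.
  + exact: hu.
  + by move: hy; rewrite /t; lra.
  apply/negP; rewrite -leNgt; apply: (Ple W E k (fun x => -1 * h x + b)) => // w _.
  have [Ew|/existsNP[N hN]] := pselect (E w); first by left.
  right; exists N; rewrite leNgt; apply/negP => hlt; apply: hN.
  exists (k + N)%N; first exact: leq_addl.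
  by move: hlt; rewrite /t /c; lra.
- have hu : harmonic nu (fun x => 1 * h x + (- a)) by exact: harmonic_affine.
  have [||||k [W [mW W0]]] := key (fun x => 1 * h x + (- a)) x.
  + by move=> z; have := ha z; lra.
  + by apply: (@bnd_itv _ _ 0 (1 - a)) => z; have := ha z; have /andP[] := h01 z; move=> *; apply/andP; split; lra.
  + exact: hu.
  + by move: hx; rewrite /t; lra.
  apply/negP; rewrite -leNgt; apply: (Ple W (~` E) k (fun x => 1 * h x + (- a))) => //.
  + by rewrite probability_setC// PE subee.
  + exact: measurableC.
  move=> w _; have [Ew|] := pselect (E w); last by left.
  right; have [n kn hn] := Ew k; exists (n - k)%N; rewrite subnKC//.
  by move: hn; rewrite /t /c; lra.
Qed.

(** * From the Liouville property to trivial boundary *)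

Definition path_cylinder (G : groupType) (s : seq G) : set (nat -> G) :=
  [set z | mkseq z (size s) = s].

Lemma path_cylinder_measurable (G : groupType) (s : seq G) :
  path_measurable (path_cylinder s).
Proof.
elim/last_ind: s => [|s y IH].
  by rewrite (_ : path_cylinder _ = setT); [exact: (@measurableT _ (path_sigma G))|exact/seteqP].
rewrite (_ : path_cylinder _ = path_cylinder s `&` [set z | z (size s) = y]).
  apply: (@measurableI _ (path_sigma G)) => //.
  by apply: sub_sigma_algebra; exists (size s), y.
exact: (@word_event_rcons G (nat -> G) (fun n z => z n) s y).
Qed.

(** Dynkin's theorem: two cylinders are nested if one word is a prefix of the other and disjoint
    otherwise, so together with the empty set they form a pi-system. *)
Lemma path_cylinder_generate (G : groupType) (f : G -> nat) (finj : injective f)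
    (D : set (set (nat -> G))) :
  dynkin D -> D set0 -> (forall s, D (path_cylinder s)) ->
  forall A, path_measurable A -> D A.
Proof.
move=> dD D0 Ds A mA.
pose C := [set B : set (nat -> G) | B = set0 \/ exists s, B = path_cylinder s].
have CI : setI_closed C.
  move=> B1 B2 [->|[s ->]]; first by left; rewrite set0I.
  move=> [->|[t ->]]; first by left; rewrite setI0.
  wlog st : s t / (size s <= size t)%N => [hw|].
    by have [|/ltnW] := leqP (size s) (size t); [|rewrite setIC]; exact: hw.
  have [e|ne] := eqVneq (take (size s) t) s; [right; exists t|left].
    apply/seteqP; split=> z; first by case.
    move=> zt; split => //; rewrite /path_cylinder/= -[in RHS]e -[in RHS]zt.
    by rewrite /mkseq -map_take take_iota (minn_idPl st).
  rewrite -subset0 => z [zs zt]; move/eqP: ne; apply.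
  by rewrite -[in LHS]zt /mkseq -map_take take_iota (minn_idPl st).
have sub : <<s @cylinders G >> `<=` <<s C >>.
  apply: smallest_sub; first exact: smallest_sigma_algebra.
  move=> _ [n [g ->]].
  have [f' f'inj] := countable_seq finj.
  have -> : [set z : nat -> G | z n = g] =
      \bigcup_(s in [set s : seq G | size s = n]) path_cylinder (rcons s g).
    apply/seteqP; split=> z.
      move=> zn; exists (mkseq z n); first by rewrite /= size_mkseq.
      by rewrite /path_cylinder/= size_rcons size_mkseq -zn /mkseq -{1}addn1 iotaD map_cat cats1.
    move=> [s /= <-]; rewrite /path_cylinder/= size_rcons /mkseq -{1}addn1 iotaD map_cat/= cats1.
    by move=> /rcons_inj[].
  apply: (@measurable_bigcup_inj _ f' _ (g_sigma_algebraType (C : set (set (paths G)))) _ _ f'inj) => s.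
  by apply: sub_sigma_algebra; right; exists (rcons s g).
have := sub _ mA; rewrite -setI_closed_g_dynkin_g_sigma_algebra// => /(_ D); apply.
by split => // B [->//|[s ->]].
Qed.

(** Used twice: with [W] a word event it gives the Markov property, with [W] an invariant event it
    gives the independence of that event from the whole walk. *)
Lemma path_law_ext (G : groupType) (f : G -> nat) (finj : injective f)
    d (T : measurableType d) (P : probability T R) (phi psi : T -> nat -> G)
    (W : set T) (c : R) :
  measurable W -> 0 <= c ->
  (forall n g, measurable [set w | phi w n = g]) ->
  (forall n g, measurable [set w | psi w n = g]) ->
  (forall s, P (W `&` [set w | path_cylinder s (phi w)]) =
     c%:E * P [set w | path_cylinder s (psi w)])%E ->
  forall A, path_measurable A ->
    (P (W `&` [set w | A (phi w)]) = c%:E * P [set w | A (psi w)])%E.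
Proof.
move=> mW c0 mphi mpsi hs A mA.
have PW : P W = c%:E.
  have nilT (z : T -> nat -> G) : [set w | path_cylinder [::] (z w)] = setT by exact/seteqP.
  by have := hs [::]; rewrite !nilT setIT probability_setT mule1.
suff [] : path_measurable A /\ (P (W `&` [set w | A (phi w)]) = c%:E * P [set w | A (psi w)])%E by [].
apply: (path_cylinder_generate finj (D := [set A | path_measurable A /\
   (P (W `&` [set w | A (phi w)]) = c%:E * P [set w | A (psi w)])%E])) mA.
- split.
  + by split; [exact: (@measurableT _ (path_sigma G))|rewrite probability_setT mule1 setIT].
  + move=> B [mB hB]; split; first exact: (@measurableC _ (path_sigma G)).
    have m1 := path_preimage_measurable mphi mB.
    have m2 := path_preimage_measurable mpsi mB.
    rewrite [X in W `&` X](_ : _ = ~` [set w | B (phi w)])//.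
    rewrite [X in (_ * P X)%E](_ : _ = ~` [set w | B (psi w)])//.
    have fW : (P W < +oo)%E by rewrite PW ltry.
    have e : P (W `\` [set w | B (phi w)]) = (P W - P (W `&` [set w | B (phi w)]))%E.
      exact: measureD.
    rewrite probability_setC// -setDE e PW hB muleBr// ?mule1//.
  + move=> F tF hF; split.
      by apply: (@bigcupT_measurable _ (path_sigma G)) => n; have [] := hF n.
    have m1 n : measurable [set w | F n (phi w)] by apply: path_preimage_measurable => //; have [] := hF n.
    have m2 n : measurable [set w | F n (psi w)] by apply: path_preimage_measurable => //; have [] := hF n.
    rewrite (_ : W `&` _ = \bigcup_n (W `&` [set w | F n (phi w)])); last first.
      by rewrite -setI_bigcupr; congr (_ `&` _); apply/seteqP; split=> w [n _ ?]; exists n.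
    rewrite [X in (_ * P X)%E](_ : _ = \bigcup_n [set w | F n (psi w)]); last first.
      by apply/seteqP; split=> w [n _ ?]; exists n.
    rewrite (measure_bigcup_inj _ _ (@inj_id nat)); last 2 first.
    * by move=> i; exact: measurableI.
    * by move=> i j _ _ [w [[_ Fi] [_ Fj]]]; apply: (tF i j) => //; exists (phi w).
    rewrite (measure_bigcup_inj _ _ (@inj_id nat))//; last first.
    * by move=> i j _ _ [w [Fi Fj]]; apply: (tF i j) => //; exists (psi w).
    have fE n : P [set w | F n (psi w)] = (fine (P [set w | F n (psi w)]))%:E.
      by rewrite fineK// fin_num_measure.
    rewrite [in RHS](eq_esum (b := fun n => (fine (P [set w | F n (psi w)]))%:E)) => [|n _]//.
    rewrite -esumZ// => [|n]; last exact: fine_ge0.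
    by apply: eq_esum => n _; rewrite EFinM -fE; have [] := hF n.
- split; first exact: (@measurable0 _ (path_sigma G)).
  by rewrite measure0 mule0 setI0 measure0.
- by move=> s; split; [exact: path_cylinder_measurable|exact: hs].
Qed.

Section LiouvilleBoundary.
Variables (G : groupType) (nu : G -> R) (f : G -> nat).
Hypothesis finj : injective f.
Hypothesis pnu : prob_mass nu.
Variables (d : measure_display) (T : measurableType d) (P : probability T R).
Variable X : nat -> T -> G.
Hypothesis iX : iid_law nu P X.

Let nu0 : forall x, 0 <= nu x. Proof. by have [] := pnu. Qed.

Let mW s : measurable (word_event X s). Proof. exact: (measurable_word iX). Qed.

(** The start [g] and the first time [k] are separate parameters: the Markov property changes [k],
    shift invariance trades [k] letters for a new [g]. *)
Let twalk k (g : G) (w : T) : nat -> G :=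
  fun n => gmul g (gprod (mkseq (fun i => X (k + i)%N w) n)).

Lemma words_event (E : set T) k n (C : set (seq G)) : measurable E ->
  P (E `&` [set w | C (mkseq (fun i => X (k + i)%N w) n)]) =
  \esum_(t in [set t | C t /\ size t = n])
     P (E `&` [set w | mkseq (fun i => X (k + i)%N w) n = t]).
Proof.
move=> mE; have [f' f'inj] := countable_seq finj.
have mS t : measurable [set w | mkseq (fun i => X (k + i)%N w) n = t].
  have [e|ne] := eqVneq (size t) n.
    have -> : [set w | mkseq (fun i => X (k + i)%N w) n = t] = word_event (fun i => X (k + i)%N) t.
      by rewrite /word_event e.
    by apply: word_event_measurable => i g; have [mX _ _] := iX; exact: mX.
  rewrite (_ : [set w | _] = set0); first exact: measurable0.
  by rewrite -subset0 => w /= h; move/eqP: ne; apply; rewrite -h size_mkseq.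
rewrite -(measure_bigcup_inj _ _ f'inj).
- congr (P _); apply/seteqP; split=> w.
    move=> [Ew Cw]; exists (mkseq (fun i => X (k + i)%N w) n) => //.
    by rewrite /= size_mkseq.
  by move=> [t [Ct _] [Ew /= e]]; split => //=; rewrite e.
- by move=> t; exact: measurableI.
- by move=> t t' _ _ [w [[_ /= <-] [_ /= <-]]].
Qed.

Let prob_shift_words s n (C : set (seq G)) :
  P (word_event X s `&` [set w | C (mkseq (fun i => X (size s + i)%N w) n)]) =
  ((\prod_(x <- s) nu x)%:E * P [set w | C (mkseq (X^~ w) n)])%E.
Proof.
rewrite words_event//.
have := words_event (E := setT) 0 n C measurableT; rewrite setTI => ->.
rewrite (eq_esum (b := fun t => (\prod_(x <- s) nu x * \prod_(x <- t) nu x)%:E)); last first.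
  move=> t [_ tn]; rewrite -big_cat/= -(iid_word iX); congr (P _).
  apply/seteqP; split=> w; rewrite /word_event/= size_cat tn /mkseq iotaD map_cat add0n.
    move=> [hs ht]; congr (_ ++ _) => //.
    by rewrite -[X in iota X]addn0 iotaDl -map_comp.
  move=> /eqP; rewrite eqseq_cat ?size_map ?size_iota// => /andP[/eqP hs /eqP ht].
  split => //; move: ht; by rewrite -[X in iota X]addn0 iotaDl -map_comp.
rewrite esumZ; [|exact: prodr_ge0|by move=> t; exact: prodr_ge0].
congr (_ * _)%E; apply: eq_esum => t [_ tn].
by rewrite -(iid_word iX) setTI; congr (P _); rewrite /word_event tn.
Qed.

Let mtwalk k g n x : measurable [set w | twalk k g w n = x].
Proof.
rewrite (_ : [set w | _] = \bigcup_(t in [set t | size t = n /\ gmul g (gprod t) = x])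
   word_event (fun i => X (k + i)%N) t).
  have [f' f'inj] := countable_seq finj.
  apply: (measurable_bigcup_inj _ f'inj) => t.
  by apply: word_event_measurable => i y; have [mX _ _] := iX; exact: mX.
apply/seteqP; split=> w.
  move=> h; exists (mkseq (fun i => X (k + i)%N w) n) => /=.
    by rewrite size_mkseq.
  by rewrite /word_event/= size_mkseq.
by move=> [t [tn tx]]; rewrite /word_event/= tn /twalk => ->.
Qed.

Let prob_shift s g (A : set (nat -> G)) : path_measurable A ->
  (P (word_event X s `&` [set w | A (twalk (size s) g w)]) =
   (\prod_(x <- s) nu x)%:E * P [set w | A (twalk 0 g w)])%E.
Proof.
apply: (path_law_ext finj (mW s)); [exact: prodr_ge0|by move=> *; exact: mtwalk..|].
move=> t.
have e k : [set w | path_cylinder t (twalk k g w)] =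
   [set w | [set r | mkseq (fun i => gmul g (gprod (take i r))) (size t) = t]
      (mkseq (fun i => X (k + i)%N w) (size t))].
  apply/seteqP; split=> w; rewrite /path_cylinder/= => h; rewrite -[RHS]h; apply/eq_in_map => i;
  by rewrite mem_iota/= add0n => it; rewrite /twalk /mkseq -map_take take_iota (minn_idPl (ltnW it)).
by rewrite !e prob_shift_words.
Qed.

Let shift_n (A : set (nat -> G)) : shift_invariant A ->
  forall n z, A z <-> A (fun i => z (n + i)%N).
Proof.
move=> sA; elim=> [|n IH] z; first by [].
rewrite (IH z).
have -> : (fun i => z (n.+1 + i)%N) = Defs.shift (fun i => z (n + i)%N).
  by apply/funext => i; rewrite /Defs.shift addSnnS.
by rewrite -[X in X _ <-> _]sA.
Qed.

(** Dropping the first [size s] positions does not affect an invariant event, and leaves a walk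
    started at [gmul g (gprod s)] and independent of [s]. *)
Let prob_word s g (A : set (nat -> G)) : path_measurable A -> shift_invariant A ->
  (P (word_event X s `&` [set w | A (twalk 0 g w)]) =
   (\prod_(x <- s) nu x)%:E * P [set w | A (twalk 0 (gmul g (gprod s)) w)])%E.
Proof.
move=> mA sA; rewrite -prob_shift//; congr (P _).
have e w : word_event X s w -> (fun i => twalk 0 g w (size s + i)%N) = twalk (size s) (gmul g (gprod s)) w.
  move=> ws; apply/funext => i; rewrite /twalk /mkseq iotaD map_cat gprod_cat add0n.
  rewrite -monoid.mulgA; congr (gmul _ (gmul _ _)); first by rewrite -[in RHS]ws.
  by rewrite -[X in iota X]addn0 iotaDl -map_comp.
by apply/seteqP; split=> w [ws h]; split => //; move: h; have := shift_n sA (size s) (twalk 0 g w);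
  rewrite (e w ws) /= => -[h1 h2].
Qed.

Hypothesis Lnu : liouville nu.

Lemma invariant_event_trivial (A : set (nat -> G)) : path_measurable A -> shift_invariant A ->
  P [set w | A (walk X w)] = 0%E \/ P [set w | A (walk X w)] = 1%E.
Proof.
move=> mA sA.
have mtA g : measurable [set w | A (twalk 0 g w)] by apply: path_preimage_measurable => // *; exact: mtwalk.
pose h g := fine (P [set w | A (twalk 0 g w)]).
have hE g : P [set w | A (twalk 0 g w)] = (h g)%:E by rewrite /h fineK// fin_num_measure.
have h01 g : 0 <= h g <= 1.
  by rewrite -!lee_fin -hE measure_ge0 probability_le1.
(* Conditioning on the first increment shows that the probability of [A] is harmonic in the starting
   point. *)
have hh : harmonic nu h.
  have [_ nu1] := pnu.
  move=> g; apply/EFin_inj; rewrite (Ex_ge0E nu0 nu1); last 2 first.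
  - by move=> y; have /andP[] := h01 (gmul g y).
  - by apply: bnd_comp; exact: bnd_unit h01.
  rewrite -hE -[X in P X]setIT -(word_event_nil X) (prob_word_split finj iX) //.
  apply: eq_esum => y _; rewrite /= setIC prob_word// big_seq1 hE -EFinM.
  by rewrite /gprod/= monoid.mulg1.
have tA : [set w | A (walk X w)] = [set w | A (twalk 0 gone w)].
  apply/seteqP; split=> w; rewrite /= => Aw; [have e : twalk 0 gone w = walk X w|have e : walk X w = twalk 0 gone w];
    rewrite ?e//; by apply/funext => n; rewrite /twalk monoid.mul1g.
pose p := h gone.
have hp g : h g = p by exact: Lnu.
have mwk n g : measurable [set w | walk X w n = g].
  exact: (measurable_walk finj iX n [set x | x = g]).
have key s : P ([set w | A (walk X w)] `&` [set w | path_cylinder s (walk X w)]) =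
    (p%:E * P [set w | path_cylinder s (walk X w)])%E.
  have e : [set w | path_cylinder s (walk X w)] =
     [set w | [set r | mkseq (fun i => gprod (take i r)) (size s) = s]
      (mkseq (fun i => X (0 + i)%N w) (size s))].
    apply/seteqP; split=> w; rewrite /path_cylinder/= => hw; rewrite -[RHS]hw; apply/eq_in_map => i;
    by rewrite mem_iota/= add0n => it; rewrite walkE /mkseq -map_take take_iota (minn_idPl (ltnW it)).
  rewrite e words_event ?tA//.
  have := words_event (E := setT) 0 (size s) [set r | mkseq (fun i => gprod (take i r)) (size s) = s] measurableT.
  rewrite setTI => ->.
  rewrite [in RHS](eq_esum (b := fun t => (\prod_(x <- t) nu x)%:E)); last first.
    by move=> t [_ tn]; rewrite -(iid_word iX) setTI; congr (P _); rewrite /word_event tn.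
  rewrite -esumZ; [|by have /andP[] := h01 gone|by move=> t; exact: prodr_ge0].
  apply: eq_esum => t [_ tn].
  have -> : [set w | mkseq (fun i => X (0 + i)%N w) (size s) = t] = word_event X t.
    by rewrite /word_event tn.
  by rewrite setIC prob_word// hE hp mulrC.
have /andP[p0 p1] := h01 gone.
have mE : measurable [set w | A (walk X w)] by rewrite tA.
(* With [A] itself as conditioning event, independence from cylinders extends to independence of [A]
   from [A]: [p = p * p]. *)
have := path_law_ext finj mE p0 mwk mwk key mA.
rewrite setIid tA hE -/p -EFinM => pp'; have pp : p = p * p by exact: EFin_inj pp'.
have /eqP : p * (1 - p) = 0 by rewrite mulrBr mulr1 -pp subrr.
rewrite mulf_eq0 => /orP[/eqP->|]; first by left.
by rewrite subr_eq0 => /eqP <-; right.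
Qed.

End LiouvilleBoundary.

Lemma liouville_boundary_trivial (G : groupType) (nu : G -> R) :
  countable_group G -> prob_mass nu -> liouville nu -> boundary_trivial nu.
Proof.
by move=> [f finj] pnu Lnu d T P X iX A; exact: (invariant_event_trivial finj pnu iX Lnu).
Qed.

(** * Liouville measures and amenability *)

Lemma LIM_itv u a b : (forall n, a <= u n <= b) -> a <= LIM u <= b.
Proof.
move=> h; have bu := bnd_itv h.
rewrite -[X in X <= _ <= _]LIM_cst -[X in _ <= _ <= X]LIM_cst.
by apply/andP; split; apply: (LIM_le (N := 0%N)) => //;
  try exact: bnd_cst; move=> n _; have /andP[] := h n.
Qed.

Lemma mem_set_bool (T : Type) (p : pred T) (y : T) : (y \in [set x | p x]) = p y.
Proof. by apply/idP/idP; rewrite inE. Qed.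

Section MarkovOperator.
Variables (G : groupType) (nu : G -> R).
Hypothesis pnu : prob_mass nu.

Let nu0 : forall x, 0 <= nu x. Proof. by have [] := pnu. Qed.
Let nu1 : (\esum_(x in [set: G]) (nu x)%:E = 1)%E. Proof. by have [] := pnu. Qed.

Definition mop (f : G -> R) : G -> R := fun x => Ex nu (fun y => f (gmul x y)).

Lemma mop_bnd f : bnd f -> bnd (mop f).
Proof.
move=> [M hM]; exists M => x; rewrite ler_norml.
have b : bnd (fun y => f (gmul x y)) by exists M.
apply/andP; split.
  rewrite -(Ex_cst nu0 nu1 (- M)); apply: Ex_le => //; first exact: bnd_cst.
  by move=> y; have := hM (gmul x y); rewrite ler_norml => /andP[].
rewrite -[leRHS](Ex_cst nu0 nu1 M); apply: Ex_le => //; first exact: bnd_cst.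
by move=> y; have := hM (gmul x y); rewrite ler_norml => /andP[].
Qed.

Definition mopn n (f : G -> R) : G -> R := iter n mop f.

Lemma mopn_bnd n f : bnd f -> bnd (mopn n f).
Proof. by move=> bf; elim: n => //= n IH; exact: mop_bnd. Qed.

Lemma mopnS n f : mopn n.+1 f = mopn n (mop f).
Proof. by rewrite /mopn iterSr. Qed.

Lemma mopnSl n f : mopn n.+1 f = mop (mopn n f).
Proof. by []. Qed.

Lemma mop_le f g : bnd f -> bnd g -> (forall x, f x <= g x) -> forall x, mop f x <= mop g x.
Proof. by move=> bf bg h x; apply: Ex_le => //; exact: bnd_comp. Qed.

Lemma mopn_le n f g : bnd f -> bnd g -> (forall x, f x <= g x) ->
  forall x, mopn n f x <= mopn n g x.
Proof.
move=> bf bg h; elim: n => //= n IH x.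
by apply: mop_le => //; exact: mopn_bnd.
Qed.

Lemma mopnD n f g : bnd f -> bnd g ->
  mopn n (fun x => f x + g x) = fun x => mopn n f x + mopn n g x.
Proof.
move=> bf bg; elim: n => //= n ->; apply/funext => x; rewrite /mop ExD//.
  exact/bnd_comp/mopn_bnd.
exact/bnd_comp/mopn_bnd.
Qed.

Lemma mopnZ n c f : bnd f -> mopn n (fun x => c * f x) = fun x => c * mopn n f x.
Proof.
move=> bf; elim: n => //= n ->; apply/funext => x; rewrite /mop ExZ//.
exact/bnd_comp/mopn_bnd.
Qed.

Lemma mopn_cst n c : mopn n (fun=> c) = fun=> c.
Proof. by elim: n => //= n ->; apply/funext => x; rewrite /mop Ex_cst. Qed.

Lemma mopn_translate n f g x : mopn n (fun y => f (gmul g y)) x = mopn n f (gmul g x).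
Proof.
elim: n x => //= n IH x; rewrite /mop.
by congr Ex; apply/funext => y; rewrite IH monoid.mulgA.
Qed.

Lemma mopn_unit n f : (forall x, 0 <= f x <= 1) -> forall x, 0 <= mopn n f x <= 1.
Proof.
move=> h; elim: n => //= n IH x; exact: Ex_unit.
Qed.

Lemma mopn_ge0 n f : bnd f -> (forall x, 0 <= f x) -> forall x, 0 <= mopn n f x.
Proof.
move=> bf h x; rewrite -(congr1 (@^~ x) (mopn_cst n 0)); apply: mopn_le => //.
exact: bnd_cst.
Qed.

Lemma mop_jensen f : bnd f -> forall x, mop f x ^+ 2 <= mop (fun y => f y ^+ 2) x.
Proof. by move=> bf x; apply: Ex_jensen => //; exact: bnd_comp. Qed.

Lemma mopn_sqr_ge n h : bnd h -> harmonic nu h -> forall x,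
  h x ^+ 2 <= mopn n (fun y => h y ^+ 2) x.
Proof.
move=> bh hh; elim: n => // n IH x; rewrite mopnSl.
apply: (@le_trans _ _ (mop (fun y => h y ^+ 2) x)).
  by rewrite -[in leLHS](hh x); exact: mop_jensen.
by apply: mop_le => //; [exact: bndX2|apply: mopn_bnd; exact: bndX2].
Qed.

Lemma Ex_ind1 z : Ex nu (\1_[set z]) = nu z.
Proof.
apply/EFin_inj; rewrite Ex_ge0E//; last exact: bnd_ind.
rewrite -[RHS](esum_set1 (t := z) (a := fun x => (nu x)%:E)) ?lee_fin//.
rewrite [RHS]esum_mkcond; apply: eq_esum => x _; rewrite indicE.
by case: ifP => _; rewrite ?mulr1 ?mulr0.
Qed.

Lemma Ex_sum_seq (F : seq G) (v : G -> R) : uniq F -> bnd v ->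
  Ex nu (fun y => v y * \1_[set x | x \in F] y) = \sum_(y <- F) nu y * v y.
Proof.
move=> + bv; elim: F => [|z F IH] /=.
  move=> _; rewrite big_nil -[RHS](Ex_cst nu0 nu1); congr Ex; apply/funext => y.
  by rewrite indicE mem_set_bool mulr0.
move=> /andP[zF uF]; rewrite big_cons -IH// -Ex_ind1 mulrC -ExZ//; last exact: bnd_ind.
rewrite -ExD//.
- congr Ex; apply/funext => y; rewrite !indicE.
  rewrite !mem_set_bool in_cons.
  have -> : (y \in [set z]) = (y == z).
    by apply/idP/eqP => [/set_mem //|->]; exact: mem_set.
  by have [->|] := eqVneq y z; rewrite ?(negbTE zF) /= ?mulr1 ?mulr0 ?addr0 ?add0r.
- by apply: bndM; [exact: bnd_cst|exact: bnd_ind].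
- by apply: bndM => //; exact: bnd_ind.
Qed.

Lemma Ex_finite_approx (e : R) : 0 < e -> exists F : seq G,
  forall v, (forall y, 0 <= v y <= 1) ->
    `|Ex nu v - \sum_(y <- F) nu y * v y| <= e.
Proof.
move=> /(Ex_tight nu0 nu1)[F0 hF0]; exists (undup F0) => v v01.
have bv := bnd_unit v01.
rewrite -Ex_sum_seq ?undup_uniq// -ExB//; last by apply: bndM => //; exact: bnd_ind.
have b1 := bnd_ind [set x : G | x \notin F0].
have h y : 0 <= v y - v y * \1_[set x : G | x \in undup F0] y <= \1_[set x : G | x \notin F0] y.
  rewrite !indicE.
  rewrite !mem_set_bool mem_undup.
  have /andP[v0 v1] := v01 y.
  by case: (y \in F0) => /=; apply/andP; split; lra.
have b2 : bnd (fun y => v y - v y * \1_[set x : G | x \in undup F0] y).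
  by apply: (@bnd_itv _ _ 0 1) => y; have /andP[h1 h2] := h y; rewrite h1 (le_trans h2)// indicE lern1 leq_b1.
rewrite ger0_norm; last by apply: Ex_ge0 => // y; have /andP[] := h y.
by apply: le_trans hF0; apply: Ex_le => // y; have /andP[] := h y.
Qed.

(** [LIM] commutes with finite sums only. Up to [e], the expectation is a finite sum, with the same
    finite set for all functions with values in [[0, 1]]. *)
Lemma Ex_LIM (v : nat -> G -> R) : (forall n y, 0 <= v n y <= 1) ->
  Ex nu (fun y => LIM (v^~ y)) = LIM (fun n => Ex nu (v n)).
Proof.
move=> v01.
have bv y : bnd (v^~ y) by apply: bnd_unit.
have L01 y : 0 <= LIM (v^~ y) <= 1 by exact: LIM_itv.
have bE : bnd (fun n => Ex nu (v n)) by apply: bnd_unit => n; exact: Ex_unit.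
apply/eqP; rewrite -subr_eq0 -normr_le0; apply/ler_addgt0Pl => e e0; rewrite addr0.
have [F hF] := Ex_finite_approx (divr_gt0 e0 (ltr0Sn _ 1)).
have h1 := hF _ L01.
have bs : bnd (fun n => \sum_(y <- F) nu y * v n y).
  elim: F {hF h1} => [|y F [M hM]]; first by exists 0 => n; rewrite big_nil normr0.
  exists (nu y + M) => n; rewrite big_cons; apply: le_trans (ler_normD _ _) _.
  apply: lerD => //; rewrite normrM !ger0_norm//.
    by rewrite -[leRHS]mulr1; apply: ler_wpM2l => //; have /andP[] := v01 n y.
  by have /andP[] := v01 n y.
have h2 : `|LIM (fun n => Ex nu (v n) - \sum_(y <- F) nu y * v n y)| <= e / 2.
  by apply: (LIM_abs (N := 0%N)) => [|n _]; [exact: bndB|exact: hF].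
move: h2; rewrite LIMB// LIM_sum; last first.
  by move=> y; apply: bndM; [exact: bnd_cst|exact: bv].
under eq_bigr do rewrite LIMZ//.
move: h1; rewrite !ler_norml => /andP[h1 h2] /andP[h3 h4].
by apply/andP; split; lra.
Qed.

(** For each [A] the limit [h A x] of the Cesaro means started at [x] is harmonic, hence independent
    of [x]. Translating [A] by [g] amounts to starting from [g^-1], so this independence is the
    invariance of the mean. *)
Lemma liouville_amenable : liouville nu -> amenable G.
Proof.
move=> Lnu.
pose av n (A : set G) x := n.+1%:R^-1 * \sum_(k < n.+1) mopn k (\1_A) x.
have i01 (A : set G) x : 0 <= (\1_A x : R) <= 1 by rewrite indicE ler0n lern1 leq_b1.
have m01 k A x : 0 <= mopn k (\1_A) x <= 1 by exact: mopn_unit.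
have s01 n A x : 0 <= \sum_(k < n.+1) mopn k (\1_A) x <= n.+1%:R.
  apply/andP; split; first by apply: sumr_ge0 => k _; have /andP[] := m01 k A x.
  rewrite -[leRHS](_ : \sum_(k < n.+1) (1 : R) = _); last by rewrite sumr_const card_ord.
  by apply: ler_sum => k _; have /andP[] := m01 k A x.
have a01 n A x : 0 <= av n A x <= 1.
  have /andP[h1 h2] := s01 n A x.
  by rewrite /av mulr_ge0 ?invr_ge0//= ler_pdivrMl// mulr1.
have bav A x : bnd (fun n => av n A x) by exact: bnd_unit.
pose h A x := LIM (fun n => av n A x).
have h01 A x : 0 <= h A x <= 1 by exact: LIM_itv.
have avD n A x : mop (av n A) x = n.+1%:R^-1 * \sum_(k < n.+1) mopn k.+1 (\1_A) x.
  rewrite /mop /av ExZ//; last first.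
    by apply: (@bnd_itv _ _ 0 n.+1%:R) => y; exact: s01.
  congr (_ * _).
  have -> N : Ex nu (fun y => \sum_(k < N) mopn k (\1_A) (gmul x y)) = \sum_(k < N) mopn k.+1 (\1_A) x; last by [].
  elim: N => [|N IH].
    rewrite big_ord0 -[RHS](Ex_cst nu0 nu1); congr Ex; apply/funext => y.
    by rewrite big_ord0.
  rewrite big_ord_recr /= -IH -ExD//.
  - by congr Ex; apply/funext => y; rewrite big_ord_recr.
  - apply: (@bnd_itv _ _ 0 N.+1%:R) => y; case: N {IH} => [|N]; first by rewrite big_ord0; apply/andP; split; lra.
    by have /andP[-> hs] := s01 N A (gmul x y); apply: le_trans hs _; rewrite ler_nat.
  - by apply: bnd_comp; apply: bnd_unit => ?; exact: m01.
have hh A : harmonic nu (h A).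
  move=> x; rewrite /h Ex_LIM//.
  apply/eqP; rewrite -subr_eq0 -LIMB//; last by apply: bnd_unit => n; exact: Ex_unit.
  apply/eqP; apply: LIM0; first by apply: bndB => //; apply: bnd_unit => n; exact: Ex_unit.
  (* The Cesaro sums telescope: the defect of harmonicity is at most [1 / (n + 1)]. *)
  move=> e e0; exists (Num.truncn e^-1) => n hn.
  rewrite -/(mop (av n A) x) avD -mulrBr.
  rewrite big_ord_recr [in X in _ - X]big_ord_recl /=.
  set S1 := \sum_(i < n) _.
  rewrite normrM ger0_norm ?invr_ge0//.
  apply: (@le_trans _ _ n.+1%:R^-1).
    rewrite -[leRHS]mulr1; apply: ler_wpM2l; first by rewrite invr_ge0.
    have /andP[p1 p2] := m01 n.+1 A x; have /andP[p3 p4] := i01 A x.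
    by rewrite ler_norml /=; move: p1 p2; rewrite /= => *; apply/andP; split; lra.
  rewrite invf_ple ?posrE//.
  apply: le_trans (ltW (truncnS_gt _)) _.
  by rewrite ler_nat ltnS.
exists (fun A => h A gone); split.
- rewrite /h -[RHS](LIM_cst 1); congr LIM; apply/funext => n.
  rewrite /av (_ : \1_[set: G] = fun=> 1); last by apply/funext => x; rewrite indicE in_setT.
  under eq_bigr do rewrite mopn_cst.
  by rewrite sumr_const card_ord mulVf.
- by move=> A; have /andP[] := h01 A gone.
- move=> A B AB; rewrite /h -LIMD//; congr LIM; apply/funext => n.
  rewrite /av -mulrDr -big_split/=; congr (_ * _); apply: eq_bigr => k _.
  rewrite -(congr1 (@^~ gone) (mopnD k (bnd_ind A) (bnd_ind B))); congr (mopn k _ _).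
  apply/funext => x; rewrite !indicE in_setU.
  case: (boolP (x \in A)); case: (boolP (x \in B)); rewrite ?addr0 ?add0r//.
  by rewrite !inE => Bx Ax; exfalso; have : (A `&` B) x by []; rewrite AB.
- move=> g A; transitivity (h A (ginv g)).
    rewrite /h; congr LIM; apply/funext => n; rewrite /av; congr (_ * _).
    apply: eq_bigr => k _; rewrite -[in RHS](monoid.mulg1 (ginv g)) -mopn_translate.
    congr (mopn k _ _); apply/funext => x; rewrite !indicE; congr ((nat_of_bool _)%:R).
    apply/idP/idP; rewrite !inE.
      by move=> [y Ay <-]; rewrite monoid.mulKg.
    by move=> Ax; exists (gmul (ginv g) x) => //; rewrite monoid.mulVKg.
  by apply: Lnu; [exact: h01|exact: hh].
Qed.

End MarkovOperator.

(** * Harmonic functions and finite conjugacy classes *)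

Definition vanishes (u : nat -> R) : Prop :=
  forall e, 0 < e -> exists N, forall n, (N <= n)%N -> u n <= e.

Lemma vanishes_le u v : vanishes v -> (forall n, u n <= v n) -> vanishes u.
Proof. by move=> hv h e /hv[N hN]; exists N => n /hN; exact: le_trans. Qed.

Lemma vanishesD u v : vanishes u -> vanishes v -> vanishes (fun n => u n + v n).
Proof.
move=> hu hv e e0; have e2 : 0 < e / 2 by rewrite divr_gt0.
have [N hN] := hu _ e2; have [M hM] := hv _ e2; exists (maxn N M) => n.
by rewrite geq_max => /andP[/hN h1 /hM h2]; move: h1 h2; lra.
Qed.

Lemma vanishesZ c u : 0 < c -> vanishes u -> vanishes (fun n => c * u n).
Proof.
move=> c0 hu e e0; have [|N hN] := hu (c^-1 * e); first by rewrite mulr_gt0 ?invr_gt0.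
by exists N => n /hN; rewrite ler_pdivlMl.
Qed.

Lemma vanishesS u : vanishes u -> vanishes (fun n => u n.+1).
Proof. by move=> hu e /hu[N hN]; exists N => n nN; apply: hN; exact: leqW. Qed.

Lemma vanishes_incr u M : (forall n, u n <= u n.+1) -> (forall n, u n <= M) ->
  vanishes (fun n => u n.+1 - u n).
Proof.
move=> mono bM e e0.
have hs : has_sup (range u) by split; [exists (u 0%N), 0%N|exists M => _ [n _ <-]].
have [_ [N _ <-] hN] := sup_adherent e0 hs.
have mon m n : (m <= n)%N -> u m <= u n.
  move=> /subnK <-; elim: (n - m)%N => //= k IH; apply: le_trans IH _; exact: mono.
exists N => n /mon h1; have h2 : u n.+1 <= sup (range u).
  by apply: ub_le_sup; [exact: (proj2 hs)|exists n.+1].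
by move: hN h1 h2; lra.
Qed.

Section HarmonicIncrements.
Variables (G : groupType) (nu : G -> R).
Hypothesis pnu : prob_mass nu.
Hypothesis ndnu : non_degenerate nu.
Local Notation P := (mopn nu).

Let nu0 : forall x, 0 <= nu x. Proof. by have [] := pnu. Qed.
Let nu1 : (\esum_(x in [set: G]) (nu x)%:E = 1)%E. Proof. by have [] := pnu. Qed.

Let sqdiff (h : G -> R) g x := (h (gmul x g) - h x) ^+ 2.

Let sqdiff_bnd h g : bnd h -> bnd (sqdiff h g).
Proof. by move=> bh; apply/bndX2/bndB => //; exact: bnd_comp. Qed.

Let variance h x : bnd h -> harmonic nu h ->
  mop nu (fun y => h y ^+ 2) x - h x ^+ 2 =
  Ex nu (fun y => (h (gmul x y) - h x) ^+ 2).
Proof.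
move=> bh hh.
have b1 : bnd (fun y => h (gmul x y)) by exact: bnd_comp.
have b2 := bndX2 b1.
rewrite (_ : (fun y => (h (gmul x y) - h x) ^+ 2) = fun y =>
   (h (gmul x y) ^+ 2 - 2 * h x * h (gmul x y)) + h x ^+ 2); last first.
  by apply/funext => y; rewrite sqrrB; lra.
have b3 : bnd (fun y => 2 * h x * h (gmul x y)) by apply: bndM => //; exact: bnd_cst.
rewrite (ExD nu0 nu1 (bndB b2 b3) (bnd_cst _ _)) (ExB nu0 nu1 b2 b3).
rewrite (ExZ nu0 nu1 _ b1) Ex_cst// hh /mop; lra.
Qed.

(** The means [P^n h^2] increase and are bounded, so their increments [P^n V] tend to 0, [V] being
    the one-step variance of [h]. For a letter [s] of positive mass, [nu s] times the squared
    increment along [s] is at most [V]; a general [g] is a product of such letters. *)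
Lemma increments_vanish h g : bnd h -> harmonic nu h ->
  vanishes (fun n => P n (fun x => (h (gmul x g) - h x) ^+ 2) gone).
Proof.
move=> bh hh.
have bh2 := bndX2 bh.
pose V x := mop nu (fun y => h y ^+ 2) x - h x ^+ 2.
have bV : bnd V by apply: bndB => //; exact: mop_bnd.
have vV : vanishes (fun n => P n V gone).
  have -> : (fun n => P n V gone) = fun n => P n.+1 (fun y => h y ^+ 2) gone - P n (fun y => h y ^+ 2) gone.
    apply/funext => n; rewrite mopnS.
    have := mopnD pnu n bV bh2 => /(congr1 (@^~ gone)) /=.
    rewrite (_ : (fun x => V x + h x ^+ 2) = mop nu (fun y => h y ^+ 2)); first by move=> ->; lra.
    by apply/funext => x; rewrite /V subrK.
  have [M M0 hM] := bnd_ge0 bh2.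
  have [M' hM'] : bnd (fun n => P n (fun y => h y ^+ 2) gone).
    exists M => n; have b' : bnd (fun _ : G => M) by exact: bnd_cst.
    rewrite ger0_norm; last by apply: mopn_ge0 => // x; exact: sqr_ge0.
    rewrite -[leRHS](congr1 (@^~ gone) (mopn_cst pnu n M)); apply: mopn_le => // x.
    by apply: le_trans (hM x); exact: ler_norm.
  apply: (@vanishes_incr _ M') => n; last by apply: le_trans (hM' n); exact: ler_norm.
  rewrite mopnS; apply: mopn_le => //; first exact: mop_bnd.
  by move=> x; have := mopn_sqr_ge pnu 1 bh hh x.
have one s : 0 < nu s -> forall x, sqdiff h s x <= (nu s)^-1 * V x.
  move=> s0 x; rewrite ler_pdivlMl// /V variance//.
  apply: (@Ex_atom _ nu nu0 nu1 (fun y => (h (gmul x y) - h x) ^+ 2) s).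
    by move=> y; exact: sqr_ge0.
  by apply/bndX2/bndB; [exact: bnd_comp|exact: bnd_cst].
have [w [_ [wpos <-]]] := ndnu g; rewrite -/(gprod w).
elim: w wpos => [|s w IH] wpos.
  apply: (vanishes_le vV) => n; apply: mopn_le => //.
    by apply: sqdiff_bnd.
  by move=> x; rewrite monoid.mulg1 subrr expr0n /= /V variance//; apply: Ex_ge0 => // [y|];
    [exact: sqr_ge0|apply/bndX2/bndB; [exact: bnd_comp|exact: bnd_cst]].
have s0 : 0 < nu s by apply: wpos; rewrite mem_head.
have {}IH : vanishes (fun n => P n (sqdiff h (gprod w)) gone).
  by apply: IH => x xw; apply: wpos; rewrite in_cons xw orbT.
have c0 : 0 < 2 * (nu s)^-1 by rewrite mulr_gt0 ?invr_gt0.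
(* The increment along [s :: w] is the one along [s] followed by the one along [w], whence the
   factors 2. The latter is taken at [gmul x s], hence is at most [(nu s)^-1] times a mean over one
   more step: this is the time shift [vanishesS]. *)
apply: (vanishes_le (vanishesD (vanishesZ c0 (vanishesS IH)) (vanishesZ c0 vV))) => n.
have bD := sqdiff_bnd (gprod w) bh.
have bm := mop_bnd pnu bD.
rewrite mopnS -[X in _ <= X + _](congr1 (@^~ gone) (mopnZ pnu n _ bm)).
rewrite -[X in _ <= _ + X](congr1 (@^~ gone) (mopnZ pnu n _ bV)).
have b1 : bnd (fun x => 2 / nu s * mop nu (sqdiff h (gprod w)) x) by apply: bndM => //; exact: bnd_cst.
have b2 : bnd (fun x => 2 / nu s * V x) by apply: bndM => //; exact: bnd_cst.
rewrite -[leRHS](congr1 (@^~ gone) (mopnD pnu n b1 b2)).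
apply: mopn_le => //; [exact: sqdiff_bnd|exact: bndD|move=> x].
have h1 := one _ s0 x.
have h2 : sqdiff h (gprod w) (gmul x s) <= (nu s)^-1 * mop nu (sqdiff h (gprod w)) x.
  rewrite ler_pdivlMl//.
  apply: (@Ex_atom _ nu nu0 nu1 (fun y => sqdiff h (gprod w) (gmul x y)) s).
    by move=> y; exact: sqr_ge0.
  exact: bnd_comp.
move: h1 h2; rewrite /sqdiff /= -/(gprod w) monoid.mulgA.
set a := h (gmul (gmul x s) _); set b := h (gmul x s); set c := h x => h1 h2.
by have := sqr_ge0 ((a - b) - (b - c)); rewrite !sqrrD !sqrrN; move: h1 h2; nra.
Qed.

(** Left translation by [c] is a bounded right increment: [c x = x (x^-1 c x)], and [x^-1 c x] lies
    in the finite list [C] up to [K]. So the square of the harmonic function [u x = f (c x) - f x]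
    is at most a finite sum of squared right increments, whose means tend to 0; as
    [u(1)^2 <= P^n u^2 (1)], [u] vanishes at the identity. *)
Lemma fc_invariant (h : G -> R) (K : set G) (C : seq G) : bnd h -> harmonic nu h ->
  (forall x k, K k -> h (gmul x k) = h x) ->
  (forall x c, c \in C -> exists c' k,
     [/\ c' \in C, K k & gmul (gmul (ginv x) c) x = gmul c' k]) ->
  forall c y, c \in C -> h (gmul y c) = h y.
Proof.
move=> + + + hC c y cC.
(* Left translates of [h] remain harmonic, since the walk multiplies on the right; so [y] may be
   taken to be the identity. *)
suff key f : bnd f -> harmonic nu f -> (forall x k, K k -> f (gmul x k) = f x) ->
    f c = f gone.
  move=> bh hh hK; have := key (fun x => h (gmul y x)); rewrite monoid.mulg1; apply.
  - exact: bnd_comp.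
  - by move=> x; rewrite -[RHS]hh; congr Ex; apply/funext => z; rewrite monoid.mulgA.
  - by move=> x k /hK; rewrite monoid.mulgA.
move=> bf hf fK.
pose u x := f (gmul c x) - f x.
have bu : bnd u by apply: bndB => //; exact: bnd_comp.
have hu : harmonic nu u.
  move=> x; rewrite /u.
  have b1 : bnd (fun z => f (gmul c (gmul x z))) by exact: (bnd_comp (fun z => gmul c (gmul x z))).
  have b2 : bnd (fun z => f (gmul x z)) by exact: bnd_comp.
  rewrite (ExB nu0 nu1 b1 b2) hf; congr (_ - _).
  by rewrite -[RHS]hf; congr Ex; apply/funext => z; rewrite monoid.mulgA.
have sum_ge (s : seq G) x c' : c' \in s -> sqdiff f c' x <= \sum_(g <- s) sqdiff f g x.
  elim: s => // g s IH; rewrite in_cons big_cons => /predU1P[<-|/IH hs].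
    by rewrite lerDl sumr_ge0// => i _; exact: sqr_ge0.
  by apply: le_trans hs _; rewrite lerDr sqr_ge0.
have le_u x : u x ^+ 2 <= \sum_(g <- C) sqdiff f g x.
  have [c' [k [c'C Kk e]]] := hC x c cC.
  apply: le_trans (sum_ge C x c' c'C); rewrite /u /sqdiff.
  have -> : gmul c x = gmul (gmul x c') k.
    by rewrite -monoid.mulgA -e !monoid.mulgA monoid.mulgV monoid.mul1g.
  by rewrite (fK _ _ Kk).

have bs (s : seq G) : bnd (fun x => \sum_(g <- s) sqdiff f g x).
  elim: s => [|g s [M IH]]; first by exists 0 => x; rewrite big_nil normr0.
  have [N hN] := sqdiff_bnd g bf; exists (N + M) => x; rewrite big_cons.
  by apply: le_trans (ler_normD _ _) _; exact: lerD.
have vs (s : seq G) : vanishes (fun n => P n (fun x => \sum_(g <- s) sqdiff f g x) gone).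
  elim: s => [|g s IH].
    move=> e e0; exists 0%N => n _.
    rewrite (_ : (fun x => _) = fun=> 0); last by apply/funext => x; rewrite big_nil.
    by rewrite mopn_cst// ltW.
  apply: (vanishes_le (vanishesD (increments_vanish g bf hf) IH)) => n.
  rewrite -(congr1 (@^~ gone) (mopnD pnu n (sqdiff_bnd g bf) (bs s))).
  by rewrite (_ : (fun x => \sum_(_ <- _ :: _) _) = fun x => sqdiff f g x + \sum_(j <- s) sqdiff f j x)//;
     apply/funext => x; rewrite big_cons.
have : u gone ^+ 2 <= 0.
  apply/ler_addgt0Pl => e /(vs C)[N hN]; rewrite addr0.
  apply: le_trans (mopn_sqr_ge pnu N bu hu gone) _.
  apply: le_trans (hN N (leqnn N)); apply: mopn_le => //; exact: bndX2.
rewrite le_eqVlt ltNge sqr_ge0 orbF sqrf_eq0 /u subr_eq0 monoid.mulg1 => /eqP.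
exact.
Qed.

End HarmonicIncrements.

(** [i] embeds [H] as a direct factor and [p] is the projection onto it, so that conjugating [i a]
    by [y] only involves [p y]. *)
Lemma no_ICC_factor_invariant (G H : groupType) (i : H -> G) (p : G -> H) (nu h : G -> R) :
  prob_mass nu -> non_degenerate nu ->
  {morph i : a b / gmul a b} -> i gone = gone ->
  (forall y a, gmul (gmul (ginv y) (i a)) y = i (gmul (gmul (ginv (p y)) a) (p y))) ->
  ~ has_nontrivial_ICC_factor H -> bnd h -> harmonic nu h ->
  forall x a, h (gmul x (i a)) = h x.
Proof.
move=> pnu nd iM i1 iJ noICC bh hh.
(* Inserting [i n] in the middle, rather than at the right end, makes [K] normal at once. *)
pose K := [set n | forall x y, h (gmul (gmul x (i n)) y) = h (gmul x y)].
have KN : normal_subgroup K.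
  split.
  - by move=> x y; rewrite i1 monoid.mulg1.
  - by move=> a b Ka Kb x y; rewrite iM monoid.mulgA Kb Ka.
  - move=> a Ka x y; rewrite -(Ka (gmul x (i (ginv a)))).
    by rewrite -(monoid.mulgA x) -iM monoid.mulVg i1 monoid.mulg1.
  - move=> g a Ka x y; rewrite !iM !monoid.mulgA.
    have := Ka (gmul x (i g)) (gmul (i (ginv g)) y); rewrite !monoid.mulgA => ->.
    by rewrite -(monoid.mulgA x) -iM monoid.mulgV i1 monoid.mulg1.
have [K1 KM KV KJ] := KN.
have hK x k : K k -> h (gmul x (i k)) = h x.
  by move=> /(_ x gone); rewrite !monoid.mulg1.
suff KT : K = setT by move=> x a; apply: hK; rewrite KT.
apply: contrapT => KT; apply: noICC; exists K; split => // g nKg finC; apply: nKg.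
have /finite_seqP[s hs] := finC.
(* One conjugate of [g] is chosen in each of the finitely many cosets; every conjugate then lies in
   this finite list up to [K], as [fc_invariant] requires. *)
pose conj b := gmul (gmul b g) (ginv b).
pose rep (A : set H) := conj (xget gone [set b | A = coset K (conj b)]).
have repP b : coset K (rep (coset K (conj b))) = coset K (conj b).
  by rewrite /rep; case: xgetP => [b' _ /= <-//|/(_ b)]; case.
have ins b : coset K (conj b) \in s.
  by have : [set` s] (coset K (conj b)) by rewrite -hs; exists b.
have decomp b : exists2 k, K k & conj b = gmul (rep (coset K (conj b))) k.
  exists (gmul (ginv (rep (coset K (conj b)))) (conj b)); last by rewrite monoid.mulVKg.
  have : coset K (conj b) (conj b) by rewrite /coset/= monoid.mulVg.
  by rewrite -[X in X _]repP.
have conjJ b z : gmul (gmul (ginv z) (conj b)) z = conj (gmul (ginv z) b).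
  by rewrite /conj monoid.invgM monoid.invgK !monoid.mulgA.
pose C := [seq i (rep A) | A <- s].
have hC c y : c \in C -> h (gmul y c) = h y.
  apply: (@fc_invariant _ nu pnu nd h (i @` K) C) => //.
    by move=> x _ [k Kk <-]; exact: hK.
  move=> x _ /mapP[A As ->].
  have [b ->] : exists b, rep A = conj b by rewrite /rep; eexists.
  rewrite iJ conjJ; have [k Kk e] := decomp (gmul (ginv (p x)) b).
  exists (i (rep (coset K (conj (gmul (ginv (p x)) b))))), (i k); split.
  - exact: map_f.
  - by exists k.
  - by rewrite -iM -e.
have hconj y b : h (gmul y (i (conj b))) = h y.
  have [k Kk ->] := decomp b; rewrite iM monoid.mulgA hK//; apply: hC; exact: map_f.
move=> x y.
have -> : gmul (gmul x (i g)) y = gmul (gmul x y) (gmul (gmul (ginv y) (i g)) y).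
  by rewrite !monoid.mulgA monoid.mulgK.
rewrite iJ; have := hconj (gmul x y) (ginv (p y)).
by rewrite /conj monoid.invgK.
Qed.

(** * Null sets of an invariant mean *)

Lemma conj_quotient (G : groupType) (b r x y : G) :
  gmul (ginv (gmul (ginv r) (gmul (gmul (ginv b) x) b))) (gmul (ginv r) (gmul (gmul (ginv b) y) b)) =
  gmul (gmul (ginv b) (gmul (ginv x) y)) b.
Proof. by rewrite !monoid.invgM !monoid.invgK !monoid.mulgA !monoid.mulgK. Qed.

Section InvariantMean.
Variables (G : groupType) (m : set G -> R).
Hypothesis mT : m [set: G] = 1.
Hypothesis m_ge0 : forall A, 0 <= m A.
Hypothesis mU : forall A B, A `&` B = set0 -> m (A `|` B) = m A + m B.
Hypothesis mI : forall g A, m [set gmul g x | x in A] = m A.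

Lemma mean0 : m set0 = 0.
Proof. by have := mU (set0I (@set0 G)); rewrite setU0; lra. Qed.

Lemma mean_le A B : A `<=` B -> m A <= m B.
Proof.
move=> AB; rewrite -(setDUK AB) mU; last by rewrite setDIK.
by rewrite lerDl.
Qed.

Lemma null_sub A B : A `<=` B -> m B = 0 -> m A = 0.
Proof. by move=> /mean_le AB B0; apply/eqP; rewrite eq_le m_ge0 -B0 AB. Qed.

Lemma nullU A B : m A = 0 -> m B = 0 -> m (A `|` B) = 0.
Proof.
move=> A0 B0; have -> : A `|` B = A `|` (B `\` A).
  by rewrite setDE setUIr setUv setIT.
by rewrite mU ?setDIK// A0 add0r; apply: null_sub B0 => x [].
Qed.

Lemma null_seq (I : eqType) (s : seq I) (F : I -> set G) :
  (forall i, i \in s -> m (F i) = 0) -> m [set x | exists2 i, i \in s & F i x] = 0.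
Proof.
elim: s => [|i s IH] h.
  by rewrite (_ : [set _ | _] = set0) ?mean0// -subset0 => x [].
have h1 := h i (mem_head _ _).
have h2 : m [set x | exists2 i, i \in s & F i x] = 0.
  by apply: IH => j js; apply: h; rewrite in_cons js orbT.
apply: null_sub (nullU h1 h2) => x [j]; rewrite in_cons => /predU1P[->|js Fx]; first by left.
by right; exists j.
Qed.

Lemma not_null_ex A B : A `|` B = setT -> m A = 0 -> exists x, B x.
Proof.
move=> AB A0; apply: contrapT => /forallNP nB; have : m [set: G] = 0; last by rewrite mT; lra.
by rewrite -AB; apply: null_sub A0 => x [//|/nB].
Qed.

(** [n] pairwise disjoint translates have total mean [n * m D <= 1] for every [n]. *)
Lemma null_translates (D : set G) (g : nat -> G) :
  (forall i j x y, i <> j -> D x -> D y -> gmul (g i) x <> gmul (g j) y) -> m D = 0.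
Proof.
move=> dj; apply/eqP; rewrite eq_le m_ge0 andbT leNgt; apply/negP => D0.
have key n : n%:R * m D = m (\bigcup_(i in [set i | (i < n)%N]) [set gmul (g i) x | x in D]).
  elim: n => [|n IH].
    by rewrite mul0r (_ : \bigcup_(_ in _) _ = set0) ?mean0// -subset0 => x [].
  rewrite -natr1 mulrDl mul1r IH -[in X in _ + X = _](mI (g n)) -mU.
    congr m; apply/seteqP; split=> x.
      by move=> [[i /= ilt hx]|hx]; [exists i => //=; exact: ltnW|exists n => /=].
    move=> [i /=]; rewrite ltnS leq_eqVlt => /predU1P[->|ilt] hx; [by right|by left; exists i].
  rewrite -subset0 => x [[i /= ilt [y Dy <-]] [z Dz e]].
  by apply: (dj n i z y) => // ni; rewrite ni ltnn in ilt.
have := key (Num.truncn (m D)^-1).+1.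
have h1 := truncnS_gt (m D)^-1.
have h2 := mean_le (@subsetT _ (\bigcup_(i in [set i | (i < (Num.truncn (m D)^-1).+1)%N]) [set gmul (g i) x | x in D])).
move=> e; move: h2; rewrite -e mT; apply/negP; rewrite -ltNge.
by rewrite -ltr_pdivrMr// div1r.
Qed.

Section ICCQuotient.
Variable N : set G.
Hypothesis nN : normal_subgroup N.
Hypothesis icc : quotient_ICC N.

Let N1 : N gone. Proof. by have [] := nN. Qed.
Let NM x y : N x -> N y -> N (gmul x y). Proof. by have [_ h _ _] := nN; exact: h. Qed.
Let NV x : N x -> N (ginv x). Proof. by have [_ _ h _] := nN; exact: h. Qed.
Let NJ g x : N x -> N (gmul (gmul g x) (ginv g)). Proof. by have [_ _ _ h] := nN; exact: h. Qed.

Lemma coset_eq x y : N (gmul (ginv x) y) -> coset N x = coset N y.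
Proof.
move=> h; apply/seteqP; split=> z; rewrite /coset/= => hz.
  by have := NM (NV h) hz; rewrite monoid.invgM monoid.invgK -monoid.mulgA monoid.mulVKg.
by have := NM h hz; rewrite -monoid.mulgA monoid.mulVKg.
Qed.

Lemma ICC_sequence k : ~ N k -> exists g : nat -> G,
  forall i j, N (gmul (ginv (gmul (gmul (g i) k) (ginv (g i)))) (gmul (gmul (g j) k) (ginv (g j)))) -> i = j.
Proof.
move=> /icc /infiniteP /card_leP[phi].
have h n : exists h, coset N (gmul (gmul h k) (ginv h)) = val (phi (to_setT n)).
  by have := set_valP (phi (to_setT n)) => -[x _ e]; exists x.
have [g hg] := choice h.
exists g => i j /coset_eq; rewrite !hg => /val_inj e.
have : to_setT i = to_setT j by apply: (@inj _ _ _ phi) => //; rewrite inE.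
by move=> /(congr1 val).
Qed.

(** Let [g i] conjugate [k] to elements distinct modulo [N]. A point [b] of the translate by [g i]
    satisfies [b^-1 (g_i k g_i^-1) b = r] modulo [N], which determines [g_i k g_i^-1] modulo [N]; so
    these translates are disjoint. *)
Lemma null_conj k r : ~ N k -> m [set a | N (gmul (ginv r) (gmul (gmul (ginv a) k) a))] = 0.
Proof.
move=> /ICC_sequence[g hg].
apply: (@null_translates _ g) => i j x y ij /= Dx Dy e; apply/ij/hg.
set b := gmul (g i) x in e.
have ex : x = gmul (ginv (g i)) b by rewrite /b monoid.mulKg.
have ey : y = gmul (ginv (g j)) b by rewrite e monoid.mulKg.
have cj h : gmul (gmul (ginv (gmul (ginv h) b)) k) (gmul (ginv h) b) =
    gmul (gmul (ginv b) (gmul (gmul h k) (ginv h))) b.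
  by rewrite monoid.invgM monoid.invgK !monoid.mulgA.
move: Dx Dy; rewrite ex ey !cj; set xi := gmul (gmul (g i) k) _; set xj := gmul (gmul (g j) k) _.
clearbody xi xj b; move=> /NV Dx /(NM Dx); rewrite conj_quotient => /(NJ b).
by rewrite !monoid.mulgA monoid.mulgK monoid.mulgV monoid.mul1g.
Qed.

(** A non-trivial ICC quotient is infinite: the conjugates of some [k] outside [N] fill infinitely
    many cosets, and they carry the coset of [x] to disjoint ones. *)
Lemma null_coset x : N <> setT -> m [set a | N (gmul (ginv x) a)] = 0.
Proof.
move=> NT; have [k nk] : exists k, ~ N k.
  by apply: contrapT => /forallNP h; apply: NT; apply/seteqP; split=> // y _; exact: contrapT (h y).
have [g hg] := ICC_sequence nk.
apply: (@null_translates _ (fun i => gmul (gmul (gmul (g i) k) (ginv (g i))) (ginv x))) => i j a b ij /= Na Nb.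
move=> e; apply/ij/hg; move: e.
set xi := gmul (gmul (g i) k) _; set xj := gmul (gmul (g j) k) _; clearbody xi xj => e.
have e2 : xj = gmul (gmul xi (gmul (ginv x) a)) (ginv (gmul (ginv x) b)).
  by rewrite monoid.mulgA e -(monoid.mulgA xj) monoid.mulgK.
by rewrite e2 -monoid.mulgA monoid.mulKg; apply: NM => //; exact: NV.
Qed.

End ICCQuotient.
End InvariantMean.

(** * Almost invariant measures *)

(* A finitely supported measure is a list of (weight, atom) pairs. *)
Definition wsum (T : Type) (L : seq (R * T)) (f : T -> R) : R := \sum_(p <- L) p.1 * f p.2.

Definition wprob (T : Type) (L : seq (R * T)) : Prop :=
  (forall p, List.In p L -> 0 <= p.1) /\ wsum L (fun=> 1) = 1.

Section Wsum.
Variable T : Type.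
Implicit Types (L : seq (R * T)) (f g : T -> R).

Lemma wsumD L f g : wsum L (fun x => f x + g x) = wsum L f + wsum L g.
Proof. by rewrite /wsum -big_split; apply: eq_bigr => p _; rewrite /= mulrDr. Qed.

Lemma wsumZ L c f : wsum L (fun x => c * f x) = c * wsum L f.
Proof. by rewrite /wsum mulr_sumr; apply: eq_bigr => p _; rewrite mulrCA. Qed.

Lemma wsumB L f g : wsum L (fun x => f x - g x) = wsum L f - wsum L g.
Proof.
rewrite wsumD; congr (_ + _); rewrite -[RHS]mulN1r -wsumZ.
by congr wsum; apply/funext => x; rewrite mulN1r.
Qed.

Lemma wsum_cat L L' f : wsum (L ++ L') f = wsum L f + wsum L' f.
Proof. by rewrite /wsum big_cat. Qed.

Lemma wsum_scale L c f : wsum [seq (c * p.1, p.2) | p <- L] f = c * wsum L f.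
Proof. by rewrite /wsum big_map mulr_sumr; apply: eq_bigr => p _ /=; rewrite mulrA. Qed.

Lemma wsum_le L f g : (forall p, List.In p L -> 0 <= p.1) ->
  (forall p, List.In p L -> f p.2 <= g p.2) -> wsum L f <= wsum L g.
Proof.
rewrite /wsum; elim: L => [|p L IH] w0 fg; first by rewrite !big_nil.
rewrite !big_cons; apply: lerD.
  by apply: ler_wpM2l; [apply: w0; left|apply: fg; left].
by apply: IH => q qL; [apply: w0; right|apply: fg; right].
Qed.

Lemma wsum_cst L c : wprob L -> wsum L (fun=> c) = c.
Proof.
move=> [_ h1]; rewrite -[RHS]mulr1 -h1 -wsumZ; congr wsum.
by apply/funext => x; rewrite mulr1.
Qed.

Lemma wsum_sum (I : Type) (s : seq I) L (f : I -> T -> R) :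
  wsum L (fun x => \sum_(i <- s) f i x) = \sum_(i <- s) wsum L (f i).
Proof.
rewrite /wsum exchange_big/=; apply: eq_bigr => p _; by rewrite mulr_sumr.
Qed.

End Wsum.

Lemma wsum_map (S T : Type) (L : seq (R * S)) (g : S -> T) (f : T -> R) :
  wsum [seq (p.1, g p.2) | p <- L] f = wsum L (fun x => f (g x)).
Proof. by rewrite /wsum big_map. Qed.

(** * From invariant means to almost invariant measures avoiding a null set *)

Section Reiter.
Variables (G : groupType) (m : set G -> R).
Hypothesis mT : m [set: G] = 1.
Hypothesis m_ge0 : forall A, 0 <= m A.
Hypothesis mU : forall A B, A `&` B = set0 -> m (A `|` B) = m A + m B.
Hypothesis mI : forall g A, m [set gmul g x | x in A] = m A.

Section FiniteIntegral.
Variables (T : finType) (F : G -> T).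

Let mean_fiber_seq (s : seq T) : uniq s ->
  m [set x | F x \in s] = \sum_(t <- s) m [set x | F x = t].
Proof.
elim: s => [|t s IH] /=.
  move=> _; rewrite big_nil -(mean0 mU); congr m; by apply/seteqP; split.
move=> /andP[ts us]; rewrite big_cons -IH// -mU.
  congr m; apply/seteqP; split=> x /=; rewrite in_cons.
    by move=> /predU1P[->|]; [left|right].
  by move=> [->|->]; rewrite ?eqxx ?orbT.
by rewrite -subset0 => x [/= -> h]; rewrite h in ts.
Qed.

Lemma mean_fiber (P : pred T) : m [set x | P (F x)] = \sum_(t | P t) m [set x | F x = t].
Proof.
rewrite -big_filter -mean_fiber_seq; last exact/filter_uniq/index_enum_uniq.
congr m; apply/seteqP; split=> x /=; by rewrite mem_filter mem_index_enum andbT.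
Qed.

(** The mean is given on sets only. Functions with finitely many values are integrated as sums over
    these values, and the integral does not depend on how finely the values are recorded. *)
Lemma mean_push (T' : finType) (pi : T -> T') (phi : T' -> R) :
  \sum_t phi (pi t) * m [set x | F x = t] = \sum_t' phi t' * m [set x | pi (F x) = t'].
Proof.
rewrite (partition_big pi xpredT)//=; apply: eq_bigr => t' _.
have -> : [set x | pi (F x) = t'] = [set x | pi (F x) == t'].
  by apply/seteqP; split=> x /eqP.
rewrite (mean_fiber (fun t => pi t == t')) mulr_sumr.
by apply: eq_bigr => t /eqP ->.
Qed.

End FiniteIntegral.

Variables (Bad : set G) (e : nat -> G).
Hypothesis nullBad : m Bad = 0.
Hypothesis esurj : forall x, exists n, e n = x.

(** A game: one player picks a finite measure [L], the other a function [phi k] for each [k], and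
    the gain is the [L]-mean of the sum over [k] of [phi k (k x) - phi k x]. A measure against which
    no strategy bounded by 1 gains [ep] is almost invariant under [K]. *)
Let strat (phi : G -> G -> R) c := forall k x, `|phi k x| <= c.
Let payoff (K : seq G) (phi : G -> G -> R) x := \sum_(k <- K) (phi k (gmul k x) - phi k x).

Let payoff_bound K phi c x : strat phi c -> `|payoff K phi x| <= (size K)%:R * (2 * c).
Proof.
move=> h; rewrite /payoff; elim: K => [|k K IH]; first by rewrite big_nil normr0 mul0r.
rewrite big_cons; apply: le_trans (ler_normD _ _) _.
rewrite /= -natr1 mulrDl mul1r addrC; apply: lerD => //.
by apply: le_trans (ler_normB _ _) _; rewrite mulr2n mulrDl mul1r; apply: lerD.
Qed.

(* Repeatedly playing a good reply to the mixture weighted by the current deficits keeps the sum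
   of squared deficits linear in time, so the time average of the replies is good at every point. *)
Let finite_minimax K (ep : R) (xs : seq G) : 0 < ep ->
  (forall L, wprob L -> (forall p, List.In p L -> p.2 \in xs) ->
     exists2 phi, strat phi 1 & ep <= wsum L (payoff K phi)) ->
  exists2 phi, strat phi 1 & forall x, x \in xs -> ep / 2 <= payoff K phi x.
Proof.
move=> ep0 hL.
pose deficit T Phi x := Num.max 0 (T%:R * ep - payoff K Phi x).
(* A bound for [|payoff - ep|] over strategies bounded by 1; one round adds at most [c ^+ 2] per
   point to the squared deficits. *)
pose c := (size K)%:R * 2 + ep.
have pD Phi phi x : payoff K (fun k x => Phi k x + phi k x) x = payoff K Phi x + payoff K phi x.
  by rewrite /payoff -big_split; apply: eq_bigr => k _ /=; lra.
have step T : exists2 Phi, strat Phi T%:R &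
   \sum_(x <- xs) deficit T Phi x ^+ 2 <= T%:R * (size xs)%:R * c ^+ 2.
  elim: T => [|T [Phi hPhi IH]].
    exists (fun _ _ => 0) => [k x|]; first by rewrite normr0.
    rewrite !mul0r big1// => x _.
    have p0 : payoff K (fun _ _ => 0) x = 0 by rewrite /payoff big1// => k _; rewrite subrr.
    by rewrite /deficit mul0r p0 subr0 maxxx expr0n.
  have [phi hphi hv] : exists2 phi, strat phi 1 &
      0 <= \sum_(x <- xs) deficit T Phi x * (payoff K phi x - ep).
    pose W := \sum_(x <- xs) deficit T Phi x.
    have d0 x : 0 <= deficit T Phi x by rewrite /deficit le_max lexx.
    have W0 : 0 <= W by exact: sumr_ge0.
    have [Wz|Wn] := eqVneq W 0.
      exists (fun _ _ => 0) => [k x|]; first by rewrite normr0 ler01.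
      rewrite big_seq big1// => x xxs; rewrite (_ : deficit T Phi x = 0) ?mul0r//.
      move: Wz => /eqP; rewrite /W psumr_eq0// => /allP/(_ x xxs)/eqP; exact.
    have {Wn W0}W0 : 0 < W by rewrite lt_neqAle eq_sym Wn.
    pose L := [seq (W^-1 * deficit T Phi x, x) | x <- xs].
    have sL f : wsum L f = W^-1 * \sum_(x <- xs) deficit T Phi x * f x.
      by rewrite /wsum big_map mulr_sumr; apply: eq_bigr => x _ /=; rewrite mulrA.
    have [||phi hphi h] := hL L.
    - split.
        move=> p; rewrite /L => /List.in_map_iff[x [<- _]] /=.
        by rewrite mulr_ge0 ?invr_ge0 ?(ltW W0).
      rewrite sL; under eq_bigr do rewrite mulr1.
      by rewrite mulVf ?gt_eqF.
    - move=> p; rewrite /L => /List.in_map_iff[x [<- xin]] /=.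
      by elim: {hL W L W0 sL IH} xs xin => //= y s IHs [->|/IHs h]; rewrite in_cons ?eqxx ?h ?orbT.
    exists phi => //; move: h; rewrite sL ler_pdivlMl// => h.
    rewrite (eq_bigr (fun x => deficit T Phi x * payoff K phi x - ep * deficit T Phi x)); last first.
      by move=> x _; rewrite mulrBr [ep * _]mulrC.
    by rewrite sumrB -mulr_sumr -/W; move: h; lra.
  exists (fun k x => Phi k x + phi k x) => [k x|].
    by rewrite -natr1; apply: le_trans (ler_normD _ _) _; apply: lerD.
  apply: (@le_trans _ _ (\sum_(x <- xs) (deficit T Phi x ^+ 2
     - 2 * (deficit T Phi x * (payoff K phi x - ep)) + c ^+ 2))).
    apply: ler_sum => x _; rewrite /deficit pD -natr1.
    have hb : `|payoff K phi x - ep| <= c.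
      apply: le_trans (ler_normB _ _) _; rewrite /c; apply: lerD; last by rewrite gtr0_norm.
      by apply: le_trans (payoff_bound K x hphi) _; rewrite mulr1.
    have hb2 : (payoff K phi x - ep) ^+ 2 <= c ^+ 2.
      by rewrite -[leLHS]real_normK ?num_real// ler_sqr ?nnegrE ?(le_trans (normr_ge0 _) hb).
    set a := T%:R * ep - payoff K Phi x; set v := payoff K phi x - ep in hb2 *.
    have -> : (T%:R + 1) * ep - (payoff K Phi x + payoff K phi x) = a - v by rewrite /a /v; lra.
    case: (leP 0 a) => ha; case: (leP 0 (a - v)) => hav.
    - by rewrite sqrrB; lra.
    - by have := sqr_ge0 (a - v); rewrite sqrrB expr0n /=; lra.
    - rewrite expr0n/= mul0r mulr0 subr0 add0r; apply: le_trans hb2.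
      by rewrite -[leRHS]sqrrN ler_sqr ?nnegrE; lra.
    - by rewrite expr0n/= mul0r mulr0 subr0 add0r sqr_ge0.
  rewrite big_split /= sumrB -mulr_sumr.
  have -> : \sum_(x <- xs) c ^+ 2 = (size xs)%:R * c ^+ 2.
    by rewrite big_const_seq count_predT iter_addr_0 mulr_natl.
  by rewrite -natr1; move: IH hv; lra.
have c0 : 0 < c by rewrite /c ltr_wpDl.
(* [T] is so large that the total [T * size xs * c^2] is below [(T * ep / 2)^2]: then no point can
   have a deficit of [T * ep / 2]. *)
pose T := (Num.truncn (4 * (size xs)%:R * c ^+ 2 / ep ^+ 2)).+1.
have hT : 4 * (size xs)%:R * c ^+ 2 < T%:R * ep ^+ 2.
  by rewrite -ltr_pdivrMr ?exprn_gt0// truncnS_gt.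
have T0 : (0 : R) < T%:R by rewrite ltr0n.
have [Phi hPhi hs] := step T.
exists (fun k x => T%:R^-1 * Phi k x) => [k x|x xin].
  by rewrite normrM gtr0_norm ?invr_gt0// ler_pdivrMl// mulr1.
have -> : payoff K (fun k x => T%:R^-1 * Phi k x) x = T%:R^-1 * payoff K Phi x.
  by rewrite /payoff mulr_sumr; apply: eq_bigr => k _; rewrite mulrBr.
rewrite ler_pdivlMl// leNgt; apply/negP => hlt.
have h1 : (T%:R * ep / 2) ^+ 2 <= deficit T Phi x ^+ 2.
  rewrite ler_sqr ?nnegrE ?divr_ge0 ?mulr_ge0 ?(ltW T0) ?(ltW ep0)//; last by rewrite /deficit le_max lexx.
  by rewrite /deficit le_max; apply/orP; right; move: hlt; lra.
have h2 : deficit T Phi x ^+ 2 <= \sum_(x <- xs) deficit T Phi x ^+ 2.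
  rewrite (big_rem x)//= lerDl; apply: sumr_ge0 => *; exact: sqr_ge0.
have : (T%:R * ep / 2) ^+ 2 <= T%:R * (size xs)%:R * c ^+ 2 by exact: le_trans h1 (le_trans h2 hs).
rewrite !exprMn expr2; set n := (size xs)%:R in hT *.
apply/negP; rewrite -ltNge.
have -> : T%:R * T%:R * ep ^+ 2 * (2^-1) ^+ 2 = T%:R * (T%:R * ep ^+ 2) / 4 by field.
by rewrite ltr_pdivlMr// -!mulrA ltr_pM2l//; move: hT; lra.
Qed.
(** By invariance, the integral of [phi k (k x) - phi k x] is 0 for each [k], so the payoff cannot
    be bounded below by [ep] off a null set. To integrate with a mean on sets, [phi] is first
    rounded to finitely many values. *)
Let no_bounded_cocycle K (ep : R) (phi : G -> G -> R) : 0 < ep -> strat phi 1 ->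
  ~ (forall x, ~ Bad x -> ep <= payoff K phi x).
Proof.
move=> ep0 sphi hphi.
(* Multiplying by [D] and rounding down costs at most [size K] in the payoff; with this [D] a gain
   of at least 1 is left. *)
pose D := (Num.truncn (((size K)%:R + 1) / ep)).+1.
have hD : (size K)%:R + 1 < D%:R * ep by rewrite -ltr_pdivrMr// truncnS_gt.
have D0 : (0 : R) < D%:R by rewrite ltr0n.
pose q k x := Num.truncn (D%:R * (phi k x + 1)).
have r0 k x : 0 <= D%:R * (phi k x + 1).
  by rewrite mulr_ge0 ?(ltW D0)//; have := sphi k x; rewrite ler_norml => /andP[h _]; lra.
have q1 k x : (q k x)%:R <= D%:R * (phi k x + 1) by rewrite truncn_le.
have q2 k x : D%:R * (phi k x + 1) < (q k x)%:R + 1 by rewrite natr1; exact: truncnS_gt.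
have qlt k x : (q k x < (2 * D).+1)%N.
  rewrite ltnS -(ler_nat R); apply: le_trans (q1 k x) _.
  rewrite natrM mulrC; apply: ler_wpM2r; first exact: ltW.
  by have := sphi k x; rewrite ler_norml => /andP[_ h]; lra.
pose kk (j : 'I_(size K)) := nth gone K j.
pose F x : {ffun 'I_(size K) -> ('I_(2 * D).+1 * 'I_(2 * D).+1)%type} :=
  [ffun j => (inord (q (kk j) (gmul (kk j) x)), inord (q (kk j) x))].
have Fq x j : (F x j).1 = q (kk j) (gmul (kk j) x) :> nat /\ (F x j).2 = q (kk j) x :> nat.
  by rewrite ffunE /= !inordK.
pose J : R := \sum_(t : {ffun 'I_(size K) -> ('I_(2 * D).+1 * 'I_(2 * D).+1)%type}) (\sum_j (((t j).1)%:R - ((t j).2)%:R)) * m [set x | F x = t].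
have J0 : J = 0.
  rewrite /J; under eq_bigr do rewrite mulr_suml.
  rewrite exchange_big /= big1// => j _.
  under eq_bigr do rewrite mulrBl.
  rewrite sumrB; apply/eqP; rewrite subr_eq0; apply/eqP.
  have := mean_push F (fun t => (t j).1) (fun v => (v%:R : R)) => ->.
  have := mean_push F (fun t => (t j).2) (fun v => (v%:R : R)) => ->.
  apply: eq_bigr => v _; congr (_ * _).
  rewrite -(mI (kk j) [set x | (F x j).1 = v]); congr m; apply/seteqP; split=> x /=.
    move=> [y e1 <-]; apply: val_inj => /=.
    by rewrite (proj2 (Fq _ j)) -e1 (proj1 (Fq _ j)).
  move=> e2; exists (gmul (ginv (kk j)) x); last by rewrite monoid.mulVKg.
  apply: val_inj => /=; by rewrite (proj1 (Fq _ j)) monoid.mulVKg -e2 (proj2 (Fq _ j)).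
have J1 : 1 <= J.
  rewrite -mT -[leLHS](_ : \sum_t m [set x | F x = t] = _); last first.
    rewrite -(mean_fiber F xpredT) ; congr m; exact/seteqP.
  apply: ler_sum => t _.
  have [[x [Fx nBx]]|] := pselect (exists x, F x = t /\ ~ Bad x); last first.
    move=> /forallNP h; rewrite (_ : m _ = 0) ?mulr0//.
    apply: (null_sub m_ge0 mU _ nullBad) => x /= Fx.
    by apply: contrapT => nB; apply: (h x).
  rewrite -[leLHS]mul1r; apply: ler_wpM2r => //.
  have -> : \sum_j (((t j).1)%:R - ((t j).2)%:R) =
     \sum_(k <- K) ((q k (gmul k x))%:R - (q k x)%:R) :> R.
    rewrite (big_nth gone) big_mkord; apply: eq_bigr => j _.
    by rewrite -Fx (proj1 (Fq _ j)) (proj2 (Fq _ j)).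
  apply: (@le_trans _ _ (D%:R * payoff K phi x - (size K)%:R)).
    have := hphi x nBx; rewrite -(ler_pM2l D0); move: hD; lra.
  rewrite /payoff mulr_sumr -[X in _ - X](_ : \sum_(k <- K) (1 : R) = _); last first.
    by rewrite big_const_seq count_predT iter_addr_0.
  rewrite -sumrB; apply: ler_sum => k _.
  by have := q1 k x; have := q2 k (gmul k x); lra.
by move: J1; rewrite J0; lra.
Qed.

(** If every measure carried by the complement of [Bad] could be beaten, minimax would give, for
    each finite part of that complement, one strategy good at all its points. A [LIM] of these along
    an enumeration of the group is good off [Bad], against [no_bounded_cocycle]. *)
Lemma reiter (K : seq G) (ep : R) : 0 < ep ->
  exists L, [/\ wprob L, forall p, List.In p L -> ~ Bad p.2 &
    forall k f, k \in K -> (forall x, `|f x| <= 1) ->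
      `|wsum L (fun x => f (gmul k x)) - wsum L f| <= ep].
Proof.
move=> ep0; apply: contrapT => /forallNP nL.
(* Without repetitions, a test function for a single [k] is a strategy whose payoff has a single
   term. *)
pose K' := undup K.
have hL L : wprob L -> (forall p, List.In p L -> ~ Bad p.2) ->
    exists2 phi, strat phi 1 & ep <= wsum L (payoff K' phi).
  move=> pL gL; apply: contrapT => h; apply: (nL L); split => // k f kK f1.
  have one (f' : G -> R) : (forall x, `|f' x| <= 1) -> wsum L (fun x => f' (gmul k x)) - wsum L f' < ep.
    move=> f'1; rewrite ltNge; apply/negP => hge; apply: h.
    exists (fun k' x => if k' == k then f' x else 0) => [k' x|].
      by case: ifP; rewrite ?normr0 ?ler01.
    apply: (le_trans hge); rewrite -wsumB le_eqVlt; apply/orP; left; apply/eqP; congr wsum.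
    apply/funext => x; rewrite /payoff (bigD1_seq k) ?undup_uniq ?mem_undup//= eqxx big1 ?addr0//.
    by move=> k' /negbTE ->; rewrite subrr.
  rewrite ler_norml; apply/andP; split; last exact/ltW/one.
  have fN x : `|- f x| <= 1 by rewrite normrN.
  have := one _ fN; rewrite (_ : wsum L (fun x => - f (gmul k x)) = - wsum L (fun x => f (gmul k x))); last first.
    by rewrite -[RHS]mulN1r -wsumZ; congr wsum; apply/funext => x; rewrite mulN1r.
  rewrite (_ : wsum L (fun x => - f x) = - wsum L f); last first.
    by rewrite -[RHS]mulN1r -wsumZ; congr wsum; apply/funext => x; rewrite mulN1r.
  by lra.
pose good n := [seq x <- [seq e i | i <- iota 0 n] | ~~ `[< Bad x >]].
have hphi n : exists phi, strat phi 1 /\ forall x, x \in good n -> ep / 2 <= payoff K' phi x.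
  have [|phi h1 h2] := @finite_minimax K' ep (good n) ep0; last by exists phi.
  move=> L pL hp; apply: hL => // p pL'; have := hp p pL'.
  by rewrite mem_filter => /andP[/asboolPn].
have [ph hph] := choice hphi.
pose phi k x := LIM (fun n => ph n k x).
have b k x : bnd (fun n => ph n k x) by exists 1 => n; have [] := hph n.
have sphi : strat phi 1.
  by move=> k x; apply: (LIM_abs (N := 0%N)) => // n _; have [] := hph n.
apply: (no_bounded_cocycle (K := K') (ep := ep / 2) _ sphi); first by rewrite divr_gt0.
move=> x nBx; have [j ej] := esurj x.
have -> : payoff K' phi x = LIM (fun n => payoff K' (ph n) x).
  rewrite /payoff LIM_sum; last by move=> k; exact: bndB.
  by apply: eq_bigr => k _; rewrite LIMB.
rewrite -[leLHS]LIM_cst; apply: (LIM_le (N := j.+1)); first exact: bnd_cst.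
  by exists ((size K')%:R * (2 * 1)) => n; apply: payoff_bound; have [] := hph n.
move=> n jn; have [_ h] := hph n; apply: h.
rewrite mem_filter; apply/andP; split; first exact/asboolPn.
by apply/mapP; exists j => //; rewrite mem_iota.
Qed.

End Reiter.

(** * Generic elements and switching *)

Section Fresh.
Variables (G : groupType) (N : set G) (K : seq G).
Hypothesis nN : normal_subgroup N.

Let NM x y : N x -> N y -> N (gmul x y). Proof. by have [_ h _ _] := nN; exact: h. Qed.
Let NV x : N x -> N (ginv x). Proof. by have [_ _ h _] := nN; exact: h. Qed.
Let NJ g x : N x -> N (gmul (gmul g x) (ginv g)). Proof. by have [_ _ _ h] := nN; exact: h. Qed.

(* [k a r = k' a r' mod N] with [k, k', r, r' \in K] forces [k = k' mod N]. *)
Definition switching (a : G) : Prop := forall k k' r r', k \in K -> k' \in K -> r \in K -> r' \in K ->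
  N (gmul (ginv (gmul (gmul k a) r)) (gmul (gmul k' a) r')) -> N (gmul (ginv k) k').

(** Modulo [N], the sets [K a K] and [K b K] are disjoint. *)
Definition separated (a b : G) : Prop := forall k k' r r', k \in K -> k' \in K -> r \in K -> r' \in K ->
  ~ N (gmul (ginv (gmul (gmul k a) r)) (gmul (gmul k' b) r')).

Lemma separated_sym a b : separated a b -> separated b a.
Proof.
move=> h k k' r r' kK kK' rK rK' /NV; rewrite monoid.invgM monoid.invgK.
exact: h.
Qed.

Variable m : set G -> R.
Hypothesis mT : m [set: G] = 1.
Hypothesis m_ge0 : forall A, 0 <= m A.
Hypothesis mU : forall A B, A `&` B = set0 -> m (A `|` B) = m A + m B.
Hypothesis mI : forall g A, m [set gmul g x | x in A] = m A.
Hypothesis icc : quotient_ICC N.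
Hypothesis NT : N <> setT.

(** For fixed [k, k', r, r'] with [k^-1 k'] outside [N], a bad [a] conjugates [k^-1 k'] into the
    coset of [r r'^-1]: [null_conj], applied finitely many times. *)
Lemma null_not_switching : m [set a | ~ switching a] = 0.
Proof.
pose s := [seq (x, y) | x <- [seq (k, k') | k <- K, k' <- K], y <- [seq (r, r') | r <- K, r' <- K]].
have h : m [set a | exists2 i, i \in [seq i <- s | ~~ `[< N (gmul (ginv i.1.1) i.1.2) >]] &
   N (gmul (ginv (gmul i.2.1 (ginv i.2.2))) (gmul (gmul (ginv a) (gmul (ginv i.1.1) i.1.2)) a))] = 0.
  apply: (null_seq m_ge0 mU) => -[[k k'] [r r']]; rewrite mem_filter => /andP[/asboolPn/= nNk _].
  exact: (null_conj mT m_ge0 mU mI nN icc).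
apply: null_sub h => //= a; apply: contra_notP => nh k k' r r' kK kK' rK rK' Na.
apply: contrapT => nNk; apply: nh; exists ((k, k'), (r, r')).
  rewrite mem_filter; apply/andP; split; first exact/asboolPn.
  by apply/allpairsP; exists ((k, k'), (r, r')); split => //=; apply/allpairsP; [exists (k, k')|exists (r, r')].
have := NJ r' Na; rewrite /= !monoid.invgM !monoid.invgK !monoid.mulgA.
by rewrite monoid.mulgK.
Qed.

Lemma null_not_separated b : m [set a | ~ separated b a] = 0.
Proof.
pose s := [seq (x, y) | x <- [seq (k, k') | k <- K, k' <- K], y <- [seq (r, r') | r <- K, r' <- K]].
have h : m [set a | exists2 i, i \in s &
   N (gmul (ginv (gmul (gmul (gmul (ginv i.1.2) i.1.1) b) (gmul i.2.1 (ginv i.2.2)))) a)] = 0.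
  apply: (null_seq m_ge0 mU) => i _.
  exact: (null_coset mT m_ge0 mU mI nN icc).
apply: null_sub h => //= a; apply: contra_notP => nh k k' r r' kK kK' rK rK' Na.
apply: nh; exists ((k, k'), (r, r')).
  by apply/allpairsP; exists ((k, k'), (r, r')); split => //=; apply/allpairsP; [exists (k, k')|exists (r, r')].
have := NJ r' Na; rewrite /= !monoid.invgM !monoid.invgK !monoid.mulgA.
by rewrite monoid.mulgK.
Qed.

(** Greedy choice: each new label avoids finitely many null sets. The list [O] collects elements
    fixed in advance from which all labels must also be separated. *)
Lemma fresh_assignment (H : Type) (O : seq G) (L : seq (R * H)) :
  exists A : seq (R * (H * G)), [/\ [seq (p.1, p.2.1) | p <- A] = L,
    forall p, List.In p A -> switching p.2.2 /\ forall o, o \in O -> separated o p.2.2 &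
    forall p q, List.In p A -> List.In q A -> p = q \/ separated p.2.2 q.2.2].
Proof.
elim: L => [|[w a] L [A [AL hA pA]]]; first by exists [::].
pose s := O ++ [seq p.2.2 | p <- A].
have n1 : m [set y | exists2 o, o \in s & ~ separated o y] = 0.
  by apply: (null_seq m_ge0 mU) => o _; exact: null_not_separated.
have [z [hz1 hz2]] : exists z, switching z /\ forall o, o \in s -> separated o z.
  apply: (not_null_ex mT m_ge0 mU _ (nullU m_ge0 mU null_not_switching n1)).
  apply/seteqP; split=> // y _.
  have [h1|h1] := pselect (switching y); last by left; left.
  have [h2|h2] := pselect (forall o, o \in s -> separated o y); first by right.
  by left; right; apply: contrapT => /forall2NP h; apply: h2 => o os; have [//|/contrapT] := h o.
have hzA p : List.In p A -> separated p.2.2 z.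
  move=> pIn; apply: hz2; rewrite mem_cat; apply/orP; right.
  elim: A pIn {AL hA pA s n1} => //= q A IH [->|/IH h]; rewrite in_cons ?eqxx ?h ?orbT//.
exists ((w, (a, z)) :: A); split => /=.
- by rewrite AL.
- move=> p [<-|/hA//]; split => // o oO; apply: hz2; by rewrite mem_cat oO.
- move=> p q [<-|hp] [<-|hq]; first by left.
  + by right; apply/separated_sym/hzA.
  + by right; exact: hzA.
  + exact: pA.
Qed.

End Fresh.

Definition modset (G1 G2 : groupType) (N1 : set G1) (N2 : set G2) : set (prodG G1 G2) :=
  [set x | N1 x.1 /\ N2 x.2].

Section Level.
Variables (G1 G2 : groupType) (N1 : set G1) (N2 : set G2).
Hypotheses (cG1 : countable_group G1) (cG2 : countable_group G2).
Hypotheses (aG1 : amenable G1) (aG2 : amenable G2).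
Hypotheses (nN1 : normal_subgroup N1) (nN2 : normal_subgroup N2).
Hypotheses (icc1 : quotient_ICC N1) (icc2 : quotient_ICC N2).
Hypotheses (NT1 : N1 <> setT) (NT2 : N2 <> setT).

Local Notation Gam := (prodG G1 G2).
Local Notation NN := (modset N1 N2).

Lemma exists_enum (G : groupType) : countable_group G -> exists e : nat -> G, forall x, exists n, e n = x.
Proof.
move=> [f finj]; exists (fun n => xget gone [set x | f x = n]) => x; exists (f x).
by case: xgetP => [y _ /finj//|/(_ x)/(_ erefl)].
Qed.

Lemma In_map_fst (H I : Type) (A : seq (R * (H * I))) (L : seq (R * H)) p :
  [seq (p.1, p.2.1) | p <- A] = L -> List.In p A -> List.In (p.1, p.2.1) L.
Proof. move=> <- pA; exact: (List.in_map (fun p => (p.1, p.2.1)) A p pA). Qed.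

Lemma wprob_map (H I : Type) (A : seq (R * H)) (g : H -> I) :
  wprob [seq (p.1, g p.2) | p <- A] -> wprob A.
Proof.
move=> [h1 h2]; split; last by move: h2; rewrite wsum_map.
move=> p pA; have := h1 (p.1, g p.2); apply.
exact: (List.in_map (fun p : R * H => (p.1, g p.2)) A p pA).
Qed.

(** The second conclusion is the decoding: the labels are separated, so they identify the atom used,
    and then the atom being switching in both factors gives back [k]. The third says that inserting
    an atom leaves [K] modulo [N1] and [N2]. The last two are the forgetting: on each factor one
    half is almost invariant and the other costs at most [D / 2]. *)
Lemma switching_level (K : seq Gam) (ep : R) : gone \in K -> 0 < ep ->
  exists A : seq (R * Gam),
  [/\ wprob A,
      forall k k' r r' p p', k \in K -> k' \in K -> r \in K -> r' \in K ->
        List.In p A -> List.In p' A ->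
        NN (gmul (ginv (gmul (gmul k p.2) r)) (gmul (gmul k' p'.2) r')) ->
        NN (gmul (ginv k) k'),
      forall k k' r p, k \in K -> k' \in K -> r \in K -> List.In p A ->
        ~ NN (gmul (ginv (gmul (gmul k p.2) r)) k'),
      forall (f : G1 -> R) D k k', k \in K -> k' \in K -> (forall x, `|f x| <= 1) ->
        (forall x y, f x - f y <= D) ->
        wsum A (fun a => f (gmul k a).1) - wsum A (fun a => f (gmul k' a).1) <= ep + D / 2 &
      forall (f : G2 -> R) D k k', k \in K -> k' \in K -> (forall x, `|f x| <= 1) ->
        (forall x y, f x - f y <= D) ->
        wsum A (fun a => f (gmul k a).2) - wsum A (fun a => f (gmul k' a).2) <= ep + D / 2].
Proof.
move=> K1 ep0.
have [e1 he1] := exists_enum cG1; have [e2 he2] := exists_enum cG2.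
have [m1 [mT1 m01 mU1 mI1]] := aG1; have [m2 [mT2 m02 mU2 mI2]] := aG2.
pose Ka := [seq x.1 | x <- K]; pose Kb := [seq x.2 | x <- K].
have Kaf k : k \in K -> k.1 \in Ka by exact: map_f.
have Kbf k : k \in K -> k.2 \in Kb by exact: map_f.
have bad1 := null_not_switching Ka nN1 mT1 m01 mU1 mI1 icc1.
have bad2 := null_not_switching Kb nN2 mT2 m02 mU2 mI2 icc2.
have [L1 [pL1 gL1 iL1]] := reiter mT1 m01 mU1 mI1 bad1 he1 Ka ep0.
have [L2 [pL2 gL2 iL2]] := reiter mT2 m02 mU2 mI2 bad2 he2 Kb ep0.
(* [gone] among the elements to avoid keeps [K a K] away from [K]; the atoms of [L2] keep the two
   halves apart in the second factor, so [A2] only has to avoid [gone]. *)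
have [A1 [eA1 hA1 sA1]] := fresh_assignment Kb nN2 mT2 m02 mU2 mI2 icc2 NT2 (gone :: [seq p.2 | p <- L2]) L1.
have [A2 [eA2 hA2 sA2]] := fresh_assignment Ka nN1 mT1 m01 mU1 mI1 icc1 NT1 [:: gone] L2.
pose mk1 (p : R * (G1 * G2)) : R * Gam := (2^-1 * p.1, (p.2.1, p.2.2)).
pose mk2 (p : R * (G2 * G1)) : R * Gam := (2^-1 * p.1, (p.2.2, p.2.1)).
pose A := map mk1 A1 ++ map mk2 A2.
have wA f : wsum A f = 2^-1 * wsum A1 (fun q => f (q.1, q.2)) + 2^-1 * wsum A2 (fun q => f (q.2, q.1)).
  rewrite /A wsum_cat /wsum !big_map !mulr_sumr; congr (_ + _);
  by apply: eq_bigr => p _; rewrite mulrA.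
have pA1 : wprob A1 by apply: (@wprob_map _ _ _ fst); rewrite eA1.
have pA2 : wprob A2 by apply: (@wprob_map _ _ _ fst); rewrite eA2.
have inA p : List.In p A -> (exists2 q, List.In q A1 & p = mk1 q) \/ (exists2 q, List.In q A2 & p = mk2 q).
  rewrite /A => /List.in_app_iff[] /List.in_map_iff[q [<- qA]]; [left|right]; by exists q.
have sw1 q : List.In q A1 -> switching N1 Ka q.2.1.
  by move=> /(In_map_fst eA1)/gL1 /contrapT.
have sw2 q : List.In q A2 -> switching N2 Kb q.2.1.
  by move=> /(In_map_fst eA2)/gL2 /contrapT.
have inL2 q : List.In q A2 -> q.2.1 \in gone :: [seq p.2 | p <- L2].
  move=> /(In_map_fst eA2) h; rewrite in_cons; apply/orP; right.
  elim: L2 h {pL2 gL2 iL2 eA2 hA1 pA2} => //= r L2 IH [->|/IH h]; rewrite in_cons ?eqxx ?h ?orbT//.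
have cross p q k k' r r' : List.In p A1 -> List.In q A2 -> k \in K -> k' \in K -> r \in K -> r' \in K ->
    ~ N2 (gmul (ginv (gmul (gmul k.2 p.2.2) r.2)) (gmul (gmul k'.2 q.2.1) r'.2)).
  move=> pA qA kK kK' rK rK'; have [_ h] := hA1 _ pA.
  by apply: (separated_sym nN2 (h _ (inL2 _ qA))); exact: Kbf.
exists A; split.
- split.
    move=> p /inA[[q qA ->]|[q qA ->]]; rewrite mulr_ge0 ?invr_ge0//.
      by have [h _] := pA1; exact: h.
    by have [h _] := pA2; exact: h.
  by rewrite wA !(wsum_cst 1)//; lra.
- move=> k k' r r' p p' kK kK' rK rK' /inA[[q qA ->]|[q qA ->]] /inA[[q' qA' ->]|[q' qA' ->]] [/= h1 h2].
  + have [e|se] := sA1 _ _ qA qA'; last first.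
      by case: (se k.2 k'.2 r.2 r'.2); rewrite ?Kbf.
    rewrite -e in h1 h2; split.
      by apply: (sw1 _ qA k.1 k'.1 r.1 r'.1); rewrite ?Kaf.
    by apply: ((hA1 _ qA).1 k.2 k'.2 r.2 r'.2); rewrite ?Kbf.
  + by case: (cross _ _ _ _ _ _ qA qA' kK kK' rK rK').
  + case: (cross _ _ _ _ _ _ qA' qA kK' kK rK' rK).
    have [_ _ NV _] := nN2; have := NV _ h2.
    by rewrite monoid.invgM monoid.invgK.
  + have [e|se] := sA2 _ _ qA qA'; last first.
      by case: (se k.1 k'.1 r.1 r'.1); rewrite ?Kaf.
    rewrite -e in h1 h2; split.
      by apply: ((hA2 _ qA).1 k.1 k'.1 r.1 r'.1); rewrite ?Kaf.
    by apply: (sw2 _ qA k.2 k'.2 r.2 r'.2); rewrite ?Kbf.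
- move=> k k' r p kK kK' rK /inA[[q qA ->]|[q qA ->]] [/= h1 h2].
  + have [_ /(_ gone (mem_head _ _)) h] := hA1 _ qA.
    apply: (separated_sym nN2 h (k := k.2) (k' := k'.2) (r := r.2) (r' := gone)); rewrite ?Kbf//.
      exact: (Kbf _ K1).
    by rewrite !monoid.mulg1.
  + have [_ /(_ gone (mem_head _ _)) h] := hA2 _ qA.
    apply: (separated_sym nN1 h (k := k.1) (k' := k'.1) (r := r.1) (r' := gone)); rewrite ?Kaf//.
      exact: (Kaf _ K1).
    by rewrite !monoid.mulg1.
- move=> f D k k' kK kK' f1 fD; rewrite !wA /=.
  have e x : wsum A1 (fun q => f (gmul x q.1)) = wsum L1 (fun a => f (gmul x a)).
    by rewrite -eA1 (wsum_map A1 fst).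
  (* Comparing [k] and [k'] with the untranslated mean costs [2 * ep], which the weight 1/2 reduces
     to [ep]. *)
  have h1 := iL1 _ _ (Kaf _ kK) f1; have h2 := iL1 _ _ (Kaf _ kK') f1.
  have h3 : wsum A2 (fun q => f (gmul k.1 q.2)) - wsum A2 (fun q => f (gmul k'.1 q.2)) <= D.
    rewrite -wsumB -[leRHS](wsum_cst D pA2); apply: wsum_le; first by have [] := pA2.
    by move=> p _; exact: fD.
  rewrite !e; move: h1 h2; rewrite !ler_norml => /andP[h1 h1'] /andP[h2 h2'].
  by move: h1' h2 h3; lra.
- move=> f D k k' kK kK' f1 fD; rewrite !wA /=.
  have e x : wsum A2 (fun q => f (gmul x q.1)) = wsum L2 (fun a => f (gmul x a)).
    by rewrite -eA2 (wsum_map A2 fst).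
  have h1 := iL2 _ _ (Kbf _ kK) f1; have h2 := iL2 _ _ (Kbf _ kK') f1.
  have h3 : wsum A1 (fun q => f (gmul k.2 q.2)) - wsum A1 (fun q => f (gmul k'.2 q.2)) <= D.
    rewrite -wsumB -[leRHS](wsum_cst D pA1); apply: wsum_le; first by have [] := pA1.
    by move=> p _; exact: fD.
  rewrite !e; move: h1 h2; rewrite !ler_norml => /andP[h1 h1'] /andP[h2 h2'].
  by move: h1' h2 h3; lra.
Qed.

End Level.

(** * Levels *)

(* [rlev m] is the probability that the first step of level at least [m] has level [m]. The
   constant 24 makes [4 * sum rlev^2] at most [1/6]. *)
Definition qlev (m : nat) : R := 24 / (m + 24)%:R.
Definition rlev (m : nat) : R := (m + 25)%:R^-1.
(** The mass of level [m]; thus [qlev m] is the total mass of the levels from [m] on. *)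
Definition plev (m : nat) : R := qlev m * rlev m.

Lemma qlev_gt0 m : 0 < qlev m. Proof. by rewrite /qlev divr_gt0// ltr0n addn_gt0 orbT. Qed.
Lemma rlev_gt0 m : 0 < rlev m. Proof. by rewrite /rlev invr_gt0 ltr0n addn_gt0 orbT. Qed.
Lemma plev_gt0 m : 0 < plev m. Proof. by rewrite mulr_gt0 ?qlev_gt0 ?rlev_gt0. Qed.

Lemma qlev0 : qlev 0 = 1. Proof. by rewrite /qlev add0n mulfV. Qed.

Lemma rlev_lt1 m : rlev m < 1.
Proof. by rewrite /rlev invf_lt1 ?ltr0n ?addn_gt0 ?orbT// ltr1n addnS ltnS addn_gt0 orbT. Qed.

Lemma qlevS m : qlev m.+1 = qlev m * (1 - rlev m).
Proof.
rewrite /qlev /rlev -addn1 !natrD; have := ler0n R m; set x := m%:R => x0.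
by field; apply/andP; split; apply/lt0r_neq0; lra.
Qed.

Lemma plevE m : plev m = qlev m - qlev m.+1.
Proof. by rewrite qlevS /plev; lra. Qed.

Lemma sum_plev n : \sum_(0 <= j < n) plev j = 1 - qlev n.
Proof.
elim: n => [|n IH]; first by rewrite big_geq// qlev0 subrr.
by rewrite big_nat_recr//= IH plevE; lra.
Qed.

Lemma qlev_le1 m : qlev m <= 1.
Proof. by rewrite /qlev ler_pdivrMr ?ltr0n ?addn_gt0 ?orbT// mul1r ler_nat leq_addl. Qed.

Lemma qlev_small (e : R) : 0 < e -> exists n, forall m, (n <= m)%N -> qlev m <= e.
Proof.
move=> e0; exists (Num.truncn (24 / e)) => m nm.
rewrite /qlev ler_pdivrMr ?ltr0n ?addn_gt0 ?orbT// mulrC -ler_pdivrMr//.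
apply: le_trans (ltW (truncnS_gt _)) _; rewrite ler_nat.
by apply: leq_trans (_ : m.+1 <= _)%N; rewrite ?ltnS// -addn1 leq_add2l.
Qed.

Lemma rlev_small (e : R) : 0 < e -> exists n, forall m, (n <= m)%N -> rlev m <= e.
Proof.
move=> e0; exists (Num.truncn (e^-1)) => m nm.
rewrite /rlev invf_ple ?posrE ?ltr0n ?addn_gt0 ?orbT//.
apply: le_trans (ltW (truncnS_gt _)) _; rewrite ler_nat.
by apply: leq_trans (_ : m.+1 <= _)%N; rewrite ?ltnS// -addn1 leq_add2l.
Qed.

(* [1/(m+25)^2 <= 1/(m+24) - 1/(m+25)], telescoped. *)
Lemma sum_rlev2 n : \sum_(0 <= j < n) rlev j ^+ 2 <= 24^-1.
Proof.
suff : \sum_(0 <= j < n) rlev j ^+ 2 <= 24^-1 - (n + 24)%:R^-1.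
  by move=> h; apply: le_trans h _; rewrite gerBl invr_ge0.
elim: n => [|n IH]; first by rewrite big_geq// add0n subrr.
rewrite big_nat_recr//=; apply: le_trans (lerD IH (lexx _)) _.
rewrite /rlev addSnnS !natrD; have := ler0n R n; set x := n%:R => x0.
rewrite -subr_ge0.
have -> : 24^-1 - (x + 25)^-1 - (24^-1 - (x + 24)^-1 + (x + 25)^-1 ^+ 2) =
   (x + 25)^-1 ^+ 2 * (x + 24)^-1.
  by field; apply/andP; split; apply/lt0r_neq0; lra.
by rewrite mulr_ge0 ?sqr_ge0// invr_ge0; lra.
Qed.

(** Bernoulli's inequality in the form [x^n (1 + n (1 - x)) <= 1]. *)
Lemma expr_small (x e : R) : 0 <= x < 1 -> 0 < e -> exists n, x ^+ n <= e.
Proof.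
move=> /andP[x0 x1] e0.
have h : 1 - x > 0 by lra.
have bern n : x ^+ n * (1 + n%:R * (1 - x)) <= 1.
  elim: n => [|n IH]; first by rewrite expr0; lra.
  apply: le_trans IH; rewrite exprS -natr1 -subr_ge0.
  have -> : x ^+ n * (1 + n%:R * (1 - x)) - x * x ^+ n * (1 + (n%:R + 1) * (1 - x)) =
    x ^+ n * (n%:R + 1) * (1 - x) ^+ 2 by ring.
  by apply: mulr_ge0 (sqr_ge0 _); apply: mulr_ge0; [exact: exprn_ge0|rewrite natr1 ler0n].
exists (Num.truncn ((e * (1 - x))^-1)).+1; set n := _.+1.
have hn : (e * (1 - x))^-1 < n%:R by exact: truncnS_gt.
have h2 : 1 < n%:R * (1 - x) * e.
  by rewrite -mulrA [_ * e]mulrC -ltr_pdivrMr ?mulr_gt0// mul1r.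
have := bern n; have := exprn_ge0 n x0; set y := x ^+ n => y0 hy.
rewrite leNgt; apply/negP => ey.
have : 1 < y * (1 + n%:R * (1 - x)); last by move: hy; lra.
apply: lt_trans h2 _; have := ltr0n R n.+1 => _.
have a0 : 0 <= n%:R * (1 - x) by rewrite mulr_ge0// ltW.
by nra.
Qed.

Lemma tlev_spec m : exists n, (1 - qlev m) ^+ n <= rlev m.
Proof.
apply: expr_small; last exact: rlev_gt0.
by have := qlev_le1 m; have := qlev_gt0 m => *; apply/andP; split; lra.
Qed.

(** A time within which a step of level at least [m] has occurred, except with probability [rlev m].
    It makes the set of positions to be taken into account at level [m] finite. *)
Definition tlev m : nat := sval (cid (tlev_spec m)).

Lemma tlevP m : (1 - qlev m) ^+ tlev m <= rlev m.
Proof. exact: svalP (cid (tlev_spec m)). Qed.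

Section Tower.
Variables (G : groupType) (ex : nat -> G) (g0 : G).
Variable Q : seq G -> R -> seq (R * G) -> Prop.
Hypothesis lev : forall K ep, gone \in K -> 0 < ep -> exists A, Q K ep A.

(** [gone] and [g0] are the two starting points that the product must distinguish; the enumeration
    brings in every other point eventually, for the contraction of the marginals. *)
Definition base m : seq G := gone :: g0 :: [seq ex i | i <- iota 0 m].

Fixpoint words (S : seq G) n : seq (seq G) :=
  if n is n'.+1 then [seq x :: w | x <- S, w <- words S n'] else [:: [::]].

Lemma mem_words S w : all (mem S) w -> w \in words S (size w).
Proof.
elim: w => [|x w IH] //= /andP[xS /IH h].
by apply/allpairsP; exists (x, w).
Qed.

Definition products m (S : seq G) : seq G :=
  [seq gmul y (gprod w) | y <- base m, w <- flatten [seq words S n | n <- iota 0 (tlev m).+1]].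

Lemma mem_products m S y w : y \in base m -> all (mem S) w -> (size w <= tlev m)%N ->
  gmul y (gprod w) \in products m S.
Proof.
move=> yB wS sw; apply/allpairsP; exists (y, w); split => //.
apply/flatten_mapP; exists (size w); last exact: mem_words.
by rewrite mem_iota/= add0n ltnS.
Qed.

(** [A_ m] is chosen after [K_ m], which contains every position reached from [base m] in at most
    [tlev m] steps of levels below [m]. Then [S_ m.+1] receives the new atoms and [ex m], and
    [K_ m.+1] the new positions and all insertions [k a r]. *)
Lemma tower : exists (A_ : nat -> seq (R * G)) (K_ S_ : nat -> seq G),
  [/\ forall m, Q (K_ m) (m.+1%:R^-1) (A_ m),
      forall m k, k \in K_ m -> k \in K_ m.+1,
      forall m k r p, k \in K_ m -> r \in K_ m -> List.In p (A_ m) ->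
        gmul (gmul k p.2) r \in K_ m.+1,
      forall m y w, y \in base m -> all (mem (S_ m)) w -> (size w <= tlev m)%N ->
        gmul y (gprod w) \in K_ m &
      forall m j p, (j < m)%N -> List.In p (A_ j) \/ p.2 = ex j -> p.2 \in S_ m].
Proof.
(* The condition [gone \in x.1] is moved inside, with a dummy [[::]] when it fails, so that [choice]
   gives a total function for the recursion. *)
have hlev (x : seq G * nat) : exists A, gone \in x.1 -> Q x.1 (x.2.+1%:R^-1) A.
  case: x => K m /=; have [gK|ngK] := boolP (gone \in K); last by exists [::].
  by have [|A hA] := lev (ep := m.+1%:R^-1) gK; [rewrite invr_gt0|exists A].
have [c hc] := choice hlev.
pose nextS m S A : seq G := ex m :: S ++ [seq p.2 | p : R * G <- A].
pose nextK m K S (A : seq (R * G)) : seq G :=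
  K ++ [seq gmul x r | x <- [seq gmul k a | k <- K, a <- [seq p.2 | p <- A]], r <- K]
    ++ products m.+1 (nextS m S A).
pose st := fix st (m : nat) : seq G * seq G :=
  if m is m'.+1 then
    (nextS m' (st m').1 (c ((st m').2, m')), nextK m' (st m').2 (st m').1 (c ((st m').2, m')))
  else ([::], products 0 [::]).
pose K_ m := (st m).2; pose S_ m := (st m).1; pose A_ m := c (K_ m, m).
have KS m : K_ m.+1 = nextK m (K_ m) (S_ m) (A_ m) by [].
have SS m : S_ m.+1 = nextS m (S_ m) (A_ m) by [].
have Kprod m x : x \in products m (S_ m) -> x \in K_ m.
  case: m => [//|m]; rewrite KS SS /nextK !mem_cat => h.
  by apply/orP; right; apply/orP; right.
have Kone m : gone \in K_ m.
  apply: Kprod; have := @mem_products m (S_ m) gone [::] (mem_head _ _) isT (leq0n _).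
  by rewrite monoid.mulg1.
exists A_, K_, S_; split.
- by move=> m; exact: hc (K_ m, m) (Kone m).
- by move=> m k kK; rewrite KS /nextK mem_cat kK.
- move=> m k r p kK rK pA; rewrite KS /nextK !mem_cat; apply/orP; right; apply/orP; left.
  apply/allpairsP; exists (gmul k p.2, r); split => //=.
  apply/allpairsP; exists (k, p.2); split => //=.
  elim: (A_ m) pA => //= q A IH [->|/IH h]; rewrite in_cons ?eqxx ?h ?orbT//.
- by move=> m y w yB wS sw; apply: Kprod; exact: mem_products.
- elim=> // m IH j p; rewrite ltnS leq_eqVlt => /predU1P[->|jm] h.
    rewrite SS in_cons mem_cat; case: h => [h|->]; last by rewrite eqxx.
    apply/orP; right; apply/orP; right.
    elim: (A_ m) h => //= q A IHA [->|/IHA h]; rewrite in_cons ?eqxx ?h ?orbT//.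
  have hS := IH _ _ jm h.
  by rewrite SS in_cons mem_cat hS orbT.
Qed.

End Tower.

(** * The mixture of the level measures *)

Section Mixture.
Variables (G : groupType) (theta : nat -> seq (R * G)).
Hypothesis ptheta : forall j, wprob (theta j).

Definition partmix n (f : G -> R) : R := \sum_(0 <= j < n) plev j * wsum (theta j) f.

(** The partial mixtures increase with [n], so [LIM] is here their ordinary limit; writing it so
    makes finite additivity immediate. *)
Definition mixture (g : G) : R := LIM (fun n => partmix n (\1_[set g])).

Lemma partmix_le n f g : (forall j p, (j < n)%N -> List.In p (theta j) -> f p.2 <= g p.2) ->
  partmix n f <= partmix n g.
Proof.
move=> h; rewrite /partmix big_nat [leRHS]big_nat; apply: ler_sum => j /andP[_ jn].
apply: ler_wpM2l; first exact/ltW/plev_gt0.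
by apply: wsum_le => [|p pj]; [have [] := ptheta j|exact: h pj].
Qed.

Lemma partmixD n f g : partmix n (fun x => f x + g x) = partmix n f + partmix n g.
Proof. by rewrite /partmix -big_split; apply: eq_bigr => j _; rewrite wsumD mulrDr. Qed.

Lemma partmixZ n c f : partmix n (fun x => c * f x) = c * partmix n f.
Proof. by rewrite /partmix mulr_sumr; apply: eq_bigr => j _; rewrite wsumZ mulrCA. Qed.

Lemma partmixB n f g : partmix n (fun x => f x - g x) = partmix n f - partmix n g.
Proof. by rewrite /partmix -sumrB; apply: eq_bigr => j _; rewrite wsumB mulrBr. Qed.

Lemma partmix_cst n c : partmix n (fun=> c) = (1 - qlev n) * c.
Proof.
rewrite /partmix -sum_plev mulr_suml; apply: eq_bigr => j _; congr (_ * _).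
exact: wsum_cst.
Qed.

Lemma partmix_sum (I : Type) (s : seq I) n (f : I -> G -> R) :
  partmix n (fun x => \sum_(i <- s) f i x) = \sum_(i <- s) partmix n (f i).
Proof.
rewrite /partmix exchange_big; apply: eq_bigr => j _ /=.
by rewrite wsum_sum mulr_sumr.
Qed.

Lemma partmix_LIM n (f : nat -> G -> R) : (forall x, bnd (f^~ x)) ->
  partmix n (fun x => LIM (f^~ x)) = LIM (fun k => partmix n (f k)).
Proof.
move=> bf; have bw j : bnd (fun k => wsum (theta j) (f k)).
  rewrite /wsum; elim: (theta j) => [|p L [M IH]]; first by exists 0 => k; rewrite big_nil normr0.
  have [M' hM'] := bf p.2; exists (`|p.1| * M' + M) => k; rewrite big_cons.
  by apply: le_trans (ler_normD _ _) _; apply: lerD => //; rewrite normrM; apply: ler_wpM2l.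
rewrite /partmix LIM_sum => [|j]; last by apply: bndM => //; exact: bnd_cst.
apply: eq_bigr => j _; rewrite LIMZ//; congr (_ * _).
rewrite /wsum LIM_sum => [|p]; last by apply: bndM => //; exact: bnd_cst.
by apply: eq_bigr => p _; rewrite LIMZ.
Qed.

Lemma partmix_unit n f : (forall x, 0 <= f x <= 1) -> 0 <= partmix n f <= 1 - qlev n.
Proof.
move=> h; apply/andP; split.
  rewrite -[leLHS](_ : partmix n (fun=> 0) = _); last by rewrite partmix_cst mulr0.
  by apply: partmix_le => j p _ _; have /andP[] := h p.2.
rewrite -[leRHS]mulr1 -partmix_cst.
by apply: partmix_le => j p _ _; have /andP[] := h p.2.
Qed.

Lemma partmix_mono n k f : (n <= k)%N -> (forall x, 0 <= f x) -> partmix n f <= partmix k f.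
Proof.
move=> nk f0; rewrite /partmix (big_cat_nat (n := n) (p := k))//= lerDl.
apply: sumr_ge0 => j _; rewrite mulr_ge0 ?(ltW (plev_gt0 j))//.
rewrite -(wsum_cst 0 (ptheta j)); apply: wsum_le; first by have [] := ptheta j.
by [].
Qed.

Let ind_unit (g x : G) : 0 <= (\1_[set g] x : R) <= 1.
Proof. by rewrite indicE ler0n lern1 leq_b1. Qed.

Let part_unit1 n f : (forall x, 0 <= f x <= 1) -> 0 <= partmix n f <= 1.
Proof.
move=> /(partmix_unit n)/andP[-> h]; apply: le_trans h _.
by rewrite gerBl ltW// qlev_gt0.
Qed.

Let bnd_part g : bnd (fun n => partmix n (\1_[set g])).
Proof. by apply: bnd_unit => n; apply: part_unit1. Qed.

Let mixture_ge0 g : 0 <= mixture g.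
Proof.
have [] := andP (@LIM_itv (fun n => partmix n (\1_[set g])) 0 1 _) => // n.
exact: part_unit1.
Qed.

Lemma mixture_ge n g : partmix n (\1_[set g]) <= mixture g.
Proof.
rewrite -[leLHS]LIM_cst; apply: (LIM_le (N := n)) => //; first exact: bnd_cst.
move=> k nk; apply: partmix_mono => // x; by have /andP[] := ind_unit g x.
Qed.

Let ind_sum (F : seq G) (f : G -> R) a : uniq F -> a \in F ->
  \sum_(y <- F) f y * \1_[set y] a = f a.
Proof.
move=> uF aF; rewrite (bigD1_seq a)//= indicE mem_set// mulr1 big1 ?addr0// => y ya.
by rewrite indicE memNset ?mulr0//= => e; rewrite e eqxx in ya.
Qed.

Let ind_sum_le (F : seq G) a : uniq F -> \sum_(y <- F) (\1_[set y] a : R) <= 1.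
Proof.
move=> uF; have [aF|aF] := boolP (a \in F).
  rewrite -[leRHS](ind_sum (fun=> 1) uF aF); apply: ler_sum => y _; by rewrite mul1r.
rewrite big_seq big1 ?ler01// => y yF; rewrite indicE memNset//= => e.
by rewrite e yF in aF.
Qed.

Lemma mixture_finite n : exists2 F : seq G, uniq F & forall f, (forall x, 0 <= f x) ->
  partmix n f <= \sum_(y <- F) mixture y * f y.
Proof.
pose F0 := flatten [seq [seq p.2 | p <- theta j] | j <- iota 0 n].
exists (undup F0) => [|f f0]; first exact: undup_uniq.
apply: (@le_trans _ _ (\sum_(y <- undup F0) partmix n (\1_[set y]) * f y)); last first.
  by apply: ler_sum => y _; apply: ler_wpM2r => //; exact: mixture_ge.
under eq_bigr do rewrite mulrC -partmixZ.
rewrite -partmix_sum; apply: partmix_le => j p jn pj.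
rewrite ind_sum ?undup_uniq// mem_undup; apply/flatten_mapP; exists j; first by rewrite mem_iota.
elim: (theta j) pj => //= q L IH [->|/IH h]; rewrite in_cons ?eqxx ?h ?orbT//.
Qed.

Lemma mixture_prob : prob_mass mixture.
Proof.
split => //; apply/eqP; rewrite eq_le; apply/andP; split.
  apply: ge_ereal_sup => _ [A [finA _] <-].
  rewrite fsbig_finite//= sumEFin lee_fin.
  set F := finmap.enum_fset _; have uF : uniq F by exact: finmap.fset_uniq.
  rewrite /mixture -LIM_sum// -[leRHS](LIM_cst 1).
  have hle n : 0 <= \sum_(i <- F) partmix n (\1_[set i]) <= 1.
    rewrite -partmix_sum; apply: part_unit1 => x; rewrite ind_sum_le// andbT.
    by apply: sumr_ge0 => y _; have /andP[] := ind_unit y x.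
  apply: (LIM_le (N := 0%N)); [exact: bnd_unit hle|exact: bnd_cst|].
  by move=> n _; have /andP[] := hle n.
apply/lee_addgt0Pr => e e0.
have [n hn] := qlev_small e0.
have [F uF hF] := mixture_finite n.
apply: (@le_trans _ _ ((\sum_(y <- F) mixture y)%:E + e%:E)%E).
  rewrite -EFinD lee_fin; have := hF (fun=> 1) (fun=> ler01); rewrite partmix_cst.
  under eq_bigr do rewrite mulr1.
  by have := hn n (leqnn n); lra.
rewrite leeD2r//; apply: ereal_sup_ubound; exists [set` F].
  by split => //; exact: finite_seq.
by rewrite -sumEFin -fsbig_seq.
Qed.

(** The lower bound is domination of the partial mixture; the upper bound is the lower one for
    [1 - f], the missing mass being [qlev n]. *)
Lemma mixture_approx n f : (forall x, 0 <= f x <= 1) ->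
  partmix n f <= Ex mixture f <= partmix n f + qlev n.
Proof.
have [nu0 nu1] := mixture_prob.
have lower g : (forall x, 0 <= g x <= 1) -> partmix n g <= Ex mixture g.
  move=> g01; have g0 x : 0 <= g x by have /andP[] := g01 x.
  have bg := bnd_unit g01.
  have [F uF hF] := mixture_finite n; apply: le_trans (hF g g0) _.
  rewrite -(Ex_sum_seq mixture_prob)//; apply: Ex_le => //.
    by apply: bndM => //; exact: bnd_ind.
  by move=> x; rewrite ler_piMr// indicE lern1 leq_b1.
move=> f01; rewrite lower//=.
have b := bnd_unit f01; have b1 := bnd_cst G 1.
have := lower (fun x => 1 - f x).
rewrite partmixB partmix_cst mulr1 (ExB nu0 nu1 b1 b) Ex_cst//.
move=> h; have h2 : 1 - qlev n - partmix n f <= 1 - Ex mixture f.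
  by apply: h => x; have /andP[h3 h4] := f01 x; apply/andP; split; lra.
by move: h2; lra.
Qed.

End Mixture.

(** * The position before the first high step *)

Section HittingOperator.
Variables (G : groupType) (theta : nat -> seq (R * G)).
Hypothesis ptheta : forall j, wprob (theta j).
Local Notation pmix := (partmix theta).

(** The part of one step that uses levels below [m]. Its mass is [1 - qlev m < 1], so the equations
    below are contractions. *)
Definition low m (f : G -> R) : G -> R := fun x => pmix m (fun a => f (gmul x a)).

Definition hitting_iter m (f : G -> R) n : G -> R :=
  iter n (fun v x => qlev m * f x + low m v x) (fun=> 0).

(* [hitting m f x] is the mean of [f (x Z)], [Z] being the position of the walk just before
   its first increment of level at least [m]. *)
Definition hitting m (f : G -> R) : G -> R := fun x => LIM (fun n => hitting_iter m f n x).

Let affine_unit m f v x : (forall x, 0 <= f x <= 1) -> (forall x, 0 <= v x <= 1) ->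
  0 <= qlev m * f x + low m v x <= 1.
Proof.
move=> f01 v01; have /andP[f0 f1] := f01 x.
have /andP[l0 l1] := partmix_unit ptheta m (fun a => v01 (gmul x a)).
have q0 := qlev_gt0 m; apply/andP; split; first by rewrite addr_ge0// mulr_ge0// ltW.
by rewrite /low; move: l1 f1 q0; nra.
Qed.

Let iter_unit m f n : (forall x, 0 <= f x <= 1) -> forall x, 0 <= hitting_iter m f n x <= 1.
Proof.
move=> f01; elim: n => [|n IH] x; first by rewrite /= lexx ler01.
exact: affine_unit.
Qed.

Lemma hitting_unit m f : (forall x, 0 <= f x <= 1) -> forall x, 0 <= hitting m f x <= 1.
Proof. by move=> f01 x; apply: LIM_itv => n; exact: iter_unit. Qed.

Let contract m (v : G -> R) n : (forall x, `|v x| <= 1) -> (forall x, v x = low m v x) ->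
  forall x, `|v x| <= (1 - qlev m) ^+ n.
Proof.
move=> v1 hv; elim: n => [|n IH] x; first by rewrite expr0.
rewrite hv exprS -(partmix_cst ptheta) ler_norml; apply/andP; split.
  rewrite partmix_cst// -mulrN -(partmix_cst ptheta); apply: partmix_le => // j p _ _.
  by have := IH (gmul x p.2); rewrite ler_norml => /andP[].
rewrite /low; apply: partmix_le => // j p _ _.
by have := IH (gmul x p.2); rewrite ler_norml => /andP[].
Qed.

Let q01 m : 0 <= 1 - qlev m < 1.
Proof. by have := qlev_le1 m; have := qlev_gt0 m => *; apply/andP; split; lra. Qed.

(** Successive iterates differ by at most [(1 - qlev m) ^+ n], so the limit satisfies the
    fixed-point equation. *)
Lemma hittingE m f : (forall x, 0 <= f x <= 1) ->
  forall x, hitting m f x = qlev m * f x + low m (hitting m f) x.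
Proof.
move=> f01 x.
have bi y : bnd (fun n => hitting_iter m f n y) by apply: bnd_unit => n; exact: iter_unit.
rewrite /low /hitting partmix_LIM//.
have bp : bnd (fun n => pmix m (fun a => hitting_iter m f n (gmul x a))).
  apply: (@bnd_itv _ _ 0 (1 - qlev m)) => n; apply: partmix_unit => // a; exact: iter_unit.
have -> : qlev m * f x + LIM (fun n => pmix m (fun a => hitting_iter m f n (gmul x a))) =
    LIM (fun n => qlev m * f x + pmix m (fun a => hitting_iter m f n (gmul x a))).
  by rewrite (LIMD (bnd_cst _ _) bp) LIM_cst.
apply/eqP; rewrite -subr_eq0 -LIMB//; last by apply: bndD => //; exact: bnd_cst.
apply/eqP; apply: LIM0; first by apply: bndB => //; apply: bndD => //; exact: bnd_cst.
have diff n y : `|hitting_iter m f n y - hitting_iter m f n.+1 y| <= (1 - qlev m) ^+ n.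
  elim: n y => [|n IH] y.
    have /andP[h0 h1] := iter_unit m 1 f01 y.
    by rewrite expr0 sub0r normrN ger0_norm.
  rewrite [X in _ - X]/= [X in X - _]/= -/(hitting_iter m f n.+1) -/(hitting_iter m f n).
  rewrite opprD addrACA subrr add0r /low -partmixB exprS -(partmix_cst ptheta) ler_norml.
  apply/andP; split.
    rewrite partmix_cst// -mulrN -(partmix_cst ptheta); apply: partmix_le => // j p _ _.
    by have := IH (gmul y p.2); rewrite ler_norml => /andP[].
  apply: partmix_le => // j p _ _.
  by have := IH (gmul y p.2); rewrite ler_norml => /andP[].
move=> e e0; have [N hN] := expr_small (q01 m) e0; exists N => n Nn.
apply: le_trans (diff n x) _; apply: le_trans hN.
by have /andP[h0 h1] := q01 m; apply: ler_wiXn2l => //; exact: ltW.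
Qed.

Lemma hitting_uniq m f v : (forall x, 0 <= f x <= 1) -> (forall x, 0 <= v x <= 1) ->
  (forall x, v x = qlev m * f x + low m v x) -> forall x, v x = hitting m f x.
Proof.
move=> f01 v01 hv x; apply/eqP; rewrite -subr_eq0 -normr_le0.
apply/ler_addgt0Pl => e e0; rewrite addr0.
have [N hN] := expr_small (q01 m) e0; apply: le_trans hN.
apply: (contract (v := fun x => v x - hitting m f x)) => y.
  have /andP[h1 h2] := v01 y; have /andP[h3 h4] := hitting_unit m f01 y.
  by rewrite ler_norml; apply/andP; split; lra.
by rewrite [in LHS]hv hittingE// opprD addrACA subrr add0r /low partmixB.
Qed.

(* The first step of level [m], if any, before the first one of level above [m]. *)
Lemma hittingS m f : (forall x, 0 <= f x <= 1) -> forall x,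
  hitting m.+1 f x = (1 - rlev m) * hitting m f x +
    rlev m * hitting m (fun y => wsum (theta m) (fun a => hitting m.+1 f (gmul y a))) x.
Proof.
move=> f01 x.
have r0 := rlev_gt0 m; have r1 := rlev_lt1 m.
pose F y := wsum (theta m) (fun a => hitting m.+1 f (gmul y a)).
have F01 y : 0 <= F y <= 1.
  have [w0 w1] := ptheta m.
  rewrite /F -{1}(wsum_cst 0 (ptheta m)) -[X in _ <= _ <= X](wsum_cst 1 (ptheta m)).
  by apply/andP; split; apply: wsum_le => // p _; have /andP[] := hitting_unit m.+1 f01 (gmul y p.2).
have g01 y : 0 <= (1 - rlev m) * f y + rlev m * F y <= 1.
  by have /andP[a0 a1] := f01 y; have /andP[b0 b1] := F01 y; apply/andP; split; nra.
(* A step of level at least [m] has level exactly [m] with probability [rlev m]. So [hitting m.+1 f]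
   solves the equation at [m] whose target stops with weight [1 - rlev m] and otherwise makes a step
   of level [m] and goes on. *)
have -> : hitting m.+1 f x = hitting m (fun y => (1 - rlev m) * f y + rlev m * F y) x.
  apply: hitting_uniq => // [|y]; first exact: hitting_unit.
  rewrite hittingE// /low /partmix big_nat_recr//= qlevS -/(F y) /plev; lra.
apply/esym; apply: (hitting_uniq (v := fun x => (1 - rlev m) * hitting m f x + rlev m * hitting m F x)) => // y.
  have /andP[a0 a1] := hitting_unit m f01 y; have /andP[b0 b1] := hitting_unit m F01 y.
  by apply/andP; split; nra.
rewrite [in LHS]hittingE// [X in _ + _ * X]hittingE// /low partmixD !partmixZ -/(low m _ _).
by rewrite -/F; lra.
Qed.

(** The inequality between [f] and [g] is assumed only at positions reached in at most [T] low
    steps; the last term is the probability that none of the first [T] steps is high. *)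
Lemma hitting_compare m f g c (S : seq G) T : (forall x, 0 <= f x <= 1) -> (forall x, 0 <= g x <= 1) ->
  0 <= c -> (forall j p, (j < m)%N -> List.In p (theta j) -> p.2 \in S) ->
  forall x, (forall w, all (mem S) w -> (size w <= T)%N -> f (gmul x (gprod w)) <= g (gmul x (gprod w)) + c) ->
  hitting m f x <= hitting m g x + c + (1 - qlev m) ^+ T.
Proof.
move=> f01 g01 c0 hS x hx.
suff key n w : all (mem S) w -> (size w + n = T)%N ->
    hitting m f (gmul x (gprod w)) <= hitting m g (gmul x (gprod w)) + c + (1 - qlev m) ^+ n.
  by have := key T [::] isT (add0n _); rewrite monoid.mulg1.
have /andP[p0 p1] := q01 m.
elim: n w => [|n IH] w wS wT.
  have /andP[a0 a1] := hitting_unit m f01 (gmul x (gprod w)).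
  have /andP[b0 b1] := hitting_unit m g01 (gmul x (gprod w)).
  by rewrite expr0; lra.
rewrite hittingE// [X in _ <= X + _ + _]hittingE//.
have h1 : f (gmul x (gprod w)) <= g (gmul x (gprod w)) + c by apply: hx => //; rewrite -wT leq_addr.
have h2 : low m (hitting m f) (gmul x (gprod w)) <=
    low m (hitting m g) (gmul x (gprod w)) + (1 - qlev m) * (c + (1 - qlev m) ^+ n).
  rewrite -(partmix_cst ptheta) -partmixD /low; apply: partmix_le => // j p jm pj.
  rewrite -monoid.mulgA -gprod_rcons addrA; apply: IH.
    by rewrite all_rcons wS andbT; exact: hS pj.
  by rewrite size_rcons addSn -addnS.
have := qlev_gt0 m; rewrite exprS; move: h1 h2.
set F := f _; set H := low _ _ _; set F' := g _; set H' := low _ _ _; set P := _ ^+ n; nra.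
Qed.

Lemma hitting_compl m f : (forall x, 0 <= f x <= 1) -> forall x,
  hitting m (fun y => 1 - f y) x = 1 - hitting m f x.
Proof.
move=> f01 x.
have f01' y : 0 <= 1 - f y <= 1 by have /andP[h1 h2] := f01 y; apply/andP; split; lra.
apply/esym; apply: (hitting_uniq (v := fun x => 1 - hitting m f x)) => // y.
  by have /andP[h1 h2] := hitting_unit m f01 y; apply/andP; split; lra.
by rewrite hittingE// /low partmixB partmix_cst//; lra.
Qed.

(* Along a Banach limit in [m], hitting means become harmonic because the jump has mass [qlev m]. *)
Lemma hitting_LIM_harmonic f : (forall x, 0 <= f x <= 1) ->
  harmonic (mixture theta) (fun x => LIM (fun m => hitting m f x)).
Proof.
move=> f01 x; have pm := mixture_prob ptheta.
have [nu0 nu1] := pm.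
have h01 m y : 0 <= hitting m f y <= 1 by exact: hitting_unit.
rewrite Ex_LIM//.
have bE : bnd (fun m => Ex (mixture theta) (fun y => hitting m f (gmul x y))).
  by apply: bnd_unit => m; apply: Ex_unit.
have bh : bnd (fun m => hitting m f x) by apply: bnd_unit.
apply/eqP; rewrite -subr_eq0 -LIMB//; apply/eqP/LIM0; first exact: bndB.
move=> e e0; have [N hN] := qlev_small e0; exists N => m /hN hm.
apply: le_trans hm.
have /andP[a1 a2] := mixture_approx ptheta m (fun y => h01 m (gmul x y)).
rewrite [X in `|_ - X|]hittingE//; have /andP[f0 f1] := f01 x; have q0 := qlev_gt0 m.
rewrite -/(low m (hitting m f) x) in a1 a2.
by rewrite ler_norml; apply/andP; split; nra.
Qed.

End HittingOperator.

(** * The switching walk *)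

Section SwitchingWalk.
Variables (G : groupType) (ex : nat -> G) (g0 : G).
Hypothesis exsurj : forall x, exists n, ex n = x.
Variables (A_ : nat -> seq (R * G)) (K_ S_ : nat -> seq G).
Hypothesis pA : forall m, wprob (A_ m).
Hypothesis Kmono : forall m k, k \in K_ m -> k \in K_ m.+1.
Hypothesis Kar : forall m k r p, k \in K_ m -> r \in K_ m -> List.In p (A_ m) ->
  gmul (gmul k p.2) r \in K_ m.+1.
Hypothesis Kw : forall m y w, y \in base ex g0 m -> all (mem (S_ m)) w -> (size w <= tlev m)%N ->
  gmul y (gprod w) \in K_ m.
Hypothesis SA : forall m j p, (j < m)%N -> List.In p (A_ j) \/ p.2 = ex j -> p.2 \in S_ m.

(** The atom [ex j] gives the mixture full support; its weight [rlev j] is of the order of the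
    errors already tolerated at level [j]. *)
Definition step_law j : seq (R * G) :=
  [seq ((1 - rlev j) * p.1, p.2) | p <- A_ j] ++ [:: (rlev j, ex j)].

Lemma step_lawE j f : wsum (step_law j) f = (1 - rlev j) * wsum (A_ j) f + rlev j * f (ex j).
Proof. by rewrite wsum_cat wsum_scale /wsum big_seq1. Qed.

Lemma step_law_prob j : wprob (step_law j).
Proof.
have [w0 w1] := pA j; have r0 := rlev_gt0 j; have r1 := rlev_lt1 j.
split; last by rewrite step_lawE w1; lra.
move=> p /List.in_app_iff[/List.in_map_iff[q [<- qA]]|[<-|[]]] /=.
  by rewrite mulr_ge0//; [lra|exact: w0].
exact: ltW.
Qed.

Lemma step_law_support m j p : (j < m)%N -> List.In p (step_law j) -> p.2 \in S_ m.
Proof.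
move=> jm /List.in_app_iff[/List.in_map_iff[q [<- qA]]|[<-|[]]] /=.
  by apply: (SA (p := q)) jm _; left.
by apply: (SA (p := (0, ex j))) jm _; right.
Qed.

Local Notation nu := (mixture step_law).

Let K_le m n k : (m <= n)%N -> k \in K_ m -> k \in K_ n.
Proof.
move=> /subnK <- kK; elim: (n - m)%N => [|i IH]; first by rewrite add0n.
by rewrite addSn; exact: Kmono.
Qed.

Lemma mixture_full_support g : 0 < nu g.
Proof.
have [m <-] := exsurj g.
apply: lt_le_trans (mixture_ge step_law_prob m.+1 (ex m)).
rewrite /partmix big_nat_recr//=.
have i0 j : 0 <= wsum (step_law j) (\1_[set ex m]).
  rewrite -(wsum_cst 0 (step_law_prob j)); apply: wsum_le; first by have [] := step_law_prob j.
  by move=> p _; rewrite indicE ler0n.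
rewrite ltr_wpDl//.
  by apply: sumr_ge0 => j _; rewrite mulr_ge0// ltW// plev_gt0.
rewrite mulr_gt0 ?plev_gt0// step_lawE indicE mem_set// mulr1 ltr_wpDl ?rlev_gt0//.
rewrite mulr_ge0//; first by have := rlev_lt1 m; lra.
rewrite -(wsum_cst 0 (pA m)); apply: wsum_le; first by have [] := pA m.
by move=> p _; rewrite indicE ler0n.
Qed.

Lemma mixture_non_degenerate : non_degenerate nu.
Proof.
move=> g; exists [:: g]; split => //; split; last by rewrite /= monoid.mulg1.
by move=> x; rewrite inE => /eqP ->; exact: mixture_full_support.
Qed.

(** * Contraction of the oscillation, for the marginals *)

Section Contraction.
Variable h : G -> R.
Hypothesis h01 : forall x, 0 <= h x <= 1.
Hypothesis hh : harmonic nu h.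

(** Two walks from [x] and [x'] use the same increments. Before the first step of level at least [m]
    both positions are in [K_ m], up to time [tlev m]; that step, of some level [j >= m], makes the
    two means of [h] agree up to [D / 2] and small errors, since [K_ m] is included in [K_ j]. *)
Let osc_half D : 0 <= D ->
  (forall j k k', k \in K_ j -> k' \in K_ j ->
     wsum (A_ j) (fun a => h (gmul k a)) - wsum (A_ j) (fun a => h (gmul k' a))
       <= j.+1%:R^-1 + D / 2) ->
  forall x x', h x - h x' <= D / 2.
Proof.
move=> D0 hD.
have h1 x x' : h x - h x' <= 1.
  by have /andP[a0 a1] := h01 x; have /andP[b0 b1] := h01 x'; lra.
(* The three terms are the error of the level, the halved oscillation, and the atom [ex j], for
   which only the trivial bound 1 on the difference is available. *)
pose delta (m : nat) : R := m.+1%:R^-1 + D / 2 + rlev m.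
have jpos (m : nat) : (0 : R) < m.+1%:R^-1 by rewrite invr_gt0.
have delta0 m : 0 <= delta m.
  by rewrite /delta !addr_ge0// ?(ltW (jpos m)) ?(ltW (rlev_gt0 m)) ?divr_ge0.
have delta_mono m j : (m <= j)%N -> delta j <= delta m.
  move=> mj; rewrite /delta lerD//; last first.
    by rewrite /rlev lef_pV2 ?posrE ?ltr0n ?addn_gt0 ?orbT// ler_nat leq_add2r.
  by rewrite lerD2r lef_pV2 ?posrE// ler_nat ltnS.
have level j k k' : k \in K_ j -> k' \in K_ j ->
    wsum (step_law j) (fun a => h (gmul k a) - h (gmul k' a)) <= delta j.
  move=> kK kK'; rewrite step_lawE wsumB.
  have := hD j k k' kK kK'; have := h1 (gmul k (ex j)) (gmul k' (ex j)).
  have := rlev_gt0 j; have := rlev_lt1 j; have := jpos j; rewrite /delta.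
  set a := _ - _; set b := wsum _ _ - _; set i := _^-1; set r := rlev j => *.
  have : 0 <= i + D / 2 by lra.
  by nra.
have key m x x' n w : x \in base ex g0 m -> x' \in base ex g0 m -> all (mem (S_ m)) w ->
    (size w + n <= tlev m)%N ->
    h (gmul x (gprod w)) - h (gmul x' (gprod w)) <= (1 - qlev m) ^+ n + delta m.
  move=> xB xB'; have q0 := qlev_gt0 m.
  elim: n w => [|n IH] w wS wT.
    by rewrite expr0; have := h1 (gmul x (gprod w)) (gmul x' (gprod w)); have := delta0 m; lra.
  set y := gmul x _; set y' := gmul x' _.
  have yK : y \in K_ m by apply: Kw => //; apply: leq_trans wT; exact: leq_addr.
  have yK' : y' \in K_ m by apply: Kw => //; apply: leq_trans wT; exact: leq_addr.
  apply/ler_addgt0Pl => e e0; have [M0 hM0] := qlev_small e0.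
  pose M := maxn M0 m; have qM := hM0 M (leq_maxl _ _).
  have mM : (m <= M)%N by exact: leq_maxr.
  rewrite -(hh y) -(hh y').
  have /andP[_ u1] := mixture_approx step_law_prob M (fun a => h01 (gmul y a)).
  have /andP[u2 _] := mixture_approx step_law_prob M (fun a => h01 (gmul y' a)).
  pose d a := h (gmul y a) - h (gmul y' a).
  have ed : partmix step_law M d = partmix step_law M (fun a => h (gmul y a)) - partmix step_law M (fun a => h (gmul y' a)).
    by rewrite -partmixB.
  (* Levels below [m] continue the induction with a longer word, levels from [m] to [M] are high,
     and those from [M] on have mass at most [e]. *)
  have hd : partmix step_law M d <= (1 - qlev m) * ((1 - qlev m) ^+ n + delta m) + (qlev m - qlev M) * delta m.
    rewrite /partmix (big_cat_nat (n := m))//=; apply: lerD.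
      rewrite -(partmix_cst step_law_prob) -/(partmix _ _ _); apply: partmix_le => [|j p jm pj].
        exact: step_law_prob.
      rewrite /d /y /y' -!monoid.mulgA -gprod_rcons; apply: IH.
        by rewrite all_rcons wS andbT; exact: step_law_support pj.
      by rewrite size_rcons addSn -addnS.
    have -> : qlev m - qlev M = \sum_(m <= j < M) plev j.
      have := sum_plev M; rewrite (big_cat_nat (n := m))//= sum_plev; lra.
    rewrite mulr_suml big_nat [leRHS]big_nat; apply: ler_sum => j /andP[mj _].
    apply: ler_wpM2l; first exact/ltW/plev_gt0.
    by apply: le_trans (delta_mono _ _ mj); apply: level; exact: K_le mj _.
  have := delta0 m; have := qlev_gt0 M; rewrite exprS.
  move: u1 u2 ed hd qM; set P := _ ^+ n; set B := delta m; set qm := qlev m; set QM := qlev M.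
  set E1 := Ex _ _; set E2 := Ex _ _; set p1 := partmix _ _ _ ; set p2 := partmix _ _ _; set p3 := partmix _ _ _.
  move=> *; nra.
move=> x x'; apply/ler_addgt0Pl => e e0.
have [i ei] := exsurj x; have [i' ei'] := exsurj x'.
(* The errors are one [rlev m] for the time limit, one for the atom [ex j], and
   [1 / (m + 1) <= 25 * rlev m]: 27 in all. *)
have [M hM] := rlev_small (divr_gt0 e0 (ltr0Sn R 26)).
pose m := maxn M (maxn i i').+1.
have hr := hM m (leq_maxl _ _).
have inB z j : ex j = z -> (j <= maxn i i')%N -> z \in base ex g0 m.
  move=> <- hj; rewrite /base !in_cons; apply/orP; right; apply/orP; right.
  apply/mapP; exists j => //; rewrite mem_iota add0n /=.
  by apply: leq_trans (leq_maxr _ _); rewrite ltnS.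
have := key m x x' (tlev m) [::] (inB _ _ ei (leq_maxl _ _)) (inB _ _ ei' (leq_maxr _ _)) isT (leqnn _).
rewrite !monoid.mulg1 => h2; apply: le_trans h2 _.
have hj : m.+1%:R^-1 <= 25 * rlev m.
  rewrite /rlev -[X in X <= _]mul1r ler_pdivrMr ?ltr0n// mulrAC ler_pdivlMr ?ltr0n ?addn_gt0 ?orbT//.
  by rewrite mul1r -natrM ler_nat mulnS addnC leq_add2l leq_pmull.
have := tlevP m; rewrite /delta; move: hr hj.
set c := m.+1%:R^-1; set P := _ ^+ _; set r := rlev m; lra.
Qed.

Lemma contraction_constant :
  (forall D, (forall x y, h x - h y <= D) ->
    forall j k k', k \in K_ j -> k' \in K_ j ->
     wsum (A_ j) (fun a => h (gmul k a)) - wsum (A_ j) (fun a => h (gmul k' a))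
       <= j.+1%:R^-1 + D / 2) ->
  forall x y, h x = h y.
Proof.
move=> hD.
have osc n : forall x y, h x - h y <= 2^-1 ^+ n.
  elim: n => [|n IH] x y.
    by have /andP[a0 a1] := h01 x; have /andP[b0 b1] := h01 y; rewrite expr0; lra.
  rewrite exprSr; apply: osc_half; last by move=> *; exact: hD.
  by rewrite exprn_ge0.
have le x y : h x <= h y.
  apply/ler_addgt0Pl => e e0; have [|n hn] := @expr_small 2^-1 e _ e0; first by apply/andP; split; lra.
  by have := osc n x y; move: hn; lra.
by move=> x y; apply/eqP; rewrite eq_le !le.
Qed.

End Contraction.

(** * Memory of the starting point, for the product *)

Variable N : set G.
Hypothesis nN : normal_subgroup N.
Hypothesis ng0 : ~ N g0.
Hypothesis S1 : forall m k k' r r' p p', k \in K_ m -> k' \in K_ m -> r \in K_ m -> r' \in K_ m ->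
  List.In p (A_ m) -> List.In p' (A_ m) ->
  N (gmul (ginv (gmul (gmul k p.2) r)) (gmul (gmul k' p'.2) r')) -> N (gmul (ginv k) k').
Hypothesis S2 : forall m k k' r p, k \in K_ m -> k' \in K_ m -> r \in K_ m -> List.In p (A_ m) ->
  ~ N (gmul (ginv (gmul (gmul k p.2) r)) k').

Let N1 : N gone. Proof. by have [] := nN. Qed.
Let NM x y : N x -> N y -> N (gmul x y). Proof. by have [_ h _ _] := nN; exact: h. Qed.
Let NV x : N x -> N (ginv x). Proof. by have [_ _ h _] := nN; exact: h. Qed.

Let Ntrans x y z : N (gmul (ginv x) y) -> N (gmul (ginv y) z) -> N (gmul (ginv x) z).
Proof. by move=> h1 h2; have := NM h1 h2; rewrite -monoid.mulgA monoid.mulVKg. Qed.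

Let Nsym x y : N (gmul (ginv x) y) -> N (gmul (ginv y) x).
Proof. by move=> /NV; rewrite monoid.invgM monoid.invgK. Qed.

(* The elements reached from [N] by successive insertions [k |-> k a r]: decoding such an
   element level by level always leads back to [N]. *)
Fixpoint decoded n : set G :=
  if n is n'.+1 then decoded n' `|`
    [set x | exists k r p, [/\ k \in K_ n', r \in K_ n', List.In p (A_ n'), decoded n' k &
       N (gmul (ginv (gmul (gmul k p.2) r)) x)]]
  else N.

Let decN n x y : decoded n x -> N (gmul (ginv x) y) -> decoded n y.
Proof.
elim: n x y => [|n IH] x y /=; first by move=> Nx /(NM Nx); rewrite monoid.mulVKg.
move=> [hx|[k [r [p [kK rK pAn hk hx]]]]] hxy; first by left; exact: IH hxy.
by right; exists k, r, p; split => //; exact: Ntrans hxy.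
Qed.

Let Kone m : gone \in K_ m.
Proof.
by have := @Kw m gone [::] (mem_head _ _) isT (leq0n _); rewrite monoid.mulg1.
Qed.

Let Kg0 m : g0 \in K_ m.
Proof.
have := @Kw m g0 [::] _ isT (leq0n _); rewrite monoid.mulg1; apply.
by rewrite /base !in_cons eqxx orbT.
Qed.

Let decK n x : decoded n x -> exists2 k, k \in K_ n & N (gmul (ginv k) x).
Proof.
elim: n x => [|n IH] x /=.
  by move=> Nx; exists gone => //; rewrite monoid.invg1 monoid.mul1g.
move=> [/IH[k kK hk]|[k [r [p [kK rK pAn hk hx]]]]]; first by exists k => //; exact: Kmono.
by exists (gmul (gmul k p.2) r) => //; exact: Kar.
Qed.

Let dec_mono m n x : (m <= n)%N -> decoded m x -> decoded n x.
Proof.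
by move=> /subnK <- hx; elim: (n - m)%N => [|i IH]; [rewrite add0n|rewrite addSn; left].
Qed.

(** For elements of [K_ m] membership is settled at stage [m]: by [S2], a later insertion never
    falls into [K_ m] modulo [N]. *)
Let dec_stab m n k : k \in K_ m -> decoded n k -> decoded m k.
Proof.
move=> kK; have [nm|] := leqP n m; first exact: dec_mono.
elim: n => // n IH; rewrite ltnS leq_eqVlt => mn /= [].
  by case/predU1P: mn => [->//|/IH].
move=> [k' [r [p [kK' rK pAn _ hx]]]]; exfalso.
have mn' : (m <= n)%N by case/predU1P: mn => [->//|/ltnW].
exact: (S2 kK' (K_le mn' kK) rK pAn hx).
Qed.

Definition decoded_set : set G := \bigcup_n decoded n.

(** If [k a r] is decoded, it is so at stage [m.+1]. By [S2] it does not come from stage [m], so it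
    is another insertion [k' a' r'], and [S1] gives [k = k'] modulo [N]. *)
Lemma decoded_insert m k r p : k \in K_ m -> r \in K_ m -> List.In p (A_ m) ->
  decoded_set (gmul (gmul k p.2) r) <-> decoded_set k.
Proof.
move=> kK rK pAm; split=> [[n _]|[n _] /(dec_stab kK) hk]; last first.
  exists m.+1 => //; right; exists k, r, p; split => //.
  by rewrite monoid.mulVg.
move=> /(dec_stab (Kar kK rK pAm)) [/decK[k' kK' h]|[k' [r' [p' [kK' rK' pA' hk' h]]]]].
  by exfalso; apply: (S2 kK kK' rK pAm); exact: Nsym.
exists m => //; apply: decN hk' _.
exact: (S1 kK' kK rK' rK pA' pAm h).
Qed.

(** Passing from level [m] to [m.+1] changes the probability of [E] only through steps of level [m],
    of probability [rlev m]. Such a step does not change membership in [E], up to an error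
    [4 * rlev m], so the total increase is at most four times the sum of the [rlev m ^+ 2]. [E] is
    arbitrary because both the decoded set and its complement are used. *)
Lemma hitting_indicator_small (E : set G) g :
  (forall m k r p, k \in K_ m -> r \in K_ m -> List.In p (A_ m) ->
    E (gmul (gmul k p.2) r) <-> E k) ->
  (g = gone \/ g = g0) -> ~ E g ->
  forall m, hitting step_law m (\1_E) g <= 6^-1.
Proof.
move=> Eins gg nE.
have f01 x : 0 <= (\1_E x : R) <= 1 by rewrite indicE ler0n lern1 leq_b1.
have gB m : g \in base ex g0 m by rewrite /base !in_cons; case: gg => ->; rewrite eqxx ?orbT.
pose f : G -> R := \1_E; pose U m := hitting step_law m f.
have U01 m x : 0 <= U m x <= 1 by exact: hitting_unit step_law_prob m _ f01 x.
suff key m : U m g <= 4 * \sum_(0 <= j < m) rlev j ^+ 2.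
  by move=> m; apply: le_trans (key m) _; have := sum_rlev2 m; lra.
elim: m => [|m IH].
  rewrite big_geq// mulr0 /U (hittingE step_law_prob 0 f01) /low /partmix big_geq// addr0.
  by rewrite /f indicE memNset// mulr0.
have r0 := rlev_gt0 m; have r1 := rlev_lt1 m.
pose F y := wsum (step_law m) (fun a => U m.+1 (gmul y a)).
have F01 y : 0 <= F y <= 1.
  rewrite /F -{1}(wsum_cst 0 (step_law_prob m)) -[X in _ <= _ <= X](wsum_cst 1 (step_law_prob m)).
  have [w0 _] := step_law_prob m.
  by apply/andP; split; apply: wsum_le => // p _; have /andP[] := U01 m.+1 (gmul y p.2).
have hF01 x : 0 <= hitting step_law m F x <= 1 by exact: hitting_unit step_law_prob m _ F01 x.
have US x : U m.+1 x = (1 - rlev m) * U m x + rlev m * hitting step_law m F x.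
  exact: (hittingS step_law_prob m f01 x).
have Ule x : U m.+1 x <= U m x + rlev m.
  rewrite US; have /andP[a0 a1] := U01 m x; have /andP[b0 b1] := hF01 x; nra.
have KwS w : all (mem (S_ m)) w -> (size w <= tlev m)%N -> gprod w \in K_ m.
  by move=> wS wT; have := @Kw m gone w (mem_head _ _) wS wT; rewrite monoid.mul1g.
have Fle w : all (mem (S_ m)) w -> (size w <= tlev m)%N ->
    F (gmul g (gprod w)) <= f (gmul g (gprod w)) + 3 * rlev m.
  move=> wS wT; set x := gmul g (gprod w).
  have xK : x \in K_ m by exact: Kw.
  (* After the atom, a low word [v] within time [tlev m] lies in [K_ m], so membership in [E] is
     that of [x]; the time limit costs the first [rlev m]. *)
  have Ua p : List.In p (A_ m) -> U m (gmul x p.2) <= f x + rlev m.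
    move=> pAm; have fx := f01 x.
    have := @hitting_compare _ _ step_law_prob m f (fun=> f x) 0 (S_ m) (tlev m) f01 (fun=> fx) (lexx _).
    move=> /(_ (fun j p => @step_law_support m j p) (gmul x p.2)) hc.
    have {}hc : U m (gmul x p.2) <= hitting step_law m (fun=> f x) (gmul x p.2) + 0 + (1 - qlev m) ^+ tlev m.
      apply: hc => v vS vT; rewrite addr0 /f !indicE ler_nat.
      have vK := KwS _ vS vT; have e := Eins m x (gprod v) p xK vK pAm.
      case: (boolP (gmul (gmul x p.2) (gprod v) \in E)) => [|_]; last exact: leq0n.
      by rewrite inE => /e h; rewrite mem_set.
    have hc1 : hitting step_law m (fun=> f x) (gmul x p.2) = f x.
      apply/esym; apply: (hitting_uniq step_law_prob (v := fun=> f x)) => // y.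
      by rewrite /low partmix_cst; [lra|exact: step_law_prob].
    by have := tlevP m; move: hc; rewrite hc1; lra.
  (* The second [rlev m] pays for another step of level [m]; the third, in [F], for the atom
     [ex m]. *)
  have hA : wsum (A_ m) (fun a => U m.+1 (gmul x a)) <= f x + 2 * rlev m.
    rewrite -(wsum_cst (f x + 2 * rlev m) (pA m)); apply: wsum_le; first by have [] := pA m.
    by move=> p pAm; have := Ua p pAm; have := Ule (gmul x p.2); lra.
  rewrite /F step_lawE; have /andP[u0 u1] := U01 m.+1 (gmul x (ex m)).
  by have /andP[f0 f1] := f01 x; rewrite -/f in f0 f1; move: hA; nra.
(* The fourth [rlev m] is the time limit before the step of level [m]. *)
have hF : hitting step_law m F g <= U m g + 3 * rlev m + (1 - qlev m) ^+ tlev m.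
  apply: (hitting_compare step_law_prob F01 f01 _ (fun j p => @step_law_support m j p)) => //.
  by rewrite mulr_ge0// ltW.
rewrite US big_nat_recr//= mulrDr.
by have := tlevP m; have /andP[u0 u1] := U01 m g; move: IH hF; nra.
Qed.

Lemma mixture_not_liouville : ~ liouville nu.
Proof.
move=> L.
have f01 x : 0 <= (\1_decoded_set x : R) <= 1 by rewrite indicE ler0n lern1 leq_b1.
pose h x := LIM (fun m => hitting step_law m (\1_decoded_set) x).
have u01 m x : 0 <= hitting step_law m (\1_decoded_set) x <= 1.
  exact: hitting_unit step_law_prob m _ f01 x.
have h01 x : 0 <= h x <= 1 by exact: LIM_itv.
have hh := hitting_LIM_harmonic step_law_prob f01.
have e := L h h01 hh gone g0.
have h1 : h g0 <= 6^-1.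
  have : 0 <= h g0 <= 6^-1; last by case/andP.
  apply: LIM_itv => m; have /andP[-> _] := u01 m g0.
  apply: hitting_indicator_small; [exact: decoded_insert|by right|].
  by move=> [n _ /(dec_stab (Kg0 0))].
have h2 : 5 / 6 <= h gone.
  have : 5 / 6 <= h gone <= 1; last by case/andP.
  (* The lower bound at [gone] is the upper bound 1/6 for the complement of the decoded set. *)
  apply: LIM_itv => m; have /andP[_ ->] := u01 m gone; rewrite andbT.
  have := @hitting_indicator_small (~` decoded_set) gone _ (or_introl erefl) _ m.
  have -> : \1_(~` decoded_set) = (fun y => 1 - \1_decoded_set y) :> (G -> R).
    apply/funext => y; rewrite !indicE in_setC.
    by case: (y \in decoded_set); rewrite ?subrr ?subr0.
  rewrite (hitting_compl step_law_prob m f01) => hs.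
  suff : 1 - hitting step_law m (\1_decoded_set) gone <= 6^-1 by lra.
  apply: hs; last by apply; exists 0%N.
  by move=> j k r p kK rK pAj; have [i1 i2] := decoded_insert kK rK pAj; split => hn hd; apply: hn; [exact: i2|exact: i1].
by move: h1 h2; rewrite -e; lra.
Qed.

End SwitchingWalk.

(** * Marginals and the product *)

Section Marginals.
Variables (G1 G2 : groupType) (nu : prodG G1 G2 -> R).
Hypothesis pnu : prob_mass nu.

Let nu0 : forall x, 0 <= nu x. Proof. by have [] := pnu. Qed.
Let nu1 : (\esum_(x in [set: prodG G1 G2]) (nu x)%:E = 1)%E. Proof. by have [] := pnu. Qed.

Let esum_pair (a : prodG G1 G2 -> R) : (forall x, 0 <= a x) ->
  \esum_(x in [set: prodG G1 G2]) (a x)%:E =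
  \esum_(u in [set: G1]) \esum_(v in [set: G2]) (a (u, v))%:E.
Proof.
move=> a0; rewrite (@esum_esum R G1 G2 setT (fun=> setT) (fun u v => (a (u, v))%:E)); last first.
  by move=> u v; rewrite lee_fin.
rewrite (_ : _ `*`` _ = setT); last by apply/seteqP; split.
by apply: eq_esum => -[u v] _.
Qed.

Lemma pr1_massE u : (pr1_mass nu u)%:E = \esum_(v in [set: G2]) (nu (u, v))%:E.
Proof.
rewrite /pr1_mass fineK// ge0_fin_numE; last by apply: esum_ge0 => v _; rewrite lee_fin.
apply: (@le_lt_trans _ _ 1%E); last exact: ltry.
rewrite -nu1 esum_pair//.
rewrite -[leLHS](esum_set1 (t := u) (a := fun u => \esum_(v in [set: G2]) (nu (u, v))%:E)); last first.
  by apply: esum_ge0 => v _; rewrite lee_fin.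
rewrite esum_mkcond; apply: le_esum => w _; case: ifP => // _.
by apply: esum_ge0 => v _; rewrite lee_fin.
Qed.

Lemma pr1_mass_ge u v : nu (u, v) <= pr1_mass nu u.
Proof.
rewrite -lee_fin pr1_massE.
rewrite -[leLHS](esum_set1 (t := v) (a := fun v => (nu (u, v))%:E)) ?lee_fin//.
by rewrite esum_mkcond; apply: le_esum => w _; case: ifP => // _; rewrite lee_fin.
Qed.

Let pr1_mass_ge0 u : 0 <= pr1_mass nu u.
Proof. by apply: le_trans (pr1_mass_ge u gone). Qed.

Let esum_pr1 (f : G1 -> R) : (forall u, 0 <= f u) ->
  \esum_(u in [set: G1]) (pr1_mass nu u * f u)%:E =
  \esum_(x in [set: prodG G1 G2]) (nu x * f x.1)%:E.
Proof.
move=> f0; rewrite esum_pair; last by move=> x; rewrite mulr_ge0.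
apply: eq_esum => u _; rewrite EFinM pr1_massE muleC -esumZ//.
by apply: eq_esum => v _; rewrite mulrC.
Qed.

Lemma pr1_mass_prob : prob_mass (pr1_mass nu).
Proof.
split => //; have := esum_pr1 (f := fun=> 1) (fun=> ler01).
by under eq_esum do rewrite mulr1; move=> ->; under eq_esum do rewrite mulr1.
Qed.

Lemma Ex_pr1 (f : G1 -> R) : (forall u, 0 <= f u <= 1) ->
  Ex (pr1_mass nu) f = Ex nu (fun x => f x.1).
Proof.
move=> f01; have f0 u : 0 <= f u by have /andP[] := f01 u.
have bf := bnd_unit f01; have [m0 m1] := pr1_mass_prob.
apply: EFin_inj; rewrite !Ex_ge0E//; last exact: bnd_comp.
exact: esum_pr1.
Qed.

Lemma pr1_mass_non_degenerate : non_degenerate nu -> non_degenerate (pr1_mass nu).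
Proof.
move=> nd g; have [s [sne [spos sg]]] := nd (g, gone).
exists [seq x.1 | x <- s]; split; first by case: s sne {spos sg}.
split.
  move=> _ /mapP[[u v] xs ->]; exact: lt_le_trans (spos _ xs) (pr1_mass_ge u v).
have -> : foldr gmul gone [seq x.1 | x <- s] = (foldr gmul gone s).1.
  by elim: s {sne spos sg} => //= x s ->.
by rewrite sg.
Qed.

End Marginals.

Section Swap.
Variables G1 G2 : groupType.

(** Exchanging the factors turns the second marginal into a first one, so that only [pr1_mass] needs
    a direct study. *)
Definition swap_mass (nu : prodG G1 G2 -> R) : prodG G2 G1 -> R := fun x => nu (x.2, x.1).

Lemma esum_swap (a : prodG G1 G2 -> R) :
  \esum_(x in [set: prodG G1 G2]) (a x)%:E = \esum_(x in [set: prodG G2 G1]) (a (x.2, x.1))%:E.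
Proof.
rewrite (@reindex_esum _ _ _ [set: prodG G2 G1] _ (fun x => (x.2, x.1)))//.
split=> [x _//|[a1 a2] [b1 b2] _ _ [-> ->]//|[u v] _]; by exists (v, u).
Qed.

Lemma swap_prob nu : prob_mass nu -> prob_mass (swap_mass nu).
Proof. by move=> [h0 h1]; split=> [x|]; [exact: h0|rewrite -h1 (esum_swap nu)]. Qed.

Lemma Ex_swap nu (f : prodG G2 G1 -> R) : (forall x, 0 <= f x <= 1) -> prob_mass nu ->
  Ex (swap_mass nu) f = Ex nu (fun x => f (x.2, x.1)).
Proof.
move=> f01 pnu; have [s0 s1] := swap_prob pnu; have [n0 n1] := pnu.
have f0 u : 0 <= f u by have /andP[] := f01 u.
have bf := bnd_unit f01.
apply: EFin_inj; rewrite !Ex_ge0E//; last exact: bnd_comp.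
by rewrite [RHS](esum_swap (fun x => nu x * f (x.2, x.1))); apply: eq_esum => -[u v].
Qed.

Lemma swap_non_degenerate nu : non_degenerate nu -> non_degenerate (swap_mass nu).
Proof.
move=> nd [g1 g2]; have [s [sne [spos sg]]] := nd (g2, g1).
exists [seq (x.2, x.1) | x <- s]; split; first by case: s sne {spos sg}.
split; first by move=> _ /mapP[[u v] xs ->]; exact: (spos _ xs).
have -> : foldr gmul gone [seq ((x.2, x.1) : prodG G2 G1) | x <- s] =
    ((foldr gmul gone s).2, (foldr gmul gone s).1).
  by elim: s {sne spos sg} => //= x s ->.
by rewrite sg.
Qed.

Lemma pr2_massE nu : pr2_mass nu = pr1_mass (swap_mass nu). Proof. by []. Qed.

End Swap.

Lemma countable_prodG (G1 G2 : groupType) : countable_group G1 -> countable_group G2 ->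
  countable_group (prodG G1 G2).
Proof.
move=> [f1 inj1] [f2 inj2]; exists (fun x => choice.pickle (f1 x.1, f2 x.2)) => -[a b] [c d].
by move=> /(pcan_inj choice.pickleK) [/inj1 -> /inj2 ->].
Qed.

Section NoICCFactor.
Variables (G1 G2 : groupType) (nu : prodG G1 G2 -> R).
Hypotheses (pnu : prob_mass nu) (nd : non_degenerate nu).

Lemma liouville_of_fst : ~ has_nontrivial_ICC_factor G2 -> liouville (pr1_mass nu) ->
  liouville nu.
Proof.
move=> noICC L h h01 hh.
have bh := bnd_unit h01.
have inv : forall x a, h (gmul x ((gone, a) : prodG G1 G2)) = h x.
  apply: (@no_ICC_factor_invariant (prodG G1 G2) G2 (fun a => (gone, a)) snd nu h pnu nd) => //.
  - move=> a b; change ((gone, gmul a b) = (gmul gone gone, gmul a b) :> prodG G1 G2).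
    by rewrite monoid.mulg1.
  - move=> [y1 y2] a.
    change ((gmul (gmul (ginv y1) gone) y1, gmul (gmul (ginv y2) a) y2) =
      (gone, gmul (gmul (ginv y2) a) y2) :> prodG G1 G2).
    by rewrite monoid.mulg1 monoid.mulVg.
have hE u v : h (u, v) = h (u, gone).
  rewrite -(inv (u, gone) v); congr h.
  change ((u, v) = (gmul u gone, gmul gone v) :> prodG G1 G2).
  by rewrite monoid.mulg1 monoid.mul1g.
pose phi u := h (u, gone).
have hphi : harmonic (pr1_mass nu) phi.
  move=> u; rewrite Ex_pr1//; last by move=> ?; exact: h01.
  rewrite /phi -[RHS]hh; congr Ex; apply/funext => -[y1 y2].
  exact/esym/(hE (gmul u y1) (gmul gone y2)).
have cphi := L phi (fun u => h01 (u, gone)) hphi.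
by move=> [u v] [u' v']; rewrite hE (hE u' v'); exact: cphi.
Qed.

End NoICCFactor.

Lemma liouville_swap (G1 G2 : groupType) (nu : prodG G1 G2 -> R) : prob_mass nu ->
  liouville (swap_mass nu) -> liouville nu.
Proof.
move=> pnu L h h01 hh x y.
have := L (fun z => h (z.2, z.1)) (fun z => h01 (z.2, z.1)) _ (x.2, x.1) (y.2, y.1).
case: x y => [x1 x2] [y1 y2] /=; apply => -[z1 z2].
rewrite Ex_swap//.
by rewrite /= -[RHS]hh; congr Ex; apply/funext => -[w1 w2].
Qed.

Theorem theoremB (G1 G2 : groupType)
    (cG1 : countable_group G1) (cG2 : countable_group G2) :
  (exists nu : prodG G1 G2 -> R,
      [/\ prob_mass nu, non_degenerate nu, ~ boundary_trivial nu,
          boundary_trivial (pr1_mass nu) & boundary_trivial (pr2_mass nu)])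
  <->
  [/\ amenable G1, amenable G2,
      has_nontrivial_ICC_factor G1 & has_nontrivial_ICC_factor G2].
Proof.
have cG := countable_prodG cG1 cG2.
split.
  move=> [nu [pnu nd nbt]]; rewrite pr2_massE => bt1 bt2.
  have ps := swap_prob pnu; have sd := swap_non_degenerate nd.
  have L1 := boundary_trivial_liouville cG1 (pr1_mass_prob pnu) (pr1_mass_non_degenerate pnu nd) bt1.
  have L2 := boundary_trivial_liouville cG2 (pr1_mass_prob ps) (pr1_mass_non_degenerate ps sd) bt2.
  have nL : ~ liouville nu by move=> L; apply: nbt; exact: liouville_boundary_trivial.
  split.
  - exact: liouville_amenable (pr1_mass_prob pnu) L1.
  - exact: liouville_amenable (pr1_mass_prob ps) L2.
  - apply: contrapT => h; apply: nL; apply: (liouville_swap pnu).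
    exact: liouville_of_fst ps sd h L2.
  - apply: contrapT => h; apply: nL; exact: liouville_of_fst pnu nd h L1.
move=> [a1 a2 [N1 [nN1 NT1 icc1]] [N2 [nN2 NT2 icc2]]].
have nN : normal_subgroup (modset N1 N2).
  have [e1 m1 v1 j1] := nN1; have [e2 m2 v2 j2] := nN2.
  split; first by split; [exact: e1|exact: e2].
  - by move=> x y [hx1 hx2] [hy1 hy2]; split; [exact: m1|exact: m2].
  - by move=> x [hx1 hx2]; split; [exact: v1|exact: v2].
  - by move=> g x [hx1 hx2]; split; [exact: j1|exact: j2].
(* An element outside [N1], made into [g0 = (n1, gone)]: a second starting point, differing from the
   identity modulo [N1] and [N2]. *)
have [n1 nn1] : exists n, ~ N1 n.
  apply: contrapT => /forallNP h; apply: NT1; apply/seteqP; split=> // x _.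
  exact: contrapT (h x).
have ng0 : ~ modset N1 N2 (n1, gone) by case.
have [ex exsurj] := exists_enum cG.
have [A_ [K_ [S_ [hQ Kmono Kar Kw SA]]]] := tower ex (n1, gone)
  (switching_level cG1 cG2 a1 a2 nN1 nN2 icc1 icc2 NT1 NT2).
have pA m : wprob (A_ m) by have [] := hQ m.
pose nu := mixture (step_law ex A_).
have pnu : prob_mass nu by exact: mixture_prob (step_law_prob ex pA).
have ndnu : non_degenerate nu by exact: mixture_non_degenerate.
have cc (h : prodG G1 G2 -> R) := @contraction_constant _ ex (n1, gone) exsurj A_ K_ S_ pA Kmono Kw SA h.
exists nu; split => //.
- move=> /(boundary_trivial_liouville cG pnu ndnu).
  apply: (@mixture_not_liouville _ ex (n1, gone) A_ K_ S_ pA Kmono Kar Kw SA _ nN ng0).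
  + by move=> m; have [] := hQ m.
  + by move=> m; have [] := hQ m.
- apply: (liouville_boundary_trivial cG1 (pr1_mass_prob pnu)) => f f01 hf.
  have f1 u : `|f u| <= 1 by have /andP[p0 p1] := f01 u; rewrite ger0_norm.
  (* The contraction is run on the product, for the lift of [f]; only the averaging property of the
     levels is specific to the factor. *)
  have hh : harmonic nu (fun x => f x.1).
    by move=> x; rewrite -[RHS]hf Ex_pr1// => u; exact: f01.
  have c := cc (fun x => f x.1) (fun x => f01 x.1) hh.
  suff e : forall x y : prodG G1 G2, f x.1 = f y.1 by move=> u v; exact: (e (u, gone) (v, gone)).
  apply: c => D hD j k k' kK kK'; have [_ _ _ I1 _] := hQ j.
  by apply: I1 => // u v; exact: (hD (u, gone) (v, gone)).
- rewrite pr2_massE; have ps := swap_prob pnu.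
  apply: (liouville_boundary_trivial cG2 (pr1_mass_prob ps)) => f f01 hf.
  have f1 u : `|f u| <= 1 by have /andP[p0 p1] := f01 u; rewrite ger0_norm.
  have hh : harmonic nu (fun x => f x.2).
    by move=> x; rewrite -[RHS]hf Ex_pr1// Ex_swap.
  have c := cc (fun x => f x.2) (fun x => f01 x.2) hh.
  suff e : forall x y : prodG G1 G2, f x.2 = f y.2 by move=> u v; exact: (e (gone, u) (gone, v)).
  apply: c => D hD j k k' kK kK'; have [_ _ _ _ I2] := hQ j.
  by apply: I2 => // u v; exact: (hD (gone, u) (gone, v)).
Qed.
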